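(* (Purity of Characteristic Variety) Let $k$ be a field and let $A$ be a filtered $k$-algebra such that $\operatorname{gr}A$ is a commutative connected graded affine $k$-algebra. If $M$ is a finitely generated $\operatorname{GKdim}$-pure left $A$-module, then the characteristic variety $\operatorname{Ch}M$ is pure, i.e. all its irreducible components have the same dimension.
   Context: A filtered $k$-algebra is a $k$-algebra $A$ (associative with $1$) with an increasing filtration $\{F_nA\}_{n\in\mathbb Z}$ by $k$-subspaces with $1\in F_0A$, $F_nA\cdot F_mA\subset F_{n+m}A$, $\bigcap_nF_nA=0$, $\bigcup_nF_nA=A$; $\operatorname{gr}A=\bigoplus_nF_nA/F_{n-1}A$. Connected graded means $\operatorname{gr}A$ is concentrated in degrees $\ge0$, with degree $0$ component $k$ and all components of finite rank over $k$. Affine means finitely generated as a $k$-algebra. $\operatorname{GKdim}$ is Gelfand-Kirillov dimension. A module $M$ is $\operatorname{GKdim}$-pure if $\operatorname{GKdim}M'=\operatorname{GKdim}M$ for every nonzero submodule $M'\subset M$. A filtration on an $A$-module $M$ is an increasing filtration $\{F_nM\}_{n \in \mathbb{Z}}$ by $k$-subspaces with $F_nA\cdot F_mM\subset F_{n+m}M$, $\bigcap_nF_nM=0$, $\bigcup_nF_nM=M$. It is good if the Rees module $\bigoplus_nF_nM\cdot t^n\subset M[t,t^{-1}]$ is finitely generated over the Rees algebra $\bigoplus_nF_nA\cdot t^n\subset A[t,t^{-1}]$. For a finitely generated $A$-module $M$, let $I(M)\subset\operatorname{gr}A$ be the prime radical of the ideal $\operatorname{Ann}_{\operatorname{gr}A}(\operatorname{gr}^FM)$,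 where $F$ is any good filtration on $M$ (this is independent of the choice of $F$). The characteristic variety is $\operatorname{Ch}(M)=\operatorname{Spec}(\operatorname{gr}A/I(M))$. *)

(* Defs.v *)
From HB Require Import structures.
From mathcomp Require Import all_boot all_order all_algebra.
From mathcomp Require Import all_classical all_reals all_analysis.
Set Implicit Arguments.
Unset Strict Implicit.
Unset Printing Implicit Defensive.
Import Order.TTheory GRing.Theory Num.Theory.
Local Open Scope classical_set_scope.
Local Open Scope ring_scope.

Section LinearAlgebra.
Variables (R : pzRingType) (V : lmodType R).

Definition lspan (X : set V) : set V :=
  smallest [set S : set V | submod_closed (mem S)] X.

Definition finite_rank (U : set V) : Prop :=
  exists s : seq V, U = lspan [set` s].

Definition finitely_generated : Prop := finite_rank [set: V].

Definition annihilator : set R := [set r | forall v : V, r *: v = 0].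

Definition lin_indep (s : seq V) : Prop :=
  forall c : 'I_(size s) -> R,
    \sum_(i < size s) c i *: s`_i = 0 -> forall i, c i = 0.

(* The dimension of a subspace [U], [+oo] if it is infinite. *)
Definition ldim (K : realType) (U : set V) : \bar K :=
  ereal_sup [set (size s)%:R%:E | s in
    [set s : seq V | lin_indep s /\ [set` s] `<=` U]].

End LinearAlgebra.

Definition affine_algebra (k : pzRingType) (B : algType k) : Prop :=
  exists s : seq B,
    smallest [set S : set B | subalg_closed (mem S)] [set` s] = [set: B].

(* An [A]-module seen as a module over the ground ring [k] of [A]. *)
Definition restrict_scalars (k : pzRingType) (A : algType k) (M : lmodType A)
  : Type := M.

Section RestrictScalars.
Variables (k : pzRingType) (A : algType k) (M : lmodType A).
Local Notation kM := (restrict_scalars M).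

HB.instance Definition _ := GRing.Zmodule.on kM.

Definition rs_scale (c : k) (m : kM) : kM := c%:A *: (m : M).

Fact rs_scaleA a b v : rs_scale a (rs_scale b v) = rs_scale (a * b) v.
Proof. by rewrite /rs_scale scalerA -scalerAl mul1r scalerA. Qed.

Fact rs_scale1 : left_id 1 rs_scale.
Proof. by move=> v; rewrite /rs_scale !scale1r. Qed.

Fact rs_scaleDr : right_distributive rs_scale +%R.
Proof. by move=> a u v; rewrite /rs_scale scalerDr. Qed.

Fact rs_scaleDl v : {morph rs_scale^~ v : a b / a + b}.
Proof. by move=> a b; rewrite /rs_scale !scalerDl. Qed.

HB.instance Definition _ := GRing.Zmodule_isLmodule.Build k kM
  rs_scaleA rs_scale1 rs_scaleDr rs_scaleDl.

End RestrictScalars.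

Section GelfandKirillov.
Variables (K : realType) (k : fieldType) (A : algType k) (M : lmodType A).

Definition words (s : seq A) (n : nat) : set A :=
  [set \prod_(a <- u) a | u in
    [set u : seq A | (size u <= n)%N /\ {subset u <= s}]].

(* If [V] is the subspace of [A] spanned by [s], and [W] the subspace of [M]
   spanned by [t], this is [W + V W + ... + V^n W]. *)
Definition word_span (s : seq A) (t : seq M) (n : nat)
  : set (restrict_scalars M) :=
  lspan (V := restrict_scalars M)
    [set (a *: m : M) | a in words s n & m in [set` t]].

(* The Gelfand-Kirillov dimension of a submodule [N] of [M]: the supremum of
   limsup log_n (dim (W + V W + ... + V^n W)) over the finite dimensional
   subspaces [V] of [A] and [W] of [N]. *)
Definition GKdim (N : set M) : \bar K :=
  ereal_sup [set d | exists (s : seq A) (t : seq M), [set` t] `<=` N /\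
    d = limn_esup
      (fun n => lne (ldim K (word_span s t n)) * ((ln n%:R)^-1)%:E)%E].

Definition GKdim_pure : Prop :=
  forall N : set M, submod_closed (mem N) -> N <> [set 0] ->
    GKdim N = GKdim [set: M].

End GelfandKirillov.

Record filtration (k : fieldType) (A : algType k) := Filtration {
  filt :> int -> set A;
  filt_submod : forall n, submod_closed (mem (filt n));
  filt_le : forall m n, (m <= n)%R -> filt m `<=` filt n;
  filt1 : filt 0 1;
  filtM : forall m n a b, filt m a -> filt n b -> filt (m + n) (a * b);
  filt_bigcap : \bigcap_(n in [set: int]) filt n = [set 0];
  filt_bigcup : \bigcup_(n in [set: int]) filt n = [set: A] }.

Record mod_filtration (k : fieldType) (A : algType k) (F : filtration A)
    (M : lmodType A) := ModFiltration {
  mfilt :> int -> set M;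
  mfilt_submod :
    forall n, submod_closed (mem (mfilt n : set (restrict_scalars M)));
  mfilt_le : forall m n, (m <= n)%R -> mfilt m `<=` mfilt n;
  mfiltZ : forall m n a x, F m a -> mfilt n x -> mfilt (m + n) (a *: x);
  mfilt_bigcap : \bigcap_(n in [set: int]) mfilt n = [set 0];
  mfilt_bigcup : \bigcup_(n in [set: int]) mfilt n = [set: M] }.

(* A Laurent polynomial [\sum_n x_n t^n] is represented by the finitely
   supported function [n |-> x_n]; [lconv] is the product of a Laurent polynomial
   with coefficients in [A] and one with coefficients in [M]. *)
Definition fin_supp (V : zmodType) (x : int -> V) : Prop :=
  finite_set [set n | x n != 0].

Definition lconv (A : pzRingType) (M : lmodType A) (x : int -> A) (m : int -> M)
  : int -> M := fun n => \sum_(i \in [set: int]) x i *: m (n - i).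

Section Convolution.
Variables (A : pzRingType).

Lemma fin_suppP (V : zmodType) (x : int -> V) :
  fin_supp x <-> exists r : seq int, forall n, n \notin r -> x n = 0.
Proof.
split=> [/finite_seqP[r rE]|[r rE]].
  exists r => n nr; apply/eqP/negPn/negP => xn.
  by move: (xn : [set n | x n != 0] n); rewrite rE /= (negbTE nr).
apply: (@sub_finite_set _ _ [set` r]); last exact: finite_seq.
move=> n /= xn; apply/negPn/negP => nr; by rewrite rE ?eqxx in xn.
Qed.

Section Module.
Variable (M : lmodType A).
Implicit Types (x y : int -> A) (m : int -> M).

Lemma conv_seq (r : seq int) x m n :
    uniq r -> (forall i, i \notin r -> x i = 0) ->
  lconv x m n = \sum_(i <- r) x i *: m (n - i).
Proof.
move=> ur xr; rewrite /lconv (fsbigE r) //; last first.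
  by move=> i _ /xr ->; rewrite scale0r.
by apply: eq_bigl => i; rewrite in_setT.
Qed.

Lemma fin_supp_seq (V : zmodType) (x : int -> V) : fin_supp x ->
  exists2 r : seq int, uniq r & forall n, n \notin r -> x n = 0.
Proof.
move=> /fin_suppP[r xr]; exists (undup r); first exact: undup_uniq.
by move=> n; rewrite mem_undup; apply: xr.
Qed.

Lemma conv_supp x m : fin_supp x -> fin_supp m -> fin_supp (lconv x m).
Proof.
move=> /fin_supp_seq[r ur xr] /fin_supp_seq[s us ms].
apply/fin_suppP; exists [seq i + j | i <- r, j <- s] => n nrs.
rewrite (conv_seq _ _ ur xr) big_seq big1// => i ir.
rewrite ms ?scaler0//; apply: contra nrs => js.
by apply/allpairsP; exists (i, n - i); split=> //=; rewrite addrC subrK.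
Qed.

Lemma convDr x m1 m2 : fin_supp x ->
  lconv x (fun n => m1 n + m2 n) = (fun n => lconv x m1 n + lconv x m2 n).
Proof.
move=> /fin_supp_seq[r ur xr]; apply/funext => n.
rewrite !(conv_seq _ _ ur xr) -big_split; apply: eq_bigr => i _ /=.
by rewrite scalerDr.
Qed.

Lemma convDl x y m : fin_supp x -> fin_supp y ->
  lconv (fun n => x n + y n) m = (fun n => lconv x m n + lconv y m n).
Proof.
move=> /fin_supp_seq[r ur xr] /fin_supp_seq[s us ys]; apply/funext => n.
have uu : uniq (undup (r ++ s)) by exact: undup_uniq.
have xu i : i \notin undup (r ++ s) -> x i = 0.
  by rewrite mem_undup mem_cat negb_or => /andP[/xr].
have yu i : i \notin undup (r ++ s) -> y i = 0.
  by rewrite mem_undup mem_cat negb_or => /andP[_ /ys].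
rewrite !(conv_seq _ _ uu) -?big_split//=; last first.
  by move=> i iu; rewrite xu// yu// addr0.
by apply: eq_bigr => i _; rewrite scalerDl.
Qed.

Definition lmono (V : zmodType) (i : int) (v : V) : int -> V :=
  fun n => if n == i then v else 0.

Lemma mono_supp (V : zmodType) i (v : V) : fin_supp (lmono i v).
Proof.
by apply/fin_suppP; exists [:: i] => n; rewrite inE /lmono => /negbTE ->.
Qed.

Lemma conv_mono i a m n : lconv (lmono i a) m n = a *: m (n - i).
Proof.
rewrite (@conv_seq [:: i]) ?big_seq1 /lmono ?eqxx// => j.
by rewrite inE => /negbTE ->.
Qed.

End Module.

Lemma convA (M : lmodType A) (x y : int -> A) (m : int -> M) : fin_supp x -> fin_supp y ->
  lconv x (lconv y m) = lconv (lconv x (y : int -> A^o) : int -> A) m.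
Proof.
move=> fx fy; have fxy := @conv_supp A^o x y fx fy.
have [r ur xr] := fin_supp_seq fx; have [s us ys] := fin_supp_seq fy.
have [u uu xyu] := fin_supp_seq fxy; apply/funext => n.
pose w := undup (u ++ [seq i + j | i <- r, j <- s]).
have uw : uniq w by exact: undup_uniq.
have xyw i : i \notin w -> (lconv x (y : int -> A^o) : int -> A) i = 0.
  by rewrite mem_undup mem_cat negb_or => /andP[/xyu].
rewrite (conv_seq _ _ ur xr) (conv_seq _ _ uw xyw).
under [RHS]eq_bigr => i _ do rewrite (conv_seq _ _ ur xr) scaler_suml.
rewrite exchange_big big_seq [RHS]big_seq; apply: eq_bigr => i ir.
under [RHS]eq_bigr => j _ do rewrite -scalerA.
rewrite -scaler_sumr; congr (_ *: _).
have ur' : uniq [seq i + j | j <- s] by rewrite map_inj_uniq//; exact: addrI.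
rewrite (conv_seq _ _ us ys).
transitivity (\sum_(j <- [seq i + j | j <- s]) y (j - i) *: m (n - j)).
  rewrite big_map; apply: eq_bigr => j _.
  by rewrite opprD addrA [i + j]addrC addrK.
have ym (j : int) : j \notin [seq i + j | j <- s] -> y (j - i) = 0.
  move=> js; apply: ys; apply: contra js => js.
  by apply/mapP; exists (j - i); rewrite // addrC subrK.
pose f (j : int) := y (j - i) : A.
rewrite -(@conv_seq M _ f m n ur' ym); apply: conv_seq => // j jw; apply: ym.
apply: contra jw => /mapP[l ls ->]; rewrite mem_undup mem_cat; apply/orP; right.
by apply/allpairsP; exists (i, l).
Qed.

Lemma conv1 (x : int -> A) : fin_supp x -> lconv x (lmono 0 (1 : A^o)) = x.
Proof.
move=> /fin_supp_seq[r ur xr]; apply/funext => n; rewrite (conv_seq _ _ ur xr).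
have [nr|nr] := boolP (n \in r).
  rewrite (bigD1_seq n)//= subrr /lmono eqxx big1 ?addr0 ?[_ *: _]mulr1//.
  by move=> i /negbTE ni; rewrite subr_eq0 eq_sym ni scaler0.
rewrite xr// big_seq big1// => i ir; rewrite /lmono subr_eq0.
by case: eqP => [ni|_]; rewrite ?scaler0//; rewrite ni ir in nr.
Qed.

End Convolution.

Section FinSupp.
Variable V : zmodType.
Implicit Types x y : int -> V.

Lemma fin_supp0 : fin_supp (fun=> 0 : V).
Proof. by apply/fin_suppP; exists [::]. Qed.

Lemma fin_suppD x y : fin_supp x -> fin_supp y -> fin_supp (fun n => x n + y n).
Proof.
move=> /fin_suppP[r xr] /fin_suppP[s ys]; apply/fin_suppP; exists (r ++ s) => n.
by rewrite mem_cat negb_or => /andP[/xr -> /ys ->]; rewrite addr0.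
Qed.

Lemma fin_suppZ (k : pzRingType) (W : lmodType k) (a : k) (x : int -> W) :
  fin_supp x -> fin_supp (fun n => a *: x n).
Proof.
move=> /fin_suppP[r xr]; apply/fin_suppP; exists r => n /xr ->.
by rewrite scaler0.
Qed.

End FinSupp.

Section SubmodMem.
Variables (R : pzRingType) (V : lmodType R) (N : set V).
Hypothesis NP : submod_closed (mem N).

Lemma submod_mem0 : N 0.
Proof. by case: NP => + _; rewrite inE. Qed.

Lemma submod_memP a u v : N u -> N v -> N (a *: u + v).
Proof. by case: NP => _ H Nu Nv; have := H a u v; rewrite !inE; apply. Qed.

Lemma submod_memD u v : N u -> N v -> N (u + v).
Proof. by move=> Nu Nv; rewrite -[u]scale1r; exact: submod_memP. Qed.

Lemma submod_memZ a u : N u -> N (a *: u).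
Proof.
by move=> Nu; rewrite -[_ *: _]addr0; apply: submod_memP => //; exact: submod_mem0.
Qed.

Lemma submod_memN u : N u -> N (- u).
Proof. by move=> Nu; rewrite -scaleN1r; exact: submod_memZ. Qed.

Lemma submod_mem_sum (I : Type) (r : seq I) (P : pred I) (f : I -> V) :
  (forall i, P i -> N (f i)) -> N (\sum_(i <- r | P i) f i).
Proof.
by move=> H; elim/big_ind: _ => //; [exact: submod_mem0 | exact: submod_memD].
Qed.

End SubmodMem.

(* The Rees algebra [\bigoplus_n F_n A t^n], inside [A[t, t^-1]]. *)
Section Rees.
Variables (k : fieldType) (A : algType k) (F : filtration A).

Definition rees_pred : pred (int -> A) :=
  fun x => `[< fin_supp x /\ forall n, F n (x n) >].

Fact rees_submod_closed : submod_closed rees_pred.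
Proof.
split; first by apply/asboolP; split=> [|n];
  [exact: fin_supp0 | exact: submod_mem0 (filt_submod F n)].
move=> a x y /asboolP[fx Fx] /asboolP[fy Fy]; apply/asboolP; split.
  by apply: fin_suppD => //; exact: fin_suppZ.
by move=> n; apply: submod_memP (filt_submod F n) _ _ _ (Fx n) (Fy n).
Qed.

HB.instance Definition _ :=
  GRing.isSubmodClosed.Build k (int -> A) rees_pred rees_submod_closed.

Record rees := Rees { rees_coef :> int -> A; _ : rees_coef \in rees_pred }.

HB.instance Definition _ := [isSub for rees_coef].
HB.instance Definition _ := [Choice of rees by <:].
HB.instance Definition _ := [SubChoice_isSubLmodule of rees by <:].

Lemma rees_supp (x : rees) : fin_supp x.
Proof. by case: x => x /= /asboolP[]. Qed.

Lemma rees_filt (x : rees) n : F n (x n).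
Proof. by case: x => x /= /asboolP[]. Qed.

Lemma rees_eq (x y : rees) : x = y :> (int -> A) -> x = y.
Proof. exact: val_inj. Qed.

Fact rees_mono_in n a : F n a -> lmono n a \in rees_pred.
Proof.
move=> Fa; apply/asboolP; split; first exact: mono_supp.
by move=> i; rewrite /lmono; case: eqP => [->|_]//; exact: submod_mem0 (filt_submod F i).
Qed.

(* The monomial [a t^n]. *)
Definition rees_mono n a (Fa : F n a) : rees := Rees (rees_mono_in Fa).

Fact rees_mul_in (x y : rees) : lconv x (y : int -> A^o) \in rees_pred.
Proof.
have fx := rees_supp x; have fy := rees_supp y; apply/asboolP; split.
  exact: (@conv_supp A A^o).
move=> n; have [r ur xr] := fin_supp_seq fx.
rewrite (@conv_seq A A^o r)//; apply: submod_mem_sum (filt_submod F n) _ _ _ _ _.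
move=> i _; have := filtM (rees_filt x i) (rees_filt y (n - i)).
by rewrite addrC subrK.
Qed.

Definition rees_one : rees := rees_mono (filt1 F).
Definition rees_mul (x y : rees) : rees := Rees (rees_mul_in x y).

Fact rees_mulA : associative rees_mul.
Proof.
move=> x y z; apply: rees_eq; apply: (@convA A A^o); exact: rees_supp.
Qed.

Fact rees_mul1x : left_id rees_one rees_mul.
Proof.
move=> x; apply: rees_eq; apply/funext => n /=.
by rewrite conv_mono subr0 scale1r.
Qed.

Fact rees_mulx1 : right_id rees_one rees_mul.
Proof. by move=> x; apply: rees_eq; apply: conv1; exact: rees_supp. Qed.

Fact rees_mulDl : left_distributive rees_mul +%R.
Proof.
by move=> x y z; apply: rees_eq; apply: (@convDl A A^o); exact: rees_supp.
Qed.

Fact rees_mulDr : right_distributive rees_mul +%R.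
Proof.
by move=> x y z; apply: rees_eq; apply: (@convDr A A^o); exact: rees_supp.
Qed.

Lemma filtN1 : ~ F (-1) 1.
Proof.
move=> F1; have Fn (n : nat) : F (- n%:Z) 1.
  elim: n => [|n IH]; first exact: filt1.
  by have := filtM F1 IH; rewrite mulr1 -opprD -intS.
suff : (\bigcap_(n in [set: int]) F n) 1.
  by rewrite filt_bigcap => /= /eqP; rewrite oner_eq0.
move=> n _; apply: (filt_le _ (Fn `|n|%N)).
by rewrite abszE lerNl -normrN ler_norm.
Qed.

Fact rees_oner_neq0 : rees_one != 0.
Proof.
apply/eqP => /(congr1 (fun x : rees => x 0)) /=; rewrite /lmono eqxx.
by move=> /eqP; rewrite oner_eq0.
Qed.

HB.instance Definition _ := GRing.Zmodule_isNzRing.Build rees rees_mulA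
  rees_mul1x rees_mulx1 rees_mulDl rees_mulDr rees_oner_neq0.

Lemma rees_mulE (x y : rees) : x * y = lconv x (y : int -> A^o) :> (int -> A).
Proof. by []. Qed.

Lemma rees_coefZ (a : k) (x : rees) n : (a *: x) n = a *: x n.
Proof. by []. Qed.

Fact rees_scaleAl (a : k) (x y : rees) : a *: (x * y) = (a *: x) * y.
Proof.
apply: rees_eq; have [r ur xr] := fin_supp_seq (rees_supp x).
apply/funext => n; rewrite rees_coefZ !rees_mulE.
rewrite !(@conv_seq A A^o r)//; last first.
  by move=> i ir; rewrite rees_coefZ xr// scaler0.
by rewrite scaler_sumr; apply: eq_bigr => i _; rewrite rees_coefZ [LHS]scalerAl.
Qed.

Fact rees_scaleAr (a : k) (x y : rees) : a *: (x * y) = x * (a *: y).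
Proof.
apply: rees_eq; have [r ur xr] := fin_supp_seq (rees_supp x).
apply/funext => n; rewrite rees_coefZ !rees_mulE !(@conv_seq A A^o r)//.
by rewrite scaler_sumr; apply: eq_bigr => i _; rewrite rees_coefZ [LHS]scalerAr.
Qed.

HB.instance Definition _ := GRing.Lmodule_isLalgebra.Build k rees rees_scaleAl.
HB.instance Definition _ := GRing.Lalgebra_isAlgebra.Build k rees rees_scaleAr.

End Rees.

(* [gr A = \bigoplus_n F_n A / F_(n-1) A], as the quotient of the Rees algebra
   by its graded ideal [\bigoplus_n F_(n-1) A t^n]. *)
Section AssociatedGraded.
Variables (k : fieldType) (A : algType k) (F : filtration A).

Definition gr_ker : pred (rees F) :=
  fun x => `[< forall n, F (n - 1) (x n) >].

Fact gr_ker_submod_closed : submod_closed gr_ker.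
Proof.
split; first by apply/asboolP => n; exact: submod_mem0 (filt_submod F _).
move=> a x y /asboolP Fx /asboolP Fy; apply/asboolP => n.
exact: submod_memP (filt_submod F _) _ _ _ (Fx n) (Fy n).
Qed.

HB.instance Definition _ :=
  GRing.isSubmodClosed.Build k (rees F) gr_ker gr_ker_submod_closed.

Lemma gr_kerM (x y : rees F) : y \in gr_ker -> x * y \in gr_ker.
Proof.
move=> /asboolP Fy; apply/asboolP => n.
have [r ur xr] := fin_supp_seq (rees_supp x).
rewrite rees_mulE (@conv_seq A A^o r)//.
apply: submod_mem_sum (filt_submod F _) _ _ _ _ _ => i _.
have := filtM (rees_filt x i) (Fy (n - i)).
by rewrite !addrA [i + n]addrC addrK.
Qed.

Lemma gr_kerMr (x y : rees F) : x \in gr_ker -> x * y \in gr_ker.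
Proof.
move=> /asboolP Fx; apply/asboolP => n.
have [r ur xr] := fin_supp_seq (rees_supp x).
rewrite rees_mulE (@conv_seq A A^o r)//.
apply: submod_mem_sum (filt_submod F _) _ _ _ _ _ => i _.
have := filtM (Fx i) (rees_filt y (n - i)).
by rewrite addrC addrA subrK.
Qed.

Local Open Scope quotient_scope.
Local Notation gr_quot :=
  {ideal_quot (GRing.ZmodClosed.clone (rees F) gr_ker _)}.

Definition gr : Type := gr_quot.

HB.instance Definition _ := GRing.Zmodule.on gr.

Definition gr_pi (x : rees F) : gr := \pi_(gr_quot) x.
Definition gr_repr (x : gr) : rees F := repr (x : gr_quot).

Lemma gr_reprK x : gr_pi (gr_repr x) = x.
Proof. exact: reprK. Qed.

Lemma gr_piP (x y : rees F) : gr_pi x = gr_pi y <-> x - y \in gr_ker.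
Proof. by rewrite Quotient.idealrBE; split=> /eqP. Qed.

Lemma gr_reprP x : gr_repr (gr_pi x) - x \in gr_ker.
Proof. by apply/gr_piP; exact: gr_reprK. Qed.

Lemma gr_piD x y : gr_pi (x + y) = gr_pi x + gr_pi y.
Proof. exact: (raddfD (\pi_(gr_quot))). Qed.

Definition gr_one : gr := gr_pi 1.
Definition gr_mul (x y : gr) : gr := gr_pi (gr_repr x * gr_repr y).
Definition gr_scale (a : k) (x : gr) : gr := gr_pi (a *: gr_repr x).

Lemma gr_mulE x y : gr_mul (gr_pi x) (gr_pi y) = gr_pi (x * y).
Proof.
apply/gr_piP; set x' := gr_repr _; set y' := gr_repr _.
rewrite -[X in X - _](subrK (x' * y)) -mulrBr -addrA -mulrBl.
exact: rpredD (gr_kerM _ (gr_reprP y)) (gr_kerMr _ (gr_reprP x)).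
Qed.

Lemma gr_scaleE a x : gr_scale a (gr_pi x) = gr_pi (a *: x).
Proof.
by apply/gr_piP; rewrite -scalerBr; exact: rpredZ (gr_reprP x).
Qed.

Lemma gr_ind (P : gr -> Prop) : (forall x, P (gr_pi x)) -> forall x, P x.
Proof. by move=> H x; rewrite -[x]gr_reprK. Qed.

Fact gr_mulA : associative gr_mul.
Proof.
elim/gr_ind=> x; elim/gr_ind=> y; elim/gr_ind=> z.
by rewrite !gr_mulE mulrA.
Qed.

Fact gr_mul1x : left_id gr_one gr_mul.
Proof. by elim/gr_ind=> x; rewrite gr_mulE mul1r. Qed.

Fact gr_mulx1 : right_id gr_one gr_mul.
Proof. by elim/gr_ind=> x; rewrite gr_mulE mulr1. Qed.

Fact gr_mulDl : left_distributive gr_mul +%R.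
Proof.
elim/gr_ind=> x; elim/gr_ind=> y; elim/gr_ind=> z.
by rewrite -gr_piD !gr_mulE mulrDl gr_piD.
Qed.

Fact gr_mulDr : right_distributive gr_mul +%R.
Proof.
elim/gr_ind=> x; elim/gr_ind=> y; elim/gr_ind=> z.
by rewrite -gr_piD !gr_mulE mulrDr gr_piD.
Qed.

Fact gr_oner_neq0 : gr_one != 0.
Proof.
apply/eqP => H; have /gr_piP/asboolP/(_ 0) : gr_pi 1 = gr_pi 0.
  by rewrite [LHS]H; apply/esym; exact: (raddf0 (\pi_(gr_quot))).
by rewrite subr0 sub0r /= /lmono eqxx => /filtN1.
Qed.

HB.instance Definition _ := GRing.Zmodule_isNzRing.Build gr
  gr_mulA gr_mul1x gr_mulx1 gr_mulDl gr_mulDr gr_oner_neq0.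

Fact gr_scaleA a b x : gr_scale a (gr_scale b x) = gr_scale (a * b) x.
Proof. by elim/gr_ind: x => x; rewrite !gr_scaleE scalerA. Qed.

Fact gr_scale1 : left_id 1 gr_scale.
Proof. by elim/gr_ind=> x; rewrite gr_scaleE scale1r. Qed.

Fact gr_scaleDr : right_distributive gr_scale +%R.
Proof.
move=> a; elim/gr_ind=> x; elim/gr_ind=> y.
by rewrite -gr_piD !gr_scaleE scalerDr gr_piD.
Qed.

Fact gr_scaleDl x : {morph gr_scale^~ x : a b / a + b}.
Proof.
by move=> a b; elim/gr_ind: x => x; rewrite !gr_scaleE scalerDl gr_piD.
Qed.

HB.instance Definition _ := GRing.Zmodule_isLmodule.Build k gr
  gr_scaleA gr_scale1 gr_scaleDr gr_scaleDl.

Lemma gr_piM (x y : rees F) : gr_pi (x * y) = gr_pi x * gr_pi y.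
Proof. by rewrite -gr_mulE. Qed.

Lemma gr_piZ (a : k) (x : rees F) : gr_pi (a *: x) = a *: gr_pi x.
Proof. by rewrite -gr_scaleE. Qed.

Fact gr_scaleAl (a : k) (x y : gr) : a *: (x * y) = (a *: x) * y.
Proof.
elim/gr_ind: x => x; elim/gr_ind: y => y.
by rewrite -gr_piM -!gr_piZ -gr_piM scalerAl.
Qed.

Fact gr_scaleAr (a : k) (x y : gr) : a *: (x * y) = x * (a *: y).
Proof.
elim/gr_ind: x => x; elim/gr_ind: y => y.
by rewrite -gr_piM -!gr_piZ -gr_piM scalerAr.
Qed.

HB.instance Definition _ := GRing.Lmodule_isLalgebra.Build k gr gr_scaleAl.
HB.instance Definition _ := GRing.Lalgebra_isAlgebra.Build k gr gr_scaleAr.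

(* The degree [n] component [F_n A / F_(n-1) A] of [gr A]. *)
Definition gr_comp (n : int) : set gr :=
  [set gr_pi x | x in [set x : rees F | forall i, i != n -> x i = 0]].

Definition connected_graded : Prop :=
  [/\ forall n, (n < 0)%R -> gr_comp n = [set 0],
      gr_comp 0 = range (fun c : k => c%:A : gr) &
      forall n, finite_rank (gr_comp n)].

End AssociatedGraded.

(* [gr A], as a commutative ring when its multiplication is commutative. *)
Definition com_gr (k : fieldType) (A : algType k) (F : filtration A)
  (grC : commutative (@GRing.mul (gr F))) : Type := gr F.

HB.instance Definition _ k A F grC :=
  GRing.NzRing.copy (@com_gr k A F grC) (gr F).
HB.instance Definition _ k A F grC :=
  GRing.PzRing_hasCommutativeMul.Build (@com_gr k A F grC) grC.

(* The Rees module [\bigoplus_n F_n M t^n], inside [M[t, t^-1]]. *)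
Section ReesModule.
Variables (k : fieldType) (A : algType k) (F : filtration A).
Variables (M : lmodType A) (FM : mod_filtration F M).

Definition rees_mod_pred : pred (int -> M) :=
  fun x => `[< fin_supp x /\ forall n, FM n (x n) >].

Lemma mfilt0 n : FM n 0.
Proof. exact: submod_mem0 (mfilt_submod FM n). Qed.

Lemma mfiltD n (x y : M) : FM n x -> FM n y -> FM n (x + y).
Proof. exact: submod_memD (mfilt_submod FM n) _ _. Qed.

Lemma mfiltN n (x : M) : FM n x -> FM n (- x).
Proof. exact: submod_memN (mfilt_submod FM n) _. Qed.

Lemma mfilt_sum n (I : Type) (r : seq I) (f : I -> M) :
  (forall i, FM n (f i)) -> FM n (\sum_(i <- r) f i).
Proof.
by move=> H; elim/big_ind: _ => //; [exact: mfilt0 | exact: mfiltD].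
Qed.

Fact rees_mod_zmod_closed : zmod_closed rees_mod_pred.
Proof.
split; first by apply/asboolP; split=> [|n]; [exact: fin_supp0 | exact: mfilt0].
move=> x y /asboolP[fx Fx] /asboolP[fy Fy]; apply/asboolP; split.
  apply: fin_suppD => //; have /fin_suppP[r yr] := fy.
  by apply/fin_suppP; exists r => n /yr; rewrite !fctE => ->; rewrite oppr0.
by move=> n; apply: mfiltD (Fx n) (mfiltN (Fy n)).
Qed.

HB.instance Definition _ :=
  GRing.isZmodClosed.Build (int -> M) rees_mod_pred rees_mod_zmod_closed.

Record rees_mod :=
  ReesMod { rees_mod_coef :> int -> M; _ : rees_mod_coef \in rees_mod_pred }.

HB.instance Definition _ := [isSub for rees_mod_coef].
HB.instance Definition _ := [Choice of rees_mod by <:].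
HB.instance Definition _ := [SubChoice_isSubZmodule of rees_mod by <:].

Lemma rees_mod_supp (x : rees_mod) : fin_supp x.
Proof. by case: x => x /= /asboolP[]. Qed.

Lemma rees_mod_filt (x : rees_mod) n : FM n (x n).
Proof. by case: x => x /= /asboolP[]. Qed.

Fact rees_mod_scale_in (x : rees F) (m : rees_mod) : lconv x m \in rees_mod_pred.
Proof.
have fx := rees_supp x; have fm := rees_mod_supp m; apply/asboolP; split.
  exact: conv_supp.
move=> n; have [r ur xr] := fin_supp_seq fx; rewrite (conv_seq _ _ ur)//.
apply: mfilt_sum => i.
have := mfiltZ (rees_filt x i) (rees_mod_filt m (n - i)).
by rewrite addrC subrK.
Qed.

Definition rees_mod_scale (x : rees F) (m : rees_mod) : rees_mod :=
  ReesMod (rees_mod_scale_in x m).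

Fact rees_mod_scaleA x y m :
  rees_mod_scale x (rees_mod_scale y m) = rees_mod_scale (x * y) m.
Proof. by apply: val_inj; apply: convA; exact: rees_supp. Qed.

Fact rees_mod_scale1 : left_id 1 rees_mod_scale.
Proof.
move=> m; apply: val_inj; apply/funext => n /=.
by rewrite conv_mono subr0 scale1r.
Qed.

Fact rees_mod_scaleDr : right_distributive rees_mod_scale +%R.
Proof. by move=> x m p; apply: val_inj; apply: convDr; exact: rees_supp. Qed.

Fact rees_mod_scaleDl m : {morph rees_mod_scale^~ m : x y / x + y}.
Proof. by move=> x y; apply: val_inj; apply: convDl; exact: rees_supp. Qed.

HB.instance Definition _ := GRing.Zmodule_isLmodule.Build (rees F) rees_mod
  rees_mod_scaleA rees_mod_scale1 rees_mod_scaleDr rees_mod_scaleDl.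

Definition good_filtration : Prop := finitely_generated rees_mod.

Definition gr_mod_ker : pred rees_mod :=
  fun x => `[< forall n, FM (n - 1) (x n) >].

Fact gr_mod_ker_submod_closed : submod_closed gr_mod_ker.
Proof.
split; first by apply/asboolP => n; exact: mfilt0.
move=> a x y /asboolP Fx /asboolP Fy; apply/asboolP => n.
apply: mfiltD (Fy n); have [r ur ar] := fin_supp_seq (rees_supp a).
rewrite [X in FM _ X](conv_seq _ _ ur)//; apply: mfilt_sum => i.
have := mfiltZ (rees_filt a i) (Fx (n - i)).
by rewrite !addrA [i + n]addrC addrK.
Qed.

HB.instance Definition _ := GRing.isSubmodClosed.Build (rees F) rees_mod
  gr_mod_ker gr_mod_ker_submod_closed.

Local Open Scope quotient_scope.
Local Notation gr_mod_quot :=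
  {ideal_quot (GRing.ZmodClosed.clone rees_mod gr_mod_ker _)}.

(* [gr M = \bigoplus_n F_n M / F_(n-1) M]. *)
Definition gr_mod : Type := gr_mod_quot.

HB.instance Definition _ := GRing.Zmodule.on gr_mod.

Definition gr_mod_pi (x : rees_mod) : gr_mod := \pi_(gr_mod_quot) x.
Definition gr_mod_repr (x : gr_mod) : rees_mod := repr (x : gr_mod_quot).

Lemma gr_mod_reprK x : gr_mod_pi (gr_mod_repr x) = x.
Proof. exact: reprK. Qed.

Lemma gr_mod_piP (x y : rees_mod) :
  gr_mod_pi x = gr_mod_pi y <-> x - y \in gr_mod_ker.
Proof. by rewrite Quotient.idealrBE; split=> /eqP. Qed.

Lemma gr_mod_reprP x : gr_mod_repr (gr_mod_pi x) - x \in gr_mod_ker.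
Proof. by apply/gr_mod_piP; exact: gr_mod_reprK. Qed.

Lemma gr_mod_piD x y : gr_mod_pi (x + y) = gr_mod_pi x + gr_mod_pi y.
Proof. exact: (raddfD (\pi_(gr_mod_quot))). Qed.

Lemma gr_mod_ind (P : gr_mod -> Prop) :
  (forall x, P (gr_mod_pi x)) -> forall x, P x.
Proof. by move=> H x; rewrite -[x]gr_mod_reprK. Qed.

Definition gr_mod_scale (x : gr F) (m : gr_mod) : gr_mod :=
  gr_mod_pi (gr_repr x *: gr_mod_repr m).

Lemma gr_ker_scale (x : rees F) (m : rees_mod) :
  x \in gr_ker (F := F) -> x *: m \in gr_mod_ker.
Proof.
move=> /asboolP Fx; apply/asboolP => n.
have [r ur xr] := fin_supp_seq (rees_supp x).
rewrite [X in FM _ X](conv_seq _ _ ur)//; apply: mfilt_sum => i.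
have := mfiltZ (Fx i) (rees_mod_filt m (n - i)).
by rewrite addrC addrA subrK.
Qed.

Lemma gr_mod_scaleE x m :
  gr_mod_scale (gr_pi x) (gr_mod_pi m) = gr_mod_pi (x *: m).
Proof.
apply/gr_mod_piP; set x' := gr_repr _; set m' := gr_mod_repr _.
rewrite -[X in X - _](subrK (x' *: m)) -scalerBr -addrA -scalerBl.
apply: rpredD (gr_ker_scale _ (gr_reprP x)).
exact: rpredZ (gr_mod_reprP m).
Qed.

Fact gr_mod_scaleA x y m :
  gr_mod_scale x (gr_mod_scale y m) = gr_mod_scale (x * y) m.
Proof.
elim/gr_ind: x => x; elim/gr_ind: y => y; elim/gr_mod_ind: m => m.
by rewrite -gr_piM !gr_mod_scaleE scalerA.
Qed.

Fact gr_mod_scale1 : left_id 1 gr_mod_scale.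
Proof. by elim/gr_mod_ind=> m; rewrite gr_mod_scaleE scale1r. Qed.

Fact gr_mod_scaleDr : right_distributive gr_mod_scale +%R.
Proof.
elim/gr_ind=> x; elim/gr_mod_ind=> m; elim/gr_mod_ind=> p.
by rewrite -gr_mod_piD !gr_mod_scaleE scalerDr gr_mod_piD.
Qed.

Fact gr_mod_scaleDl m : {morph gr_mod_scale^~ m : x y / x + y}.
Proof.
elim/gr_mod_ind: m => m; elim/gr_ind=> x; elim/gr_ind=> y.
by rewrite -gr_piD !gr_mod_scaleE scalerDl gr_mod_piD.
Qed.

HB.instance Definition _ := GRing.Zmodule_isLmodule.Build (gr F) gr_mod
  gr_mod_scaleA gr_mod_scale1 gr_mod_scaleDr gr_mod_scaleDl.

End ReesModule.

Section Ideals.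
Variable R : comPzRingType.

Record ideal := Ideal {
  ideal_set :> R -> Prop;
  ideal_closed : submod_closed (mem (ideal_set : set R^o)) }.

Definition prime_ideal (P : ideal) : Prop :=
  ~ P 1 /\ forall a b, P (a * b) -> P a \/ P b.

(* The intersection of the prime ideals containing [X]. *)
Definition prime_radical (X : set R) : set R :=
  \bigcap_(P in [set P : ideal | prime_ideal P /\ X `<=` P]) P.

Fact prime_radical_closed (X : set R) :
  submod_closed (mem (prime_radical X : set R^o)).
Proof.
split; first by rewrite inE => P _; exact: submod_mem0 (ideal_closed P).
move=> a u v; rewrite !inE => Xu Xv P PX.
exact: submod_memP (ideal_closed P) _ _ _ (Xu P PX) (Xv P PX).
Qed.

Definition prime_radical_ideal (X : set R) : ideal :=
  Ideal (prime_radical_closed X).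

Variable I : ideal.

Definition ideal_pred : pred R := fun x => x \in (I : set R).

Fact ideal_pred_zmod_closed : zmod_closed ideal_pred.
Proof.
have IP := ideal_closed I.
split=> [|x y]; rewrite !unfold_in !inE; first exact: submod_mem0 IP.
by move=> Ix Iy; exact: (submod_memD IP Ix (submod_memN IP Iy)).
Qed.

HB.instance Definition _ :=
  GRing.isZmodClosed.Build R ideal_pred ideal_pred_zmod_closed.

Lemma ideal_predM a x : x \in ideal_pred -> a * x \in ideal_pred.
Proof. by rewrite !unfold_in !inE => Ix; exact: submod_memZ (ideal_closed I) a _ Ix. Qed.

Local Open Scope quotient_scope.
Local Notation quot := {ideal_quot (GRing.ZmodClosed.clone R ideal_pred _)}.

(* [R / I]; unlike in ring_quotient, [I] may be the unit ideal. *)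
Definition ring_quot : Type := quot.

HB.instance Definition _ := GRing.Zmodule.on ring_quot.

Definition rq_pi (x : R) : ring_quot := \pi_(quot) x.
Definition rq_repr (x : ring_quot) : R := repr (x : quot).

Lemma rq_reprK x : rq_pi (rq_repr x) = x.
Proof. exact: reprK. Qed.

Lemma rq_piP (x y : R) : rq_pi x = rq_pi y <-> x - y \in ideal_pred.
Proof. by rewrite Quotient.idealrBE; split=> /eqP. Qed.

Lemma rq_reprP x : rq_repr (rq_pi x) - x \in ideal_pred.
Proof. by apply/rq_piP; exact: rq_reprK. Qed.

Lemma rq_piD x y : rq_pi (x + y) = rq_pi x + rq_pi y.
Proof. exact: (raddfD (\pi_(quot))). Qed.

Lemma rq_ind (P : ring_quot -> Prop) : (forall x, P (rq_pi x)) -> forall x, P x.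
Proof. by move=> H x; rewrite -[x]rq_reprK. Qed.

Definition rq_one : ring_quot := rq_pi 1.
Definition rq_mul (x y : ring_quot) : ring_quot := rq_pi (rq_repr x * rq_repr y).

Lemma rq_mulE x y : rq_mul (rq_pi x) (rq_pi y) = rq_pi (x * y).
Proof.
apply/rq_piP; set x' := rq_repr _; set y' := rq_repr _.
rewrite -[X in X - _](subrK (x' * y)) -mulrBr -addrA -mulrBl [_ * y]mulrC.
exact: rpredD (ideal_predM _ (rq_reprP y)) (ideal_predM _ (rq_reprP x)).
Qed.

Fact rq_mulA : associative rq_mul.
Proof.
elim/rq_ind=> x; elim/rq_ind=> y; elim/rq_ind=> z.
by rewrite !rq_mulE mulrA.
Qed.

Fact rq_mulC : commutative rq_mul.
Proof. by elim/rq_ind=> x; elim/rq_ind=> y; rewrite !rq_mulE mulrC. Qed.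

Fact rq_mul1x : left_id rq_one rq_mul.
Proof. by elim/rq_ind=> x; rewrite rq_mulE mul1r. Qed.

Fact rq_mulDl : left_distributive rq_mul +%R.
Proof.
elim/rq_ind=> x; elim/rq_ind=> y; elim/rq_ind=> z.
by rewrite -rq_piD !rq_mulE mulrDl rq_piD.
Qed.

HB.instance Definition _ := GRing.Zmodule_isComPzRing.Build ring_quot
  rq_mulA rq_mulC rq_mul1x rq_mulDl.

End Ideals.

Record spec (R : comPzRingType) :=
  Spec { spec_ideal :> ideal R; spec_prime : prime_ideal spec_ideal }.

Section Zariski.
Variable R : comPzRingType.

HB.instance Definition _ := gen_eqMixin (spec R).
HB.instance Definition _ := gen_choiceMixin (spec R).

(* The closed sets are the [V(E) = {P | E `<=` P}]. *)
Definition zariski_open (U : set (spec R)) : Prop :=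
  exists E : set R, U = [set P : spec R | ~ (E `<=` P)].

Fact zariski_openT : zariski_open setT.
Proof.
exists setT; apply/seteqP; split=> // P _ TP.
by have [+ _] := spec_prime P; apply; exact: TP.
Qed.

Fact zariski_openI : setI_closed zariski_open.
Proof.
move=> _ _ [E ->] [E' ->].
exists [set a * b | a in E & b in E']; apply/seteqP; split=> P /=.
  move=> [/existsNP[a /not_implyP[Ea Pa]] /existsNP[b /not_implyP[Eb Pb]]].
  move=> EE; have [_ /(_ a b)] := spec_prime P.
  by case=> //; apply: EE; exists a => //; exists b.
move=> /existsNP[_ /not_implyP[[a Ea [b Eb <-]] Pab]].
have PM c x : (P : set R) x -> (P : set R) (c * x).
  exact: (submod_memZ (ideal_closed P) c).
split=> EP; apply: Pab; last exact/PM/EP.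
by rewrite mulrC; exact/PM/EP.
Qed.

Fact zariski_open_bigU (I : Type) (f : I -> set (spec R)) :
  (forall i, zariski_open (f i)) -> zariski_open (\bigcup_i f i).
Proof.
move=> /choice[E fE]; exists (\bigcup_i E i); apply/seteqP; split=> P.
  by move=> [i _]; rewrite fE /= => NEP EP; apply: NEP => x Ex; apply: EP; exists i.
move=> /existsNP[x /not_implyP[[i _ Ex] Px]]; exists i => //.
by rewrite fE => /(_ _ Ex).
Qed.

HB.instance Definition _ := isOpenTopological.Build (spec R)
  zariski_openT zariski_openI zariski_open_bigU.

End Zariski.

Section IrreducibleComponents.
Variable T : topologicalType.

Definition irreducible (Z : set T) : Prop :=
  Z !=set0 /\ forall C D : set T, closed C -> closed D ->
    Z `<=` C `|` D -> Z `<=` C \/ Z `<=` D.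

Definition irreducible_component (Z : set T) : Prop :=
  irreducible Z /\ forall Y, irreducible Y -> Z `<=` Y -> Y = Z.

(* The Krull dimension of [Z] with the subspace topology: the supremum of the
   lengths of the chains [Y 0 `<` ... `<` Y n] of irreducible subsets of [Z]
   that are closed in [Z]. *)
Definition krull_dim (K : realType) (Z : set T) : \bar K :=
  ereal_sup [set n%:R%:E | n in [set n : nat | exists Y : nat -> set T,
    (forall i, (i <= n)%N ->
      irreducible (Y i) /\ exists2 C, closed C & Y i = Z `&` C) /\
    (forall i, (i < n)%N -> Y i `<` Y i.+1)]].

Definition pure_dimensional (K : realType) : Prop :=
  forall Z Z' : set T,
    irreducible_component Z -> irreducible_component Z' ->
    krull_dim K Z = krull_dim K Z'.

End IrreducibleComponents.

Section CharacteristicVariety.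
Variables (k : fieldType) (A : algType k) (F : filtration A).
Variable grC : commutative (@GRing.mul (gr F)).
Variables (M : lmodType A) (FM : mod_filtration F M).

(* The ideal [I(M)] of [gr A], computed with the filtration [FM]. *)
Definition char_ideal : ideal (com_gr grC) :=
  prime_radical_ideal (annihilator (gr_mod FM) : set (com_gr grC)).

Definition char_variety : topologicalType := spec (ring_quot char_ideal).

End CharacteristicVariety.

(* Main.v *)
(** Let [B = gr A], let [E = gr M] be finite over [S = k[y_1, ..., y_d]] with
    [S] acting freely on some element, and let [T] be the [S]-torsion of [E], that
    is, the largest submodule of dimension [< d]. It is graded and killed by some
    [f <> 0] in [S]. Let [F'_j] be the set of [u] in [M] such that, for every
    degree [q] and a fixed lift [a_q] of the degree [q] component of [f],
    [a_q^l u] lies in [F_(lq + j)] for some [l]: the filtration induced from the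
    localizations of [M] at the [a_q]. The submodule [N = \bigcap_j F'_j] has its
    symbols in [T], so its GK dimension is less than that of [M], and [N = 0] by
    purity. Thus [gr' M] makes sense, and it is [S]-torsion free.

    The images [G_p] of [F'_j `&` F_(j + p)] in [gr' M] increase with [p], and
    [G_p / G_(p - 1)] is isomorphic to [T_p / T_(p + 1)], where the submodules
    [T_p] of [T] decrease. After Nagata's change of variables [f] is monic in the
    last variable, and [T] is finite over the polynomials [S'] in the other [d - 1]
    variables; by a rank argument [T_p / T_(p + 1)] is killed by some nonzero [b]
    in [S'] for large [p]. As [f] and [b] are coprime, all the [G_p] lie in one
    lattice, so they are stationary; hence so are the [T_p], which vanish for large
    [p] since the [F_j M] are finite dimensional and [N = 0]. So [F] and [F'] are
    equivalent, [gr M] and [gr' M] have the same characteristic variety, and every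
    minimal prime [P] over the annihilator of the finite torsion free module
    [gr' M] meets [S] trivially, so that [B / P] is integral over [S] and has Krull
    dimension [d]. *)

Require Import Defs.
From HB Require Import structures.
From mathcomp Require Import all_boot all_order all_algebra.
From mathcomp Require Import all_classical all_reals all_analysis.
From mathcomp Require Import zify ring lra.
Set Implicit Arguments.
Unset Strict Implicit.
Unset Printing Implicit Defensive.
Import Order.TTheory GRing.Theory Num.Theory.
Local Open Scope classical_set_scope.
Local Open Scope ring_scope.

(** Normalization is not homogeneous: neither the [y_i] nor [f] need respect the grading of [B]. So
    no single element of [A] lifts [f], and the localizations are at lifts of its components; nor is
    it formal that [T] is graded. The reason is growth: [x] is torsion exactly when [B x] is finite
    over a polynomial ring in fewer variables, whichever they are, and the top component of [x] does
    not grow faster than [x].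

    The main obstacle is that [F'] is defined by unbounded powers, so that neither its separation
    nor the finiteness of [gr' M] is known in advance. Purity gives the first. For the second, [f]
    kills [T] and so maps [G_p] into [G_(p - 1)], but alone it only bounds [G_p] by [f^(-p)] times a
    lattice; a second multiplier prime to [f] is what keeps the lattice fixed. It exists because [T]
    already has dimension at most [d - 1] and the ranks of the [T_p] over [S'] can drop only
    finitely often. *)

(** * Hilbert's basis theorem *)

Definition noetherian (R : comNzRingType) : Prop :=
  forall J : set R, J 0 -> (forall a b, J a -> J b -> J (a + b)) ->
     (forall a b, J b -> J (a * b)) ->
     exists (I : finType) (w : I -> R),
       (forall i, J (w i)) /\
       forall a, J a -> exists c : I -> R, a = \sum_i c i * w i.

Section Span.
Variables (R : comNzRingType) (B : nzRingType) (f : {rmorphism R -> B}).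
Variable G : lmodType B.
Implicit Types U : set G.

(** Scalars act through [f], because one and the same module is taken over many polynomial rings,
    one for each choice of variables in [B]. *)
Definition rspan (I : finType) (v : I -> G) : set G :=
  [set x | exists c : I -> R, x = \sum_i f (c i) *: v i].

Definition rsub U : Prop :=
  [/\ U 0, forall x y, U x -> U y -> U (x + y) & forall r x, U x -> U (f r *: x)].

Definition fgen U : Prop := exists (I : finType) (v : I -> G), U = rspan v.

Lemma rsub_sum U (J : Type) (r : seq J) (P : pred J) (x : J -> G) :
  rsub U -> (forall i, P i -> U (x i)) -> U (\sum_(i <- r | P i) x i).
Proof. by case=> U0 UD _ Ux; elim/big_ind: _. Qed.

Lemma rsubN U x : rsub U -> U x -> U (- x).
Proof. by case=> _ _ UZ Ux; rewrite -scaleN1r -(rmorphN1 f); exact: UZ. Qed.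

Lemma rsubB U x y : rsub U -> U x -> U y -> U (x - y).
Proof. by move=> US Ux Uy; have [_ UD _] := US; apply: UD => //; exact: rsubN. Qed.

Section Family.
Variables (I : finType) (v : I -> G).

Lemma rspan_sub : rsub (rspan v).
Proof.
split=> [|_ _ [c ->] [c' ->]|r _ [c ->]].
- by exists (fun=> 0); rewrite big1// => i _; rewrite rmorph0 scale0r.
- exists (fun i => c i + c' i); rewrite -big_split; apply: eq_bigr => i _ /=.
  by rewrite rmorphD scalerDl.
- exists (fun i => r * c i); rewrite scaler_sumr; apply: eq_bigr => i _.
  by rewrite rmorphM scalerA.
Qed.

Lemma rspan_gen i : rspan v (v i).
Proof.
exists (fun j => (j == i)%:R); rewrite (bigD1 i)//= eqxx rmorph1 scale1r.
by rewrite big1 ?addr0// => j /negbTE ->; rewrite rmorph0 scale0r.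
Qed.

Lemma rspan_min U : rsub U -> (forall i, U (v i)) -> rspan v `<=` U.
Proof.
by move=> US Uv _ [c ->]; apply: rsub_sum => // i _; case: US => _ _; apply.
Qed.

End Family.

Lemma rspan_ord (I : finType) (v : I -> G) :
  rspan v = rspan (fun i : 'I_#|I| => v (enum_val i)).
Proof.
apply/seteqP; split; apply: rspan_min; try exact: rspan_sub.
  by move=> i; rewrite -(enum_rankK i); exact: (rspan_gen (fun i : 'I_#|I| => v (enum_val i))).
by move=> i; exact: rspan_gen.
Qed.

Lemma rspan_sum (I J : finType) (v : I -> G) (w : J -> G) x y :
  rspan v x -> rspan w y ->
  rspan (fun s : I + J => match s with inl i => v i | inr j => w j end) (x + y).
Proof.
move=> [c ->] [c' ->].
exists (fun s => match s with inl i => c i | inr j => c' j end).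
by rewrite big_sumType.
Qed.

(** The coefficients of [v ord0] in elements of [U] form an ideal [J]. Lifts of its generators, with
    generators of the part of [U] spanned by the other vectors, generate [U]. *)
Lemma fgen_noeth (n : nat) (v : 'I_n -> G) U :
  noetherian R ->
  rsub U -> U `<=` rspan v -> fgen U.
Proof.
move=> Rn; elim: n v U => [|n IH] v U US Uv.
  exists 'I_0, v; apply/seteqP; split=> //.
  by apply: rspan_min => // -[].
have [U0 UD UZ] := US.
pose v' := fun i => v (lift ord0 i).
pose J : set R := [set r | exists2 y, rspan v' y & U (f r *: v ord0 + y)].
have V' := rspan_sub v'; have [V0 VD VZ] := V'.
have [|||I [w [Jw wJ]]] := Rn J.
- by exists 0 => //; rewrite rmorph0 scale0r addr0.
- move=> a b [x Vx Ux] [y Vy Uy]; exists (x + y); first exact: VD.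
  by rewrite rmorphD scalerDl addrACA; exact: UD.
- move=> a b [y Vy Uy]; exists (f a *: y); first exact: VZ.
  by rewrite rmorphM -scalerA -scalerDr; exact: UZ.
have /choice[y yP] : forall i, exists y, rspan v' y /\ U (f (w i) *: v ord0 + y).
  by move=> i; have [y] := Jw i; exists y.
have [|x [Vx Ux]|L [u uE]] := IH v' (U `&` rspan v').
- split=> [|x x' [? ?] [? ?]|r x [? ?]]; first by [].
    by split; [exact: UD|exact: VD].
  by split; [exact: UZ|exact: VZ].
- by [].
pose z i := f (w i) *: v ord0 + y i.
exists (I + L)%type, (fun s => match s with inl i => z i | inr j => u j end).
apply/seteqP; split; last first.
  apply: rspan_min => // -[i|l]; first by case: (yP i).
  by have : (U `&` rspan v') (u l); [rewrite uE; exact: rspan_gen|case].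
move=> x Ux; have [c xE] := Uv x Ux.
rewrite big_ord_recl in xE.
have [e eE] : exists e : I -> R, c ord0 = \sum_i e i * w i.
  apply: wJ; exists (\sum_(i < n) f (c (lift ord0 i)) *: v' i).
    by exists (fun i => c (lift ord0 i)).
  by rewrite /v' -xE.
rewrite -[x](subrK (\sum_i f (e i) *: z i)) addrC; apply: rspan_sum.
  by exists e.
rewrite -uE; split.
  apply: (rsubB US Ux). apply: rsub_sum => // i _; apply: UZ.
  by case: (yP i).
rewrite xE eE rmorph_sum scaler_suml addrAC.
apply: VD; last by exists (fun i => c (lift ord0 i)).
rewrite -sumrB; apply: rsub_sum => // i _.
rewrite /z scalerDr scalerA -rmorphM opprD addrA subrr sub0r.
by apply: (rsubN V'); apply: VZ; case: (yP i).
Qed.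

End Span.

Lemma field_noetherian (k : fieldType) : noetherian k.
Proof.
move=> J J0 JD JM; have [[x Jx x0]|H] := pselect (exists2 x, J x & x != 0).
  exists unit, (fun=> 1); split=> [_|a _]; last first.
    by exists (fun=> a); rewrite (big_pred1 tt) ?mulr1// => -[].
  by rewrite -(mulVf x0); exact: JM.
exists void, (fun=> 0); split=> [[]|a Ja].
exists (fun=> 0); rewrite big1 => [|[]//]; apply/eqP/negPn/negP => a0.
by apply: H; exists a.
Qed.

Section HilbertBasis.
Variable R : comNzRingType.
Hypothesis Rn : noetherian R.

Lemma poly_noetherian : noetherian {poly R}.
Proof.
move=> J J0 JD JM.
pose L : set R := [set c | exists2 p, J p & lead_coef p = c \/ c = 0].
have JN a : J a -> J (- a) by move=> Ja; rewrite -mulN1r; exact: JM.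
have LP c : L c <-> exists n p, [/\ J p, (size p <= n.+1)%N & p`_n = c].
  split=> [[p Jp [<-|->]]|[n [p [Jp pn <-]]]].
  - have [->|p0] := eqVneq p 0.
      by exists 0%N, 0; rewrite size_poly0 lead_coef0 coef0.
    exists (size p).-1, p; split=> //.
    by rewrite prednK// size_poly_gt0.
  - by exists 0%N, 0; rewrite size_poly0 coef0.
  - exists p => //; have [pE|pn'] := eqVneq (size p) n.+1.
      by left; rewrite lead_coefE pE.
    by right; rewrite nth_default// -ltnS ltn_neqAle pn' pn.
have shift n m p : J p -> (size p <= n.+1)%N -> exists q, [/\ J q,
    (size q <= (m + n).+1)%N & q`_(m + n) = p`_n].
  move=> Jp pn; exists ('X^m * p); split; first exact: JM.
    by apply: leq_trans (size_polyMleq _ _) _; rewrite size_polyXn addSn /= -addnS leq_add2l.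
  by rewrite coefXnM ltnNge leq_addr /= addKn.
have [|||I [w [Lw wL]]] := Rn (J := L).
- by exists 0 => //; right.
- move=> _ _ /LP[n [p [Jp pn <-]]] /LP[m [q [Jq qm <-]]]; apply/LP.
  have [p' [Jp' pn' <-]] := shift n m p Jp pn.
  have [q' [Jq' qm' <-]] := shift m n q Jq qm.
  exists (m + n)%N, (p' + q'); split; [exact: JD| |by rewrite coefD [(n + m)%N]addnC].
  apply: leq_trans (size_polyD _ _) _; rewrite geq_max pn'.
  by rewrite addnC.
- move=> a _ /LP[n [p [Jp pn <-]]]; apply/LP; exists n, (a%:P * p).
  split; [exact: JM| |by rewrite coefCM].
  by rewrite mul_polyC; apply: leq_trans (size_scale_leq _ _) _.
have /choice[d /choice[q qP]] i := (LP (w i)).1 (Lw i).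
(* From degree [N] on, the top coefficient is cancelled by multiples of the [q i]; the elements of
   [J] of size at most [N] lie in a finite [R]-module. *)
pose N := \max_i d i.
have [||K [u uE]] := @fgen_noeth R {poly R} (@polyC R) {poly R}^o N
    (fun i => 'X^i) (J `&` [set p : {poly R}^o | (size (p : {poly R}) <= N)%N]) Rn.
- split=> [|x y [Jx xN] [Jy yN]|r x [Jx xN]].
  + by split=> //=; rewrite size_poly0.
  + split; first exact: JD.
    by apply: leq_trans (size_polyD _ _) _; rewrite geq_max xN.
  + split; first exact: JM.
    by rewrite /= [_ *: _]mul_polyC; apply: leq_trans (size_scale_leq _ _) _.
- move=> p [_ /= pN]; exists (fun i : 'I_N => (p : {poly R})`_i).
  transitivity (\poly_(i < N) (p : {poly R})`_i).
    apply/polyP => i; rewrite coef_poly; case: ltnP => // Ni.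
    by rewrite nth_default//; exact: leq_trans Ni.
  by rewrite poly_def; apply: eq_bigr => i _; rewrite [RHS]mul_polyC.
have uJ j : J (u j) by have : (J `&` [set p : {poly R}^o | (size (p : {poly R}) <= N)%N]) (u j);
  [rewrite uE; exact: rspan_gen|case].
exists (I + K)%type, (fun s => match s with inl i => q i | inr j => u j end).
split=> [[i|j]//|]; first by case: (qP i).
pose sp (p : {poly R}) := exists c : I + K -> {poly R}, p = \sum_i c i *
  match i with inl i => q i | inr j => u j end.
suff H n p : J p -> (size p <= n)%N -> sp p by move=> p Jp; exact: (H (size p)).
elim: n p => [|n IH] p Jp pn.
  exists (fun=> 0); rewrite big1 => [|i _]; last by rewrite mul0r.
  by apply/eqP; rewrite -size_poly_leq0.
have [nN|Nn] := ltnP n N.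
  have : rspan (@polyC R) u (p : {poly R}^o).
    by rewrite -uE; split=> //=; exact: leq_trans nN.
  move=> [c pE]; exists (fun s => match s with inl i => 0 | inr j => (c j)%:P end).
  rewrite big_sumType/= big1 ?add0r// => i _; by rewrite mul0r.
have [c cE] : exists c : I -> R, p`_n = \sum_i c i * w i.
  by apply: wL; apply/LP; exists n, p.
have dn i : (d i <= n)%N by apply: leq_trans Nn; exact: leq_bigmax.
pose r := \sum_i ((c i)%:P * 'X^(n - d i)) * q i.
have Jr : J r.
  by rewrite /r; elim/big_ind: _ => // i _; apply: JM; case: (qP i).
have rn : (size r <= n.+1)%N.
  apply: leq_trans (size_sum _ _ _) _; apply/bigmax_leqP => i _.
  have [_ qi _] := qP i.
  apply: leq_trans (size_polyMleq _ _) _.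
  have h : (size ((c i)%:P * 'X^(n - d i)%N : {poly R})%R <= (n - d i).+1)%N.
    by rewrite mul_polyC; apply: leq_trans (size_scale_leq _ _) _; rewrite size_polyXn.
  rewrite -subn1 leq_subLR; apply: leq_trans (leq_add h qi) _.
  by rewrite addSn addnS subnK.
have rE : r`_n = p`_n.
  rewrite cE coef_sum; apply: eq_bigr => i _; have [_ qi <-] := qP i.
  by rewrite -mulrA coefCM coefXnM ltnNge leq_subr /= subKn.
have [||e eE] := IH (p - r).
- by apply: JD => //; exact: JN.
- apply/leq_sizeP => j; rewrite leq_eqVlt => /predU1P[<-|nj].
    by rewrite coefB rE subrr.
  by rewrite coefB !nth_default ?subr0//; [exact: leq_trans rn nj|exact: leq_trans pn nj].
exists (fun s => e s + match s with inl i => (c i)%:P * 'X^(n - d i) | inr _ => 0 end).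
under eq_bigr do rewrite mulrDl; rewrite big_split -eE big_sumType/=.
by rewrite [X in _ + (_ + X)]big1 ?addr0 ?subrK// => i _; rewrite mul0r.
Qed.

End HilbertBasis.

(** * Nagata change of variables *)

Section Independence.
Variables (R : idomainType) (B : nzRingType) (f : {rmorphism R -> B}).
Variable G : lmodType B.

Definition rindep (I : finType) (v : I -> G) : Prop :=
  forall c : I -> R, \sum_i f (c i) *: v i = 0 -> forall i, c i = 0.

(** If [I] were larger, the coefficient matrix, padded to a square one by zero columns, would be
    singular; a vector of its left kernel, which exists over any domain, is a dependency of [v]. *)
Lemma steinitz (I J : finType) (v : I -> G) (w : J -> G) :
  rindep v -> (forall i, rspan f w (v i)) -> (#|I| <= #|J|)%N.
Proof.
move=> vI /choice[c vE]; rewrite leqNgt; apply/negP => JI.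
pose A : 'M[R]_#|I| := \matrix_(i, j)
  if insub (val j) is Some j' then c (enum_val i) (enum_val (j' : 'I_#|J|)) else 0.
have /eqP/det0P[u u0 uA] : \det A = 0.
  rewrite -det_tr; apply/eqP/det0P; exists (delta_mx 0 (Ordinal JI)).
    by apply/eqP => /matrixP/(_ 0 (Ordinal JI))/eqP; rewrite !mxE !eqxx oner_eq0.
  rewrite -rowE; apply/rowP => j; rewrite !mxE.
  by rewrite insubF//= ltnn.
have uA' j : \sum_i u 0 (enum_rank i) * c i j = 0.
  have jI : (enum_rank j < #|I|)%N by exact: ltn_trans JI.
  have /matrixP/(_ 0 (Ordinal jI)) := uA; rewrite !mxE => H.
  rewrite -[RHS]H (reindex (@enum_val I I))/=; last first.
    by apply: onW_bij; exact: enum_val_bij.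
  apply: eq_bigr => i _; rewrite mxE/= enum_valK.
  by rewrite (valK (enum_rank j)) enum_rankK.
have /vI H : \sum_i f (u 0 (enum_rank i)) *: v i = 0.
  under eq_bigr do rewrite vE scaler_sumr.
  rewrite exchange_big big1// => j _.
  under eq_bigr do rewrite scalerA -rmorphM.
  by rewrite -scaler_suml -rmorph_sum uA' rmorph0 scale0r.
by apply/negP: u0; rewrite negbK; apply/eqP/rowP => i; rewrite mxE -[i]enum_valK H.
Qed.

Lemma rindep_option (I : finType) (v : I -> G) x : rindep v ->
  ~ (exists2 b, b != 0 & rspan f v (f b *: x)) ->
  rindep (fun o : option I => if o is Some i then v i else x).
Proof.
move=> vI H c; rewrite (bigD1 None)//=.
rewrite (reindex_omap Some id)/=; last by case.
rewrite (eq_bigl xpredT); last by move=> i; rewrite eqxx.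
move=> E; have cN : c None = 0.
  apply/eqP/negPn/negP => c0; apply: H; exists (c None) => //.
  exists (fun i => - c (Some i)).
  under eq_bigr do rewrite rmorphN scaleNr.
  by rewrite sumrN; apply/eqP; rewrite -addr_eq0; exact/eqP.
move=> [i|//]; apply: (vI (fun i => c (Some i))).
by rewrite -[RHS]E cN rmorph0 scale0r add0r.
Qed.

Lemma max_indep (U : set G) (r : nat) :
  (forall (I : finType) (v : I -> G), rindep v -> (forall i, U (v i)) -> (#|I| <= r)%N) ->
  exists (I : finType) (v : I -> G), [/\ rindep v, forall i, U (v i) &
    forall x, U x -> exists2 b, b != 0 & rspan f v (f b *: x)].
Proof.
move=> Ur.
pose P n := `[< exists (I : finType) (v : I -> G), [/\ rindep v, forall i, U (v i) & #|I| = n] >].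
have P0 : exists n, P n.
  exists 0%N; apply/asboolP; exists void, (fun=> 0); split=> [c _ []|[]|].
  by rewrite card_void.
have Pr n : P n -> (n <= r)%N by move=> /asboolP[I [v [vI vU <-]]]; exact: Ur vU.
have [n /asboolP[I [v [vI vU nE]]] nmax] := ex_maxnP P0 Pr.
exists I, v; split=> // x Ux; apply: contrapT => H.
suff /nmax : P n.+1 by rewrite ltnn.
apply/asboolP.
exists (option I), (fun o : option I => if o is Some i then v i else x).
by split; [exact: rindep_option|case|rewrite card_option nE].
Qed.

End Independence.

(** Iterated univariate rings: the last variable, in which divisions by monic polynomials take
    place, is the outermost one. *)
Fixpoint polyring (k : fieldType) (n : nat) : idomainType :=
  if n is m.+1 then {poly polyring k m} else k.

Lemma polyring_noetherian k n : noetherian (polyring k n).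
Proof.
by elim: n => [|n IH]; [exact: field_noetherian|exact: poly_noetherian].
Qed.

Section Evaluation.
Variables (k : fieldType) (B : comAlgType k).
Implicit Types (y : nat -> B).

Fixpoint ev y (n : nat) : {rmorphism polyring k n -> B} :=
  match n return {rmorphism polyring k n -> B} with
  | 0 => in_alg B
  | m.+1 => (horner_eval (y m) \o map_poly (ev y m) : {rmorphism {poly _} -> B})
  end.

Lemma ev0E y c : ev y 0 c = c%:A. Proof. by []. Qed.

Lemma evSE y n N (p : polyring k n.+1) : (size (p : {poly _}) <= N)%N ->
  ev y n.+1 p = \sum_(i < N) ev y n (p : {poly _})`_i * y n ^+ i.
Proof.
move=> pN; rewrite /= /horner_eval (@horner_coef_wide _ N).
  by apply: eq_bigr => i _; rewrite coef_map.
by apply: leq_trans pN; exact: size_poly.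
Qed.

Lemma evC y n (c : polyring k n) : ev y n.+1 c%:P = ev y n c.
Proof. by rewrite /= /horner_eval map_polyC hornerC. Qed.

Lemma evX y n : ev y n.+1 'X = y n.
Proof. by rewrite /= /horner_eval map_polyX hornerX. Qed.

Lemma ev_ext y y' n : (forall i, (i < n)%N -> y i = y' i) -> ev y n =1 ev y' n.
Proof.
elim: n => [//|n IH] yy p; rewrite !(evSE _ (leqnn _)) yy//.
by apply: eq_bigr => i _; rewrite IH// => j jn; apply: yy; exact: ltnW.
Qed.

Lemma ev_cst n c : exists p : polyring k n, forall y, ev y n p = c%:A.
Proof.
elim: n => [|n [p pE]]; first by exists c.
by exists p%:P => y; rewrite evC.
Qed.

Lemma ev_var n i : (i < n)%N -> exists p : polyring k n, forall y, ev y n p = y i.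
Proof.
elim: n => [//|n IH]; rewrite ltnS leq_eqVlt => /predU1P[->|/IH[p pE]].
  by exists 'X => y; rewrite evX.
by exists p%:P => y; rewrite evC.
Qed.

Lemma range_ev_sub y z n m : (forall i, (i < n)%N -> range (ev z m) (y i)) ->
  range (ev y n) `<=` range (ev z m).
Proof.
elim: n => [|n IH] yz _ [p _ <-].
  by have [q qE] := ev_cst m p; exists q.
rewrite (evSE _ (leqnn _)).
have IH' : range (ev y n) `<=` range (ev z m).
  by apply: IH => i ni; apply: yz; exact: ltnW.
elim/big_ind: _ => [|_ _ [a _ <-] [b _ <-]|i _].
- by exists 0; rewrite ?rmorph0.
- by exists (a + b); rewrite ?rmorphD.
- have [a _ <-] : range (ev z m) (ev y n (p : {poly _})`_i) by apply: IH'; eexists.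
  have [b _ <-] := yz n (ltnSn n).
  by exists (a * b ^+ i); rewrite ?rmorphM ?rmorphXn.
Qed.

(* By induction the leading coefficient of [f] is monic in [w = z n]; replacing
   the last variable by [y n - w ^+ N] with [N] large, the leading term of [f]
   also dominates in [w]. *)
Lemma nagata n y (f : polyring k n.+1) : f != 0 ->
  exists (z : nat -> B) (c : k) (a : {poly polyring k n}),
  [/\ forall i, (i < n.+1)%N -> range (ev z n.+1) (y i), c != 0, a \is monic &
      ev z n.+1 a = c *: ev y n.+1 f].
Proof.
elim: n y f => [|n IH] y f f0.
  have l0 : lead_coef f != 0 by rewrite lead_coef_eq0.
  exists y, (lead_coef f)^-1, ((lead_coef f)^-1 *: (f : {poly k})); split.
  - by move=> i i1; have [p pE] := ev_var i1; exists p.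
  - by rewrite invr_eq0.
  - by rewrite monicE lead_coefZ mulVf.
  - by rewrite -mul_polyC rmorphM evC ev0E mulr_algl.
have l0 : lead_coef (f : {poly polyring k n.+1}) != 0 by rewrite lead_coef_eq0.
have [z [c [p [yz c0 pm pE]]]] := IH y _ l0.
set m := (size (f : {poly polyring k n.+1})).-1.
have sf : size (f : {poly polyring k n.+1}) = m.+1.
  by rewrite /m prednK// size_poly_gt0.
(* All coefficients of [f] are rewritten in the variables [z], the leading one by the monic [p]. *)
have /choice[q qE] : forall j : nat, exists q : {poly polyring k n},
    ev z n.+1 q = c *: ev y n.+1 (f : {poly polyring k n.+1})`_j /\ (j = m -> q = p).
  move=> j; have [->|jm] := eqVneq j m; first by exists p; rewrite pE lead_coefE.
  have [|g _ gE] := @range_ev_sub y z n.+1 n.+1 yz (ev y n.+1 (f : {poly polyring k n.+1})`_j).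
    by eexists.
  have [d dE] := ev_cst n.+1 c.
  by exists (d * g); rewrite rmorphM dE gE mulr_algl; split=> // /eqP; rewrite (negbTE jm).
pose N := (\max_(j < m.+1) size (q j))%N.
pose v := y n.+1 - z n ^+ N.
(* [v] takes the place of [z n], which becomes the last variable; [Q] below stands for
   [y n.+1 = v + z n ^+ N] in these variables. *)
pose z' i := if (i < n)%N then z i else if i == n then v else z n.
have z'n : z' n = v by rewrite /z' ltnn eqxx.
have z'n1 : z' n.+1 = z n.
  by rewrite /z' ltnNge leqnSn/= gtn_eqF.
have z'z : ev z' n =1 ev z n by apply: ev_ext => i ni; rewrite /z' ni.
pose up (g : {poly polyring k n}) : {poly {poly polyring k n}} := map_poly polyC g.
have upE (g : {poly polyring k n}) : ev z' n.+2 (up g) = ev z n.+1 g.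
  rewrite (@evSE _ _ (size g)) ?size_map_polyC//.
  rewrite (@evSE _ _ (size g))// z'n1; apply: eq_bigr => i _; congr (_ * _).
  by rewrite /up coef_map/= -[RHS]z'z -(evC z').
pose Q : {poly {poly polyring k n}} := 'X^N + ('X)%:P.
have QE : ev z' n.+2 (Q : polyring k n.+2) = y n.+1.
  rewrite (rmorphD (ev z' n.+2)) (rmorphXn (ev z' n.+2)) (evX z' n.+1) evC evX z'n z'n1 /v.
  by rewrite addrC subrK.
have N0 : (0 < N)%N.
  have := @leq_bigmax _ (fun j : 'I_m.+1 => size (q j)) ord_max.
  rewrite (qE ord_max).2//; apply: leq_trans.
  by rewrite size_poly_gt0 monic_neq0.
have sQ : size Q = N.+1.
  by rewrite size_polyDl size_polyXn// size_polyC polyX_eq0/=.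
have mQ : Q \is monic.
  by rewrite monicE lead_coefDl ?lead_coefXn// size_polyXn size_polyC polyX_eq0.
pose a := \sum_(j < m.+1) up (q j) * Q ^+ j.
have sQn j : size (Q ^+ j) = (N * j).+1.
  by rewrite -[LHS]prednK ?size_poly_gt0 ?monic_neq0 ?monic_exp// size_exp sQ.
have mp : up p \is monic by exact: monic_map.
exists z', c, a; split=> //.
- move=> i; rewrite ltnS leq_eqVlt => /predU1P[->|/yz[g _ <-]].
    by exists Q.
  by exists (up g).
- rewrite /a big_ord_recr/= addrC (qE m).2//.
  have mpQ : up p * Q ^+ m \is monic by rewrite monicMl// monic_exp.
  rewrite monicE lead_coefDl ?(monicP mpQ)//.
  rewrite size_monicM ?monic_neq0 ?monic_exp// sQn addnS/=.
  (* A term with [i < m] has size at most [N + N * i <= N * m]; the top one has size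
     [size p + N * m]. *)
  apply: (@leq_ltn_trans (N * m)%N); last first.
    by rewrite -[X in (X < _)%N]add0n ltn_add2r size_poly_gt0 monic_neq0.
  apply: leq_trans (size_sum _ _ _) _.
  apply/bigmax_leqP => i _; apply: leq_trans (size_polyMleq _ _) _.
  rewrite sQn addnS/= size_map_polyC.
  apply: (@leq_trans (N + N * i)%N).
    rewrite leq_add2r; exact: (@leq_bigmax _ (fun j : 'I_m.+1 => size (q j)) (widen_ord (leqnSn m) i)).
  by rewrite -mulnS leq_mul2l ltn_ord orbT.
- rewrite /a (rmorph_sum (ev z' n.+2)) (@evSE _ _ m.+1) ?sf// scaler_sumr; apply: eq_bigr => i _.
  rewrite (rmorphM (ev z' n.+2)) (rmorphXn (ev z' n.+2)) upE QE (qE i).1.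
  by rewrite scalerAl.
Qed.

End Evaluation.

(** * Torsion and growth over polynomial rings *)

Section BoxDegree.
Variable k : fieldType.

(* Degree at most [N] in each variable: unlike for the total degree, the
   monomials are indexed by a product. *)
Fixpoint bdeg (n N : nat) : polyring k n -> Prop :=
  match n return polyring k n -> Prop with
  | 0 => fun=> True
  | m.+1 => fun p : {poly polyring k m} =>
      (size p <= N.+1)%N /\ forall i, bdeg N p`_i
  end.

Lemma bdeg0 n N : bdeg N (0 : polyring k n).
Proof.
elim: n => [//|n IH]; split; first by rewrite size_poly0.
by move=> i; rewrite coef0; exact: IH.
Qed.

Lemma bdegW n N N' (p : polyring k n) : (N <= N')%N -> bdeg N p -> bdeg N' p.
Proof.
move=> NN; elim: n p => [//|n IH] p [pN pi]; split; first exact: leq_trans pN _.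
by move=> i; exact: IH (pi i).
Qed.

Lemma bdegD n N (p q : polyring k n) : bdeg N p -> bdeg N q -> bdeg N (p + q).
Proof.
elim: n p q => [//|n IH] p q [pN pi] [qN qi]; split.
  by apply: leq_trans (size_polyD _ _) _; rewrite geq_max pN.
by move=> i; rewrite coefD; exact: IH (pi i) (qi i).
Qed.

Lemma bdeg_sum n N (I : finType) (p : I -> polyring k n) :
  (forall i, bdeg N (p i)) -> bdeg N (\sum_i p i).
Proof. by move=> H; elim/big_ind: _ => //; [exact: bdeg0|exact: bdegD]. Qed.

Lemma bdegM n N N' (p q : polyring k n) :
  bdeg N p -> bdeg N' q -> bdeg (N + N') (p * q).
Proof.
elim: n p q => [//|n IH] p q [pN pi] [qN qi]; split.
  apply: leq_trans (size_polyMleq _ _) _.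
  rewrite -subn1 leq_subLR; apply: leq_trans (leq_add pN qN) _.
  by rewrite addSn addnS.
by move=> i; rewrite coefM; apply: bdeg_sum => j; exact: IH (pi _) (qi _).
Qed.

Lemma bdeg_ex n (p : polyring k n) : exists N, bdeg N p.
Proof.
elim: n p => [|n IH] p; first by exists 0%N.
have /choice[N NP] := fun i : nat => IH (p : {poly _})`_i.
exists (maxn (size (p : {poly _})) (\max_(i < size (p : {poly _})) N i)); split.
  exact: leq_trans (leq_maxl _ _) (leqnSn _).
move=> i; have [ip|pi] := ltnP i (size (p : {poly _})); last first.
  by rewrite nth_default//; exact: bdeg0.
apply: bdegW (NP i); apply: leq_trans (leq_maxr _ _).
exact: (@leq_bigmax _ (fun i : 'I__ => N i) (Ordinal ip)).
Qed.

Lemma bdeg_fin n (I : finType) (p : I -> polyring k n) :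
  exists N, forall i, bdeg N (p i).
Proof.
have /choice[N NP] := fun i => bdeg_ex (p i).
by exists (\max_i N i)%N => i; apply: bdegW (NP i); exact: leq_bigmax.
Qed.

Fixpoint idx (n N : nat) : finType :=
  if n is m.+1 then (idx m N * 'I_N.+1)%type else unit.

Lemma card_idx n N : #|idx n N| = (N.+1 ^ n)%N.
Proof. by elim: n => [|n IH]; rewrite ?card_unit// card_prod IH card_ord expnSr. Qed.

Fixpoint bpoly (n N : nat) : (idx n N -> k) -> polyring k n :=
  match n return (idx n N -> k) -> polyring k n with
  | 0 => fun c => c tt
  | m.+1 => fun c => \poly_(i < N.+1) bpoly (fun a => c (a, inord i))
  end.

Lemma bdeg_bpoly n N (c : idx n N -> k) : bdeg N (bpoly c).
Proof.
elim: n c => [//|n IH] c; split; first exact: size_poly.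
by move=> i; rewrite coef_poly; case: ltnP => _; [exact: IH|exact: bdeg0].
Qed.

Lemma bdegP n N (p : polyring k n) : bdeg N p -> exists c, p = @bpoly n N c.
Proof.
elim: n p => [|n IH] p; first by exists (fun=> p).
move=> [pN pi].
have /choice[c cE] := fun i : 'I_N.+1 => IH _ (pi i).
exists (fun a => c a.2 a.1) => /=.
apply/polyP => i; rewrite coef_poly; case: ltnP => iN.
  by rewrite (cE (Ordinal iN))/=; congr bpoly; apply/funext => a; congr c;
     apply/val_inj; rewrite /= inordK.
by rewrite nth_default//; exact: leq_trans iN.
Qed.

Lemma bpoly_eq0 n N (c : idx n N -> k) : bpoly c = 0 -> forall a, c a = 0.
Proof.
elim: n c => [c c0 []//|n IH] c c0 [a i].
have /polyP/(_ i) : (bpoly c : {poly polyring k n}) = 0 by [].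
by rewrite coef_poly ltn_ord coef0 => /IH/(_ a); rewrite inord_val.
Qed.

Variable (B : comAlgType k).
Implicit Types y z : nat -> B.

Lemma bdeg_cst n c : exists2 p : polyring k n, bdeg 0 p & forall y, ev y n p = c%:A.
Proof.
elim: n => [|n [p p0 pE]]; first by exists c.
exists p%:P => [|y]; last by rewrite evC.
split; first exact: size_polyC_leq1.
by move=> i; rewrite coefC; case: eqP => _ //; exact: bdeg0.
Qed.

Fixpoint mon y (n N : nat) : idx n N -> B :=
  match n return idx n N -> B with
  | 0 => fun=> 1
  | m.+1 => fun a => mon y a.1 * y m ^+ a.2
  end.

Lemma ev_bpoly y n N (c : idx n N -> k) :
  ev y n (bpoly c) = \sum_a c a *: mon y a.
Proof.
elim: n c => [|n IH] c.
  by rewrite (big_pred1 tt)// => -[].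
rewrite (evSE _ (size_poly _ _)); under eq_bigr => i _.
  rewrite coef_poly ltn_ord IH mulr_suml; over.
rewrite exchange_big pair_big_dep/=; apply: eq_bigr => -[a i] _ /=.
by rewrite inord_val scalerAl.
Qed.

Lemma mon_bdeg y n N (a : idx n N) : exists2 p, bdeg N p & mon y a = ev y n p.
Proof.
exists (bpoly (fun b => (b == a)%:R)); first exact: bdeg_bpoly.
rewrite ev_bpoly (bigD1 a)//= eqxx scale1r big1 ?addr0// => b /negbTE ->.
by rewrite scale0r.
Qed.

Variable G : lmodType B.
Local Notation kf := (in_alg B).
Local Notation bsub := (rsub (idfun : {rmorphism B -> B})).

Lemma bsub_rsub (R : comNzRingType) (f : {rmorphism R -> B}) (U : set G) :
  bsub U -> rsub f U.
Proof. by case=> U0 UD UZ; split=> // r x Ux; exact: (UZ (f r)). Qed.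

Definition free_orbit y n (u : G) := forall p, ev y n p *: u = 0 -> p = 0.
Definition tors y n (u : G) := exists2 p, p != 0 & ev y n p *: u = 0.

Lemma torsPn y n u : ~ free_orbit y n u <-> tors y n u.
Proof.
split=> [/existsNP[p /not_implyP[pu /eqP p0]]|[p p0 pu] /(_ p pu)]; first by exists p.
by apply/eqP.
Qed.

Lemma free_indep y n N u : free_orbit y n u ->
  rindep kf (fun a : idx n N => mon y a *: u).
Proof.
move=> yu c c0 a; apply: (@bpoly_eq0 n N); apply: yu.
rewrite ev_bpoly scaler_suml -[RHS]c0; apply: eq_bigr => b _.
by rewrite scalerA mulr_algl.
Qed.

Section Box.
Variables (z : nat -> B) (m : nat) (I : finType) (e : I -> G).

(** The boxes play the role of a Hilbert function: [box N] has dimension at most [#|I| * N.+1 ^ m],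
    and each operator of [B] enlarges [N] by a constant only. *)
Definition box N : set G :=
  [set x | exists2 p : I -> polyring k m, (forall i, bdeg N (p i)) &
    x = \sum_i ev z m (p i) *: e i].

Lemma boxD N x x' : box N x -> box N x' -> box N (x + x').
Proof.
move=> [p pN ->] [q qN ->]; exists (fun i => p i + q i).
  by move=> i; exact: bdegD.
by rewrite -big_split; apply: eq_bigr => i _ /=; rewrite rmorphD scalerDl.
Qed.

Lemma box0 N : box N 0.
Proof.
exists (fun=> 0); first by move=> i; exact: bdeg0.
by rewrite big1// => i _; rewrite rmorph0 scale0r.
Qed.

Lemma box_sum N (J : Type) (r : seq J) (P : pred J) (x : J -> G) :
  (forall j, P j -> box N (x j)) -> box N (\sum_(j <- r | P j) x j).
Proof. by move=> H; elim/big_ind: _ => //; [exact: box0|exact: boxD]. Qed.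

Lemma boxW N N' x : (N <= N')%N -> box N x -> box N' x.
Proof. by move=> NN [p pN ->]; exists p => // i; exact: bdegW NN (pN i). Qed.

Lemma box_ex x : rspan (ev z m) e x -> exists N, box N x.
Proof. by move=> [p ->]; have [N NP] := bdeg_fin p; exists N, p. Qed.

Lemma box_ev N N' p x : bdeg N p -> box N' x -> box (N + N') (ev z m p *: x).
Proof.
move=> pN [q qN ->]; exists (fun i => p * q i).
  by move=> i; exact: bdegM.
by rewrite scaler_sumr; apply: eq_bigr => i _; rewrite rmorphM scalerA.
Qed.

Lemma box_span N : exists w : idx m N * I -> G, box N `<=` rspan kf w.
Proof.
exists (fun a => mon z a.1 *: e a.2) => x [p pN ->].
have /choice[c cE] := fun i => bdegP (pN i).
exists (fun a => c a.2 a.1); rewrite -(pair_big xpredT xpredT (fun a i => (c i a)%:A *: (mon z a *: e i))).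
rewrite exchange_big; apply: eq_bigr => i _.
by rewrite [in LHS]cE ev_bpoly scaler_suml; apply: eq_bigr => a _; rewrite scalerA mulr_algl.
Qed.

Hypothesis US : bsub (rspan (ev z m) e).

Lemma box_shift (b : B) : exists c, forall N x, box N x -> box (N + c) (b *: x).
Proof.
have [_ _ UZ] := US.
have /choice[p pE] i : exists p : I -> polyring k m,
    b *: e i = \sum_j ev z m (p j) *: e j.
  by have [p] := UZ b _ (rspan_gen _ e i); exists p.
have [c cP] := bdeg_fin (fun ij : I * I => p ij.1 ij.2).
exists c => N x [q qN ->]; rewrite scaler_sumr; apply: box_sum => i _.
rewrite scalerA mulrC -scalerA; apply: box_ev => //.
by exists (p i) => // j; exact: (cP (i, j)).
Qed.

(** The enlargement is linear in the degree [L], so that an orbit under any number of variables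
    stays in a box whose side is linear in [L]. *)
Lemma box_ev_shift (y : nat -> B) n : exists c, forall L p N x, bdeg L p ->
  box N x -> box (N + c * L) (ev y n p *: x).
Proof.
elim: n => [|n [c cP]].
  exists 0%N => L p N x _ Nx; rewrite mul0n addn0.
  have [q q0 qE] := bdeg_cst m p; rewrite ev0E -(qE z) -[N]add0n; exact: box_ev.
have [d dP] := box_shift (y n).
have dP' i N x : box N x -> box (N + d * i) (y n ^+ i *: x).
  elim: i => [|i IH] in N x *; first by rewrite muln0 addn0 expr0 scale1r.
  by move=> Nx; rewrite exprSr -scalerA mulnS addnA; apply: IH; exact: dP.
exists (c + d)%N => L p N x [pL pi] Nx.
rewrite (evSE _ pL) scaler_suml; apply: box_sum => i _.
rewrite -scalerA mulnDl addnCA addnC -addnA [X in box X]addnC.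
apply: boxW (cP L _ (N + d * L)%N _ (pi i) _).
  lia.
apply: boxW (dP' i _ _ Nx); rewrite leq_add2l leq_mul2l.
by rewrite -ltnS ltn_ord orbT.
Qed.

End Box.
End BoxDegree.

Lemma leq_exp_bound (n m K : nat) :
  (forall N, (N.+1 ^ n <= K * N.+1 ^ m)%N) -> (n <= m)%N.
Proof.
(* At [N = K] the bound reads [K.+1 ^ n <= K * K.+1 ^ m < K.+1 ^ m.+1]. *)
move=> H; rewrite leqNgt; apply/negP => mn; have := H K.
apply/negP; rewrite -ltnNge.
apply: (@leq_trans (K.+1 ^ m.+1)); last by rewrite leq_pexp2l.
by rewrite expnS ltn_mul2r expn_gt0 ltnSn.
Qed.

Notation bsub := (rsub (idfun : {rmorphism _ -> _})).

Section Finite.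
Variables (k : fieldType) (B : comAlgType k) (G : lmodType B).
Implicit Types (y z : nat -> B) (U : set G) (u x : G).
Local Notation kf := (in_alg B).

Lemma fgen_sub y n U U' : fgen (ev y n) U -> rsub (ev y n) U' -> U' `<=` U ->
  fgen (ev y n) U'.
Proof.
move=> [I [v ->]] U'S; rewrite rspan_ord => UU'.
exact: fgen_noeth (@polyring_noetherian k n) U'S UU'.
Qed.

Lemma torsD y n u x : tors y n u -> tors y n x -> tors y n (u + x).
Proof.
move=> [p p0 pu] [q q0 qx]; exists (p * q); first by rewrite mulf_neq0.
rewrite scalerDr rmorphM -[X in _ + X]scalerA qx scaler0 addr0.
by rewrite mulrC -scalerA pu scaler0.
Qed.

Lemma torsZ y n b x : tors y n x -> tors y n (b *: x).
Proof.
by move=> [p p0 px]; exists p => //; rewrite scalerA mulrC -scalerA px scaler0.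
Qed.

Lemma tors0 y n : tors y n (0 : G).
Proof. by exists 1; rewrite ?oner_neq0// scaler0. Qed.

Lemma tors_zero y x : tors y 0 x -> x = 0.
Proof.
move=> [p p0 px]; rewrite -[x]scale1r -(rmorph1 (ev y 0)).
rewrite -(mulVf (p0 : (p : k) != 0)).
by rewrite (rmorphM (ev y 0)) -scalerA px scaler0.
Qed.

Lemma tors_bsub y n : bsub (tors y n : set G).
Proof. by split; [exact: tors0|move=> *; exact: torsD|move=> *; exact: torsZ]. Qed.

Lemma tors_ann y n U : fgen (ev y n) U -> U `<=` tors y n ->
  exists2 f, f != 0 & forall x, U x -> ev y n f *: x = 0.
Proof.
move=> [I [e UE]] Ut.
have /choice[p pP] i : exists p, p != 0 /\ ev y n p *: e i = 0.
  by have [|p p0 pe] := Ut (e i); [rewrite UE; exact: rspan_gen|exists p].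
exists (\prod_i p i); first by apply/prodf_neq0 => i _; case: (pP i).
move=> x; rewrite UE => -[c ->]; rewrite scaler_sumr big1// => i _.
by rewrite scalerA mulrC -scalerA (bigD1 i)//= rmorphM mulrC -scalerA (pP i).2 !scaler0.
Qed.

(** Remainders modulo the monic [a], which kills [U], involve finitely many powers of [z n]; the
    products of these powers with the old generators suffice. *)
Lemma nagata_fgen y n U z (a : {poly polyring k n}) :
  bsub U -> fgen (ev y n.+1) U ->
  (forall i, (i < n.+1)%N -> range (ev z n.+1) (y i)) ->
  a \is monic -> (forall x, U x -> ev z n.+1 a *: x = 0) ->
  fgen (ev z n) U.
Proof.
move=> US [I [e UE]] yz am aU.
exists (I * 'I_(size a))%type, (fun ij : I * 'I_(size a) => z n ^+ ij.2 *: e ij.1).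
have Ue i : U (e i) by rewrite UE; exact: rspan_gen.
apply/seteqP; split; last first.
  by apply: rspan_min => [|ij]; [exact: bsub_rsub|case: US => _ _; apply].
move=> x Ux; move: (Ux); rewrite {1}UE => -[c ->].
apply: rsub_sum => [|i _]; first exact: rspan_sub.
have [|p _ <-] := range_ev_sub yz (t := ev y n.+1 (c i)); first by eexists.
have pE : (p : {poly _}) = Pdiv.Ring.rdivp p a * a + Pdiv.Ring.rmodp p a by exact: Pdiv.RingMonic.rdivp_eq.
have sr : (size (Pdiv.Ring.rmodp (p : {poly _}) a) <= size a)%N.
  by apply: ltnW; rewrite Pdiv.Ring.ltn_rmodp monic_neq0.
rewrite [X in ev z n.+1 X]pE (rmorphD (ev z n.+1)) (rmorphM (ev z n.+1)).
rewrite scalerDl -scalerA aU// scaler0 add0r (evSE _ sr) scaler_suml.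
apply: rsub_sum => [|j _]; first exact: rspan_sub.
rewrite -scalerA; have [_ _] := rspan_sub (ev z n) (fun ij : I * 'I_(size a) => z n ^+ ij.2 *: e ij.1).
by apply; exact: (rspan_gen _ _ (i, j)).
Qed.

Lemma tors_fgen y n U : bsub U -> fgen (ev y n.+1) U -> U `<=` tors y n.+1 ->
  exists z, fgen (ev z n) U.
Proof.
move=> US Ufg /(tors_ann Ufg)[f f0 fU].
have [z [c [a [yz c0 am aE]]]] := nagata y f0.
exists z; apply: nagata_fgen yz am _ => // x Ux.
by rewrite aE -mulr_algl -scalerA fU// scaler0.
Qed.

(** As long as the module is torsion, Nagata's change of variables removes a variable; with none
    left, torsion means zero. *)
Lemma normalization y n U : bsub U -> fgen (ev y n) U ->
  U = [set 0] \/ exists m z u, [/\ U u, fgen (ev z m) U & free_orbit z m u].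
Proof.
move=> US; have key n' y' : (exists2 u, U u & free_orbit y' n' u) \/ U `<=` tors y' n'.
  have [|H] := pselect (exists2 u, U u & free_orbit y' n' u); first by left.
  by right=> u Uu; apply/torsPn => yu; apply: H; exists u.
elim: n y => [|n IH] y Ufg; [case: (key 0%N y) => [[u Uu yu]|Ut]|case: (key n.+1 y) => [[u Uu yu]|Ut]].
- by right; exists 0%N, y, u.
- left; apply/seteqP; split=> [u Uu|_ ->]; last by case: US.
  exact: tors_zero (Ut u Uu).
- by right; exists n.+1, y, u.
- by have [z] := tors_fgen US Ufg Ut; exact: IH.
Qed.

Section BoxCount.
Variables (z : nat -> B) (m : nat) (I : finType) (e : I -> G).

Lemma box_card (J : finType) (v : J -> G) N : rindep kf v ->
  (forall j, box z m e N (v j)) -> (#|J| <= #|I| * N.+1 ^ m)%N.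
Proof.
move=> vI vN; have [w wP] := box_span z m e N.
rewrite -card_idx mulnC -card_prod; apply: steinitz vI _ => j.
exact/wP/vN.
Qed.

End BoxCount.

(** A free orbit contains [N.+1 ^ n] independent vectors with exponents up to [N], all in a box of
    dimension [O(N ^ m)]. So the number of variables in a normalization is an invariant. *)
Lemma free_orbit_dim y n z m U u : bsub U -> fgen (ev z m) U -> U u -> free_orbit y n u ->
  (n <= m)%N.
Proof.
move=> US [I [e UE]] Uu yu; rewrite UE in US Uu.
have [N0 uN0] := box_ex Uu.
have [c cP] := box_ev_shift US y n.
apply: (@leq_exp_bound _ _ (#|I| * (N0 + c).+1 ^ m)%N) => N.
rewrite -(card_idx n N).
have /leq_trans -> // : (#|idx n N| <= #|I| * (N0 + c * N).+1 ^ m)%N.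
  apply: (box_card (free_indep (N := N) yu)) => a.
  by have [p pN ->] := mon_bdeg y a; exact: cP.
rewrite -mulnA leq_mul2l -expnMn; apply/orP; right.
case: m {UE US Uu uN0 cP} => [|m]; first by rewrite !expn0.
rewrite leq_exp2r// mulSn mulnDl; lia.
Qed.

End Finite.

(** * Graded modules *)

Lemma bdeg1 k n N : bdeg N (1 : polyring k n).
Proof.
elim: n => [//|n IH]; split; first by rewrite size_polyC oner_eq0.
by move=> i; rewrite coef1; case: eqP => _ //; exact: bdeg0.
Qed.

Section Grading.
Variables (k : fieldType) (B : comAlgType k).

(* [hm i] is the set of homogeneous elements of degree [i]; only the data used in
   the growth estimates are recorded. *)
Record ring_grading := RingGrading {
  hm :> int -> set B;
  hm1 : hm 0 1;
  hmM : forall i j a b, hm i a -> hm j b -> hm (i + j) (a * b);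
  hmZ : forall (c : k) i a, hm i a -> hm i (c *: a);
  hgen : nat -> B;
  hnum : nat;
  hdeg : nat -> nat;
  hdeg_gt0 : forall i, (i < hnum)%N -> (0 < hdeg i)%N;
  hgen_hm : forall i, (i < hnum)%N -> hm (hdeg i)%:Z (hgen i);
  hgen_ev : forall x, range (ev hgen hnum) x }.

Variable h : ring_grading.
Local Notation kf := (in_alg B).

Fixpoint mdeg (n N : nat) : idx n N -> nat :=
  match n return idx n N -> nat with
  | 0 => fun=> 0%N
  | m.+1 => fun a => (mdeg a.1 + hdeg h m * a.2)%N
  end.

Lemma mon_hm n N (a : idx n N) : (n <= hnum h)%N -> h (mdeg a)%:Z (mon (hgen h) a).
Proof.
elim: n a => [|n IH] a nh; first exact: hm1.
rewrite /= PoszD; apply: hmM; first by apply: IH; exact: ltnW.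
case: a => a [i iN] /=; elim: i {iN} => [|i IHi].
  by rewrite muln0 expr0; exact: hm1.
by rewrite mulnS PoszD exprS; apply: hmM => //; exact: hgen_hm.
Qed.

(** As the generators have positive degrees, the degree of a monomial bounds its exponents. *)
Lemma mon_mdeg n N (a : idx n N) : (n <= hnum h)%N ->
  exists2 p, bdeg (mdeg a) p & mon (hgen h) a = ev (hgen h) n p.
Proof.
elim: n a => [|n IH] a nh; first by exists 1; rewrite ?rmorph1.
case: a => a i; have [p pa pE] := IH a (ltnW nh).
exists (p%:P * 'X^i); last by rewrite (rmorphM (ev _ n.+1)) (rmorphXn (ev _ n.+1)) evC evX -pE.
apply: (@bdegW _ _ (mdeg a + i)); first by rewrite /= leq_add2l leq_pmull// hdeg_gt0.
apply: bdegM; split=> [|j].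
- exact: leq_trans (size_polyC_leq1 _) _.
- by rewrite coefC; case: eqP => _ //; exact: bdeg0.
- by rewrite size_polyXn.
- by rewrite coefXn; case: eqP => _ /=; [exact: bdeg1|exact: bdeg0].
Qed.

Variable G : lmodType B.

Record mod_grading := ModGrading {
  hcomp : int -> G -> G;
  hcompD : forall n x y, hcomp n (x + y) = hcomp n x + hcomp n y;
  hcomp_comp : forall m n x, hcomp m (hcomp n x) = if m == n then hcomp n x else 0;
  hcomp_dec : forall x, exists r : seq int, [/\ uniq r,
    forall n, n \notin r -> hcomp n x = 0 & x = \sum_(n <- r) hcomp n x];
  hcompM : forall i n b x, h i b -> hcomp (i + n) (b *: x) = b *: hcomp n x }.

Variable g : mod_grading.
Implicit Types (x u : G) (U : set G) (y z : nat -> B).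

Lemma hcomp0 n : hcomp g n 0 = 0.
Proof. by apply: (addrI (hcomp g n 0)); rewrite -hcompD !addr0. Qed.

Lemma hcomp_sum n (J : Type) (r : seq J) (P : pred J) (f : J -> G) :
  hcomp g n (\sum_(j <- r | P j) f j) = \sum_(j <- r | P j) hcomp g n (f j).
Proof. exact: (big_morph _ (hcompD g n) (hcomp0 n)). Qed.

Lemma hcompN n x : hcomp g n (- x) = - hcomp g n x.
Proof. by apply/eqP; rewrite -addr_eq0 -hcompD addNr hcomp0. Qed.

Lemma hcompk n (c : k) x : hcomp g n (c%:A *: x) = c%:A *: hcomp g n x.
Proof. by rewrite -[n in LHS]add0r hcompM//; apply: hmZ; exact: hm1. Qed.

Lemma hcomp_eq0 x : (forall n, hcomp g n x = 0) -> x = 0.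
Proof.
move=> x0; have [r [_ _ ->]] := hcomp_dec g x.
by rewrite big1// => n _; exact: x0.
Qed.

(* If [hcomp g t x] is not torsion, its orbit under the polynomials in [m + 1]
   variables grows like [N ^ (m + 1)]. Independent multiples of it by homogeneous
   elements give independent multiples of [x], whose orbit grows like [N ^ m]. *)
Lemma top_tors y m z U x t : bsub U -> fgen (ev z m) U -> U x ->
  (forall j, t < j -> hcomp g j x = 0) -> tors y m.+1 (hcomp g t x).
Proof.
move=> US [I [e UE]] Ux xt; apply/torsPn => yF; rewrite UE in US Ux.
pose b := hgen h; pose r := hnum h.
have [N0 xN0] := box_ex Ux.
have [c2 c2P] := box_ev_shift US b r.
pose one := fun _ : unit => 1 : B^o.
have oneS : bsub (rspan (ev b r) one).
  suff -> : rspan (ev b r) one = setT by [].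
  apply/seteqP; split=> // s _; have [p _ ps] := hgen_ev h s.
  by exists (fun=> p); rewrite (big_pred1 tt) => [|[]//]; rewrite -ps [RHS]mulr1.
have [c1 c1P] := box_ev_shift oneS y m.+1.
(* The [y] are not homogeneous: their monomials are rewritten in the homogeneous generators [b],
   which multiplies the bound on the exponents by [c1]. *)
have monE N (a : idx m.+1 N) : exists c : idx r (c1 * N) -> k,
    mon y a = \sum_a' c a' *: mon b a'.
  have [p pN ->] := mon_bdeg y a.
  have one0 : box b r one 0 1.
    exists (fun=> 1); first by move=> _; exact: bdeg1.
    by rewrite (big_pred1 tt) => [|[]//]; rewrite rmorph1 scale1r.
  have [q qN] := c1P _ _ _ _ pN one0; rewrite (big_pred1 tt) => [|[]//].
  rewrite [LHS]mulr1 [RHS]mulr1 => ->; rewrite add0n in qN.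
  by have [c ->] := bdegP (qN tt); exists c; rewrite ev_bpoly.
suff /(@leq_exp_bound m.+1 m) : forall N, (N.+1 ^ m.+1 <= #|I| * (N0 + c2 * c1).+1 ^ m * N.+1 ^ m)%N.
  by rewrite ltnn.
move=> N; pose L := (c1 * N)%N; rewrite -(card_idx m.+1 N).
pose w (a : idx r L) := mon b a *: hcomp g t x.
have [|I' [v' [v'I v'w v'max]]] := @max_indep k B kf G (range w) #|idx r L|.
  move=> J v vI vw; apply: (steinitz vI (w := w)) => j.
  by have [a _ <-] := vw j; exact: rspan_gen.
have wv' a : rspan kf v' (w a).
  have [|c c0] := v'max (w a); first by exists a.
  have [_ _ /[apply]] := rspan_sub kf v'; move=> /(_ c^-1).
  by rewrite scalerA -rmorphM mulVf// rmorph1 scale1r.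
have /leq_trans -> // : (#|idx m.+1 N| <= #|I'|)%N.
  apply: (steinitz (free_indep (N := N) yF) (w := v')) => a.
  have [c ->] := monE N a; rewrite scaler_suml.
  apply: rsub_sum => [|a' _]; first exact: rspan_sub.
  by rewrite -mulr_algl -scalerA; have [_ _ /(_ (c a') _ (wv' a'))] := rspan_sub kf v'.
have /choice[s sE] i : exists a, w a = v' i by have [a] := v'w i; exists a.
have v''I : rindep kf (fun i => mon b (s i) *: x).
  move=> c c0; apply: contrapT => /existsNP[i0 /eqP ci0].
  (* As [x] has no component above [t], only the terms of maximal degree [mdeg (s i)] contribute to
     the component of degree [mdeg (s i) + t], and they do so through [hcomp g t x]. *)
  have [i ci imax] := @arg_maxnP _ i0 (fun i => c i != 0) (fun i => mdeg (s i)) ci0.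
  pose c' j := if mdeg (s j) == mdeg (s i) then c j else 0.
  suff /v'I/(_ i)/eqP : \sum_j kf (c' j) *: v' j = 0.
    by rewrite /c' eqxx (negbTE ci).
  rewrite -[RHS](hcomp0 ((mdeg (s i))%:Z + t)) -[X in hcomp g _ X]c0 hcomp_sum; apply: eq_bigr => j _.
  rewrite hcompk /c'.
  case: eqP => [ji|ji]; first by rewrite -ji hcompM -?sE//; exact: mon_hm.
  rewrite rmorph0 scale0r; have [->|cj] := eqVneq (c j) 0.
    by rewrite !scale0r.
  have {}ji : (mdeg (s j) < mdeg (s i))%N.
    by rewrite ltn_neqAle; apply/andP; split; [exact/eqP|exact: imax].
  have -> : (mdeg (s i))%:Z + t = (mdeg (s j))%:Z + ((mdeg (s i))%:Z - (mdeg (s j))%:Z + t) by ring.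
  by rewrite hcompM ?xt ?scaler0//; [lia|exact: mon_hm].
apply: leq_trans (box_card v''I (z := z) (m := m) (e := e) (N := (N0 + c2 * L)%N) _) _.
  by move=> i; have [p pN ->] := mon_bdeg b (s i); exact: c2P.
rewrite -mulnA leq_mul2l -expnMn; apply/orP; right.
have [->|m0] := posnP m; first by rewrite !expn0.
by rewrite leq_exp2r// mulSn mulnDl /L; lia.
Qed.

Definition gsub U : Prop := forall n x, U x -> U (hcomp g n x).

Lemma hcomp_support (I : finType) (x : I -> G) : exists r : seq int,
  uniq r /\ forall i n, n \notin r -> hcomp g n (x i) = 0.
Proof.
have /choice[r rP] i : exists r : seq int, forall n, n \notin r -> hcomp g n (x i) = 0.
  by have [r [_ ? _]] := hcomp_dec g (x i); exists r.
exists (undup (flatten [seq r i | i <- enum I])); split; first exact: undup_uniq.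
move=> i n; rewrite mem_undup => nr; apply: rP; apply: contra nr => nr.
by apply/flattenP; exists (r i) => //; apply/mapP; exists i => //; rewrite mem_enum.
Qed.

Lemma hcomp_sum_seq (r : seq int) x : uniq r -> (forall n, n \notin r -> hcomp g n x = 0) ->
  x = \sum_(n <- r) hcomp g n x.
Proof.
move=> ur xr; apply/eqP; rewrite -subr_eq0; apply/eqP/hcomp_eq0 => n.
rewrite hcompD hcompN hcomp_sum; apply/eqP; rewrite subr_eq0; apply/eqP.
have [nr|nr] := boolP (n \in r); last first.
  rewrite xr// big_seq big1// => i ir; rewrite hcomp_comp.
  by case: eqP => // ni; rewrite -ni xr.
rewrite (bigD1_seq n)//= hcomp_comp eqxx big1 ?addr0// => i /negbTE ni.
by rewrite hcomp_comp eq_sym ni.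
Qed.

Lemma seq_int_max (r : seq int) : r != [::] ->
  exists2 t, t \in r & forall j, j \in r -> j <= t.
Proof.
elim: r => [//|i r IH] _; have [->|/IH[t tr tP]] := eqVneq r [::].
  by exists i; rewrite ?mem_head// => j; rewrite inE => /eqP->.
have [it|ti] := lerP i t.
  exists t; first by rewrite inE tr orbT.
  by move=> j; rewrite inE => /predU1P[->|/tP].
exists i; first exact: mem_head.
by move=> j; rewrite inE => /predU1P[->//|/tP jt]; exact: le_trans jt (ltW ti).
Qed.

(** The multiples of a torsion [x] form a finite module over one variable less, so [top_tors]
    applies to the largest component. It is subtracted, and the support shrinks. *)
Lemma tors_comp y d U x : bsub U -> gsub U -> fgen (ev y d) U -> U x ->
  tors y d x -> forall j, tors y d (hcomp g j x).
Proof.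
case: d => [|m] US Ug Ufg Ux yx.
  by move=> j; rewrite (tors_zero yx) hcomp0; exact: tors0.
have [r [ur xr _]] := hcomp_dec g x.
have [n rn] : exists n, (size r <= n)%N by exists (size r).
elim: n => [|n IH] in r x ur xr rn Ux yx *.
  by move=> j; rewrite xr; [exact: tors0|move: rn; rewrite leqn0 => /nilP ->].
have [r0|r0] := eqVneq r [::]; first by move=> j; rewrite xr ?r0//; exact: tors0.
have [t tr tmax] := seq_int_max r0.
have tx : tors y m.+1 (hcomp g t x).
  pose W : set G := range (fun b => b *: x).
  have WS : bsub W.
    split; first by exists 0 => //; rewrite scale0r.
      by move=> _ _ [a _ <-] [b _ <-]; exists (a + b) => //; rewrite scalerDl.
    by move=> c _ [a _ <-]; exists (c * a) => //; rewrite scalerA.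
  have WU : W `<=` U by move=> _ [b _ <-]; case: US => _ _; apply.
  have Wfg : fgen (ev y m.+1) W by apply: fgen_sub Ufg _ WU; exact: bsub_rsub.
  have [|z zW] := tors_fgen WS Wfg; first by move=> _ [b _ <-]; exact: torsZ.
  apply: (top_tors y WS zW); first by exists 1 => //; rewrite scale1r.
  move=> j tj; apply: xr; apply/negP => /tmax.
  by rewrite leNgt tj.
move=> j; have [->//|jt] := eqVneq j t.
have -> : hcomp g j x = hcomp g j (x - hcomp g t x).
  by rewrite hcompD hcompN hcomp_comp (negbTE jt) subr0.
apply: (IH (rem t r)).
- exact: rem_uniq.
- move=> i; rewrite mem_rem_uniq// inE negb_and negbK hcompD hcompN hcomp_comp.
  move=> /orP[/eqP->|ir]; first by rewrite eqxx subrr.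
  by rewrite xr// add0r; case: eqP => [<-|_]; rewrite ?xr// oppr0.
- by rewrite size_rem// -ltnS prednK// lt0n size_eq0.
- by apply: (rsubB US) => //; exact: Ug.
- by rewrite -scaleN1r; apply: torsD => //; exact: torsZ.
Qed.

Lemma homog_gens z m U : bsub U -> gsub U -> fgen (ev z m) U ->
  exists (I : finType) (e : I -> G) (d : I -> int),
  [/\ forall i, U (e i), forall i, hcomp g (d i) (e i) = e i &
   forall x n, U x -> hcomp g n x = x ->
   exists L (c : I -> idx (hnum h) L -> k), x = \sum_i
     \sum_(a : idx (hnum h) L | (mdeg a)%:Z + d i == n) (c i a *: mon (hgen h) a) *: e i].
Proof.
move=> US Ug [I [e UE]]; have [r [ur er]] := hcomp_support e.
have Ue i : U (e i) by rewrite UE; exact: rspan_gen.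
exists (I * 'I_(size r))%type, (fun i : I * 'I_(size r) => hcomp g r`_i.2 (e i.1)), (fun i : I * 'I_(size r) => r`_i.2).
split=> [i|i|x n]; [exact: Ug|by rewrite hcomp_comp eqxx|].
rewrite {1}UE => -[c ->].
have /choice[q qE] i : exists q, ev z m (c i) = ev (hgen h) (hnum h) q.
  by have [q _] := hgen_ev h (ev z m (c i)); exists q.
have [L qL] := bdeg_fin q.
have /choice[f fE] i := bdegP (qL i).
move=> <-; exists L, (fun i a => f i.1 a).
rewrite hcomp_sum -(pair_bigA _ (fun i (j : 'I_(size r)) =>
  \sum_(a : idx (hnum h) L | (mdeg a)%:Z + r`_j == n)
     (f i a *: mon (hgen h) a) *: hcomp g r`_j (e i)))/=.
apply: eq_bigr => i _; rewrite qE fE ev_bpoly.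
rewrite [X in _ *: X](hcomp_sum_seq ur (er i)) scaler_sumr hcomp_sum.
rewrite (big_nth 0) big_mkord; apply: eq_bigr => j _.
rewrite scaler_suml hcomp_sum [RHS]big_mkcond; apply: eq_bigr => a _.
have -> : n = (mdeg a)%:Z + (n - (mdeg a)%:Z) by ring.
rewrite hcompM ?hcomp_comp; last by apply: hmZ; exact: mon_hm.
rewrite (inj_eq (addrI _)) eq_sym.
by case: eqP => [->|] //; rewrite scaler0.
Qed.

Lemma graded_below z m U : bsub U -> gsub U -> fgen (ev z m) U ->
  exists d : int, forall n x, U x -> hcomp g n x = x -> n < d -> x = 0.
Proof.
move=> US Ug /(homog_gens US Ug)[I [e [d [_ _ eP]]]].
exists (- (\sum_i `|d i|)%:Z) => n x Ux nx nd.
have [L [c ->]] := eP x n Ux nx.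
rewrite big1// => i _; rewrite big_pred0// => a; apply/negbTE/eqP => an.
have : (`|d i| <= \sum_i `|d i|)%N by rewrite (bigD1 i)//= leq_addr.
lia.
Qed.

Lemma graded_bound z m U : bsub U -> gsub U -> fgen (ev z m) U ->
  exists K : nat, forall N : nat, exists (J : finType) (w : J -> G),
    (#|J| <= K * N.+1 ^ m)%N /\
    forall n x, U x -> n <= N%:Z -> hcomp g n x = x -> rspan kf w x.
Proof.
move=> US Ug Ufg; have [I [e [d [Ue _ eP]]]] := homog_gens US Ug Ufg.
have [I' [e' UE]] := Ufg; rewrite UE in US Ue.
have /choice[M0 M0P] i := box_ex (Ue i).
pose M := (\max_i M0 i)%N; pose D := (\sum_i `|d i|)%N.
have [c cP] := box_ev_shift US (hgen h) (hnum h).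
exists (#|I'| * (M + c * D + c).+1 ^ m)%N => N.
have [w wP] := box_span z m e' (M + c * (N + D))%N.
exists _, w; split.
  rewrite card_prod card_idx mulnC -mulnA leq_mul2l -expnMn; apply/orP; right.
  have [->|m0] := posnP m; first by rewrite !expn0.
  by rewrite leq_exp2r//; lia.
move=> n x Ux nN nx; apply: wP; have [L [f ->]] := eP x n Ux nx.
apply: box_sum => i _; apply: box_sum => a /eqP an.
have [p pa pE] := mon_mdeg a (leqnn _).
have dD : (`|d i| <= D)%N by rewrite /D (bigD1 i)//= leq_addr.
have aN : (mdeg a <= N + D)%N by lia.
have [q q0 qE] := bdeg_cst B m (f i a).
rewrite -mulr_algl -scalerA -(qE z) -[(M + _)%N]add0n; apply: box_ev => //.
rewrite pE; apply: cP; first exact: bdegW aN pa.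
by apply: boxW (M0P i); exact: leq_bigmax.
Qed.

End Grading.

(** * Symbols *)

HB.instance Definition _ (k : fieldType) A F grC :=
  GRing.Lmodule.copy (@com_gr k A F grC) (gr F).
HB.instance Definition _ (k : fieldType) A F grC :=
  GRing.Lmodule_isLalgebra.Build k (@com_gr k A F grC) (@gr_scaleAl k A F).
HB.instance Definition _ (k : fieldType) A F grC :=
  GRing.Lalgebra_isAlgebra.Build k (@com_gr k A F grC) (@gr_scaleAr k A F).

Definition cgr_mod (k : fieldType) (A : algType k) (F : filtration A)
  (grC : commutative (@GRing.mul (gr F))) (M : lmodType A)
  (FM : mod_filtration F M) : Type := gr_mod FM.
HB.instance Definition _ (k : fieldType) A F grC M FM :=
  GRing.Zmodule.on (@cgr_mod k A F grC M FM).
HB.instance Definition _ (k : fieldType) A F grC M FM :=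
  GRing.Zmodule_isLmodule.Build (com_gr grC) (@cgr_mod k A F grC M FM)
  (@gr_mod_scaleA k A F M FM) (@gr_mod_scale1 k A F M FM)
  (@gr_mod_scaleDr k A F M FM) (@gr_mod_scaleDl k A F M FM).

Section RingSymbol.
Variables (k : fieldType) (A : algType k) (F : filtration A).

Lemma filtZ n c a : F n a -> F n (c *: a).
Proof. exact: submod_memZ (filt_submod F n) _ _. Qed.

Lemma filtX n a l : F n a -> F (n *+ l) (a ^+ l).
Proof.
move=> Fa; elim: l => [|l IH]; first exact: filt1.
by rewrite mulrS exprS; exact: filtM.
Qed.

(* The symbol of [a] in degree [n], [0] unless [F n a]. *)
Definition asym n (a : A) : gr F :=
  if pselect (F n a) is left Fa then gr_pi (rees_mono Fa) else 0.

Lemma asymE n a (Fa : F n a) : asym n a = gr_pi (rees_mono Fa).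
Proof. by rewrite /asym; case: pselect => // Fa'; congr gr_pi; exact: rees_eq. Qed.

Lemma gr_piE (x : rees F) (r : seq int) : uniq r ->
  (forall n, n \notin r -> x n = 0) -> gr_pi x = \sum_(n <- r) asym n (x n).
Proof.
move=> ur xr; transitivity (gr_pi (\sum_(n <- r) rees_mono (rees_filt x n))).
  congr gr_pi; apply: rees_eq; apply/funext => m.
  transitivity (\sum_(n <- r) lmono n (x n) m); last first.
    by elim/big_rec2: _ => [|i y z _ ->].
  rewrite /lmono; have [mr|mr] := boolP (m \in r).
    rewrite (bigD1_seq m)//= eqxx big1 ?addr0// => i /negbTE.
    by rewrite eq_sym => ->.
  rewrite xr// big_seq big1// => i ir; case: eqP => // mi.
  by rewrite mi ir in mr.
have pi0 : gr_pi (0 : rees F) = 0.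
  by apply: (addrI (gr_pi 0)); rewrite -gr_piD !addr0.
rewrite (big_morph _ (@gr_piD _ _ F) pi0).
by apply: eq_bigr => i _; rewrite (asymE (rees_filt x i)).
Qed.

Lemma asymM i j a b : F i a -> F j b -> asym i a * asym j b = asym (i + j) (a * b).
Proof.
move=> Fa Fb; rewrite (asymE Fa) (asymE Fb) (asymE (filtM Fa Fb)) -gr_piM; congr gr_pi.
apply: rees_eq; rewrite rees_mulE; apply/funext => n.
rewrite conv_mono /= /lmono subr_eq addrC.
by case: eqP => _; rewrite ?scaler0.
Qed.

Lemma asymZ i a (c : k) : F i a -> c *: asym i a = asym i (c *: a).
Proof.
move=> Fa; rewrite (asymE Fa) (asymE (filtZ c Fa)) -gr_piZ; congr gr_pi.
apply: rees_eq; apply/funext => n; rewrite rees_coefZ /= /lmono.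
by case: eqP => _; rewrite ?scaler0.
Qed.

Lemma asym1 : asym 0 1 = 1.
Proof. by rewrite (asymE (filt1 F)). Qed.

Lemma asym_comp i a : F i a -> gr_comp (F := F) i (asym i a).
Proof.
move=> Fa; exists (rees_mono Fa); last by rewrite (asymE Fa).
by move=> j ji; rewrite /= /lmono (negbTE ji).
Qed.

End RingSymbol.

Section ModuleSymbol.
Variables (k : fieldType) (A : algType k) (F : filtration A).
Variables (grC : commutative (@GRing.mul (gr F))).
Variables (M : lmodType A) (FM : mod_filtration F M).
Local Notation B := (com_gr grC).
Local Notation E := (cgr_mod grC FM).

Lemma mfiltB n (x y : M) : FM n x -> FM n y -> FM n (x - y).
Proof. by move=> Fx Fy; apply: mfiltD => //; exact: mfiltN. Qed.

Fact sym_subproof n (x : M) : FM n x -> lmono n x \in rees_mod_pred FM.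
Proof.
move=> Fx; apply/asboolP; split; first exact: mono_supp.
by move=> i; rewrite /lmono; case: eqP => [->|_]//; exact: mfilt0.
Qed.

(* The symbol of [x] in degree [n], [0] unless [FM n x]. *)
Definition sym n (x : M) : E :=
  if pselect (FM n x) is left Fx then gr_mod_pi (ReesMod (sym_subproof Fx)) else 0.

Lemma symE n x (Fx : FM n x) : sym n x = gr_mod_pi (ReesMod (sym_subproof Fx)).
Proof. by rewrite /sym; case: pselect => // Fx'; congr gr_mod_pi; exact: val_inj. Qed.

Lemma sym_eqP n x y : FM n x -> FM n y -> sym n x = sym n y <-> FM (n - 1) (x - y).
Proof.
move=> Fx Fy; rewrite (symE Fx) (symE Fy); split.
  by move=> /gr_mod_piP/asboolP/(_ n) /=; rewrite !fctE /lmono eqxx.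
move=> H; apply/gr_mod_piP/asboolP => i; rewrite /= !fctE /lmono.
by case: eqP => [->//|_]; rewrite subr0; exact: mfilt0.
Qed.

Lemma sym0 n : sym n 0 = 0.
Proof.
have pi0 : gr_mod_pi (0 : rees_mod FM) = 0.
  by apply: (addrI (gr_mod_pi 0)); rewrite -gr_mod_piD !addr0.
rewrite (symE (mfilt0 FM n)) -[RHS]pi0; congr gr_mod_pi; apply: val_inj.
by apply/funext => i; rewrite /= /lmono; case: eqP.
Qed.

Lemma sym_eq0 n x : FM n x -> sym n x = 0 <-> FM (n - 1) x.
Proof. by move=> Fx; rewrite -(sym0 n) sym_eqP ?subr0//; exact: mfilt0. Qed.

Lemma symD n x y : FM n x -> FM n y -> sym n (x + y) = sym n x + sym n y.
Proof.
move=> Fx Fy; rewrite (symE Fx) (symE Fy) (symE (mfiltD Fx Fy)) -[RHS]gr_mod_piD.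
congr gr_mod_pi; apply: val_inj; apply/funext => i; rewrite /= !fctE /lmono.
by case: eqP => _; rewrite ?addr0.
Qed.

Lemma symZ i n a x : F i a -> FM n x ->
  (asym F i a : B) *: sym n x = sym (i + n) (a *: x).
Proof.
move=> Fa Fx; rewrite (symE Fx) (symE (mfiltZ Fa Fx)) (asymE Fa).
rewrite [LHS]gr_mod_scaleE; congr gr_mod_pi; apply: val_inj; apply/funext => j.
rewrite /= conv_mono /lmono subr_eq addrC.
by case: eqP => _; rewrite ?scaler0.
Qed.

Lemma gr_mod_piE (x : rees_mod FM) (r : seq int) : uniq r ->
  (forall n, n \notin r -> x n = 0) -> gr_mod_pi x = \sum_(n <- r) sym n (x n) :> E.
Proof.
move=> ur xr.
transitivity (gr_mod_pi (\sum_(n <- r) ReesMod (sym_subproof (rees_mod_filt x n)))).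
  congr gr_mod_pi; apply: val_inj; apply/funext => m.
  transitivity (\sum_(n <- r) lmono n (x n) m); last first.
    by elim/big_rec2: _ => [|i y z _ ->].
  rewrite /lmono; have [mr|mr] := boolP (m \in r).
    rewrite (bigD1_seq m)//= eqxx big1 ?addr0// => i /negbTE.
    by rewrite eq_sym => ->.
  rewrite [LHS]xr// big_seq big1// => i ir; case: eqP => // mi.
  by rewrite mi ir in mr.
have pi0 : gr_mod_pi (0 : rees_mod FM) = 0.
  by apply: (addrI (gr_mod_pi 0)); rewrite -gr_mod_piD !addr0.
rewrite (big_morph _ (@gr_mod_piD _ _ F _ FM) pi0).
by apply: eq_bigr => i _; rewrite (symE (rees_mod_filt x i)).
Qed.

(** The representative is an arbitrary choice, but its entry in degree [n] is determined modulo
    [FM (n - 1)]. *)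
Definition gcomp n (x : E) : E := sym n (gr_mod_repr x n).

Lemma gcomp_sym m n x : FM n x -> gcomp m (sym n x) = if m == n then sym n x else 0.
Proof.
move=> Fx; rewrite /gcomp.
have /asboolP/(_ m) := gr_mod_reprP (ReesMod (sym_subproof Fx)).
rewrite -(symE Fx) /= !fctE /lmono; case: eqP => [->|_ H].
  by move=> H; apply/sym_eqP => //; exact: rees_mod_filt.
by apply/sym_eq0; [exact: rees_mod_filt|rewrite subr0 in H].
Qed.

Lemma gcompD n x y : gcomp n (x + y) = gcomp n x + gcomp n y.
Proof.
rewrite /gcomp -symD; try exact: rees_mod_filt.
apply/sym_eqP; [exact: rees_mod_filt|by apply: mfiltD; exact: rees_mod_filt|].
have /gr_mod_piP/asboolP/(_ n) : gr_mod_pi (gr_mod_repr (x + y)) =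
    gr_mod_pi (gr_mod_repr (x : gr_mod FM) + gr_mod_repr (y : gr_mod FM)).
  by rewrite gr_mod_piD !gr_mod_reprK.
by rewrite /= !fctE.
Qed.

Lemma gcomp_dec x : exists r : seq int, [/\ uniq r,
  forall n, n \notin r -> gcomp n x = 0 & x = \sum_(n <- r) gcomp n x].
Proof.
have [r ur xr] := fin_supp_seq (rees_mod_supp (gr_mod_repr x)).
exists r; split=> // [n /xr xn|]; first by rewrite /gcomp xn sym0.
by rewrite -[LHS]gr_mod_reprK; exact: gr_mod_piE.
Qed.

End ModuleSymbol.

Section Gradings.
Variables (k : fieldType) (A : algType k) (F : filtration A).
Variables (grC : commutative (@GRing.mul (gr F))).
Hypothesis gr_connected : connected_graded F.
Hypothesis gr_affine : affine_algebra (gr F).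
Local Notation B := (com_gr grC).

Definition gr_homog (i : int) : set B := [set b | exists2 a, F i a & b = asym F i a].

Lemma gr_homog1 : gr_homog 0 1.
Proof. by exists 1; [exact: filt1|rewrite asym1]. Qed.

Lemma gr_homogM i j a b : gr_homog i a -> gr_homog j b -> gr_homog (i + j) (a * b).
Proof.
move=> [x Fx ->] [y Fy ->]; exists (x * y); first exact: filtM.
exact: asymM.
Qed.

Lemma gr_homogZ (c : k) i (a : B) : gr_homog i a -> gr_homog i (c *: a).
Proof. by move=> [x Fx ->]; exists (c *: x); [exact: filtZ|exact: asymZ]. Qed.

Lemma gr_homog_dec (b : B) : exists r : seq int, exists2 x : int -> B,
  forall i, gr_homog i (x i) & b = \sum_(i <- r) x i.
Proof.
have [r ur xr] := fin_supp_seq (rees_supp (gr_repr b)).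
exists r, (fun i => asym F i (gr_repr b i)).
  by move=> i; exists (gr_repr b i) => //; exact: rees_filt.
by rewrite -[LHS]gr_reprK; exact: gr_piE.
Qed.

(** The components of positive degree of the algebra generators suffice: by connectedness those of
    negative degree vanish and those of degree zero are scalars. *)
Lemma gr_homog_gens : exists (n : nat) (b : nat -> B) (d : nat -> nat),
  [/\ forall i, (i < n)%N -> (0 < d i)%N,
      forall i, (i < n)%N -> gr_homog (d i)%:Z (b i) &
      forall x, range (ev b n) x].
Proof.
have [s sP] := gr_affine.
have /choice[r rP] (b : B) : exists r : seq int, exists2 x : int -> B,
  forall i, gr_homog i (x i) & b = \sum_(i <- r) x i by exact: gr_homog_dec.
have /choice[x xP] (b : B) : exists x : int -> B,
  (forall i, gr_homog i (x i)) /\ b = \sum_(i <- r b) x i.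
  by have [x] := rP b; exists x.
pose L : seq (nat * B) := flatten [seq [seq (`|i|%N, x b i) | i <- r b & 0 < i] | b <- s].
pose y i := (nth (0%N, 0) L i).2.
have LP i : (i < size L)%N -> exists b j, [/\ b \in s, j \in r b, 0 < j &
    nth (0%N, 0) L i = (`|j|%N, x b j)].
  move=> /(mem_nth (0%N, 0)) /flattenP[_ /mapP[b bs ->]] /mapP[j].
  by rewrite mem_filter => /andP[j0 jr] ->; exists b, j.
exists (size L), y, (fun i => (nth (0%N, 0) L i).1); split.
- move=> i /LP[b [j [_ _ j0 ->]]] /=; lia.
- move=> i /LP[b [j [_ _ j0 jE]]]; rewrite /y jE /=.
  by rewrite gtz0_abs//; case: (xP b).
move=> z; have : [set: gr F] z by [].
rewrite -sP; apply.
split; last first.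
  move=> b bs; rewrite (xP b).2 big_seq.
  elim/big_ind: _ => [|_ _ [p _ <-] [q _ <-]|j jr].
  - by exists 0; rewrite ?rmorph0.
  - by exists (p + q); rewrite ?rmorphD.
  have [a Fa aE] := (xP b).1 j.
  have [j0|j0|j0] := ltgtP j 0.
  - exists 0 => //; rewrite rmorph0 aE; have [+ _ _] := gr_connected.
    move=> /(_ j j0) => H; have : gr_comp (F := F) j (asym F j a) by exact: asym_comp.
    by rewrite H => ->.
  - have jL : (`|j|%N, x b j) \in L.
      apply/flattenP; exists [seq (`|i|%N, x b i) | i <- r b & 0 < i].
        exact: map_f.
      by apply/mapP; exists j; rewrite // mem_filter j0.
    have iL : (index (`|j|%N, x b j) L < size L)%N by rewrite index_mem.
    have [p pE] := ev_var B iL.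
    by exists p => //; rewrite pE /y nth_index.
  - have : gr_comp (F := F) 0 (asym F j a) by rewrite -j0; exact: asym_comp.
    have [_ -> _] := gr_connected; move=> [c _ cE].
    have [p pE] := ev_cst B (size L) c.
    by exists p => //; rewrite pE aE -cE.
split.
- by rewrite inE; exists 1; rewrite ?rmorph1.
- move=> c u v; rewrite !inE => -[p _ <-] [q _ <-].
  have [e eE] := ev_cst B (size L) c.
  exists (e * p + q) => //; rewrite rmorphD rmorphM eE; congr (_ + _).
  exact: mulr_algl.
- by move=> u v; rewrite !inE => -[p _ <-] [q _ <-]; exists (p * q); rewrite ?rmorphM.
Qed.

Lemma gr_ring_grading : exists h : ring_grading B, hm h = gr_homog.
Proof.
have [n [b [d [d0 bh bs]]]] := gr_homog_gens.
by exists (RingGrading gr_homog1 gr_homogM gr_homogZ d0 bh bs).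
Qed.

End Gradings.

(** From some [s0] on, the rank has its least value [n]. An independent family of [n] vectors in a
    later [U s] cannot be extended by a vector of [U s0]. *)
Lemma rank_stab (R : idomainType) (B : nzRingType) (f : {rmorphism R -> B})
    (G : lmodType B) (U : nat -> set G) (I : finType) (e : I -> G) :
  (forall s, rsub f (U s)) -> (forall s t, (s <= t)%N -> U t `<=` U s) ->
  U 0%N `<=` rspan f e ->
  exists s0, forall s, (s0 <= s)%N -> forall x, U s0 x ->
    exists2 b, b != 0 & U s (f b *: x).
Proof.
move=> US Ud Ue.
pose bd n s := forall (J : finType) (v : J -> G), rindep f v -> (forall j, U s (v j)) ->
  (#|J| <= n)%N.
have ex : exists n, `[< exists s, bd n s >].
  exists #|I|; apply/asboolP; exists 0%N => J v vI vU.
  by apply: steinitz vI _ => j; exact/Ue/vU.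
have [n /asboolP[s0 ns] nmin] := ex_minnP ex.
exists s0 => s s0s x Ux.
have [J [v [vI vU nJ]]] : exists (J : finType) (v : J -> G),
    [/\ rindep f v, forall j, U s (v j) & (n <= #|J|)%N].
  case: n ns nmin => [|n] ns nmin.
    by exists void, (fun=> 0); split=> [c _ []|[]|].
  apply: contrapT => H; suff /nmin : `[< exists s, bd n s >] by rewrite ltnn.
  apply/asboolP; exists s => J v vI vU; rewrite leqNgt; apply/negP => nJ.
  by apply: H; exists J, v.
apply: contrapT => H.
pose v' (o : option J) := if o is Some i then v i else x.
have v'I : rindep f v'.
  apply: rindep_option => // -[b b0 bx]; apply: H; exists b => //.
  by move: bx; apply: rspan_min.
suff /(ns _ _ v'I) : forall o, U s0 (v' o) by rewrite card_option ltnNge nJ.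
by move=> [j|//]; apply: Ud (vU j).
Qed.

Section Nilpotent.
Variables (B : comNzRingType) (G : lmodType B).
Implicit Types (x : G) (b c : B).

Definition nil_on x b := exists l, b ^+ l *: x = 0.

Lemma nil_onW x b l l' : (l <= l')%N -> b ^+ l *: x = 0 -> b ^+ l' *: x = 0.
Proof. by move=> /subnK <- bx; rewrite exprD -scalerA bx scaler0. Qed.

Lemma nil_onD x b c : nil_on x b -> nil_on x c -> nil_on x (b + c).
Proof.
move=> [l bx] [l' cx]; exists (l + l')%N; rewrite exprDn scaler_suml big1// => i _.
rewrite -mulr_natl -scalerA; apply/eqP; rewrite -[X in _ == X](scaler0 _ ('C(l + l', i)%:R : B)).
apply/eqP; congr (_ *: _); have [li|il] := leqP l' i.
  by rewrite -scalerA (nil_onW li cx) scaler0.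
by rewrite mulrC -scalerA (nil_onW _ bx) ?scaler0//; lia.
Qed.

Lemma nil_onN x b : nil_on x b -> nil_on x (- b).
Proof. by move=> [l bx]; exists l; rewrite exprNn -scalerA bx scaler0. Qed.

Lemma nil_on0 x : nil_on x 0.
Proof. by exists 1%N; rewrite expr1 scale0r. Qed.

Lemma nil_on_sum x (I : Type) (r : seq I) (b : I -> B) :
  (forall i, nil_on x (b i)) -> nil_on x (\sum_(i <- r) b i).
Proof. by move=> H; elim/big_ind: _ => //; [exact: nil_on0|exact: nil_onD]. Qed.

(** For one index after the other, the last power of [b i] that does not kill the vector is applied.
    As [c] is a product of the [b i], [c *: x] is again a symbol when the [b i] and [x] are
    symbols. *)
Lemma nil_on_kill x (I : eqType) (r : seq I) (b : I -> B) : x != 0 ->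
  (forall i, i \in r -> nil_on x (b i)) ->
  exists c, c *: x != 0 /\ (exists s : seq I, c = \prod_(i <- s) b i) /\
    forall i, i \in r -> b i *: (c *: x) = 0.
Proof.
move=> x0; elim: r => [|i r IH] rx.
  by exists 1; rewrite scale1r; split=> //; split=> //; exists [::]; rewrite big_nil.
have [|c [cx [[s cE] rc]]] := IH; first by move=> j jr; apply: rx; rewrite inE jr orbT.
have [l lP lmin] : exists2 l, b i ^+ l.+1 *: (c *: x) = 0 & b i ^+ l *: (c *: x) != 0.
  have [l] := rx i (mem_head _ _); elim: l => [|l IHl] lx.
    by move: lx; rewrite expr0 scale1r => /eqP; rewrite (negbTE x0).
  have [lx'|] := eqVneq (b i ^+ l *: (c *: x)) 0; last first.
    by exists l => //; rewrite scalerA mulrC -scalerA lx scaler0.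
  elim: l lx' {lx IHl} => [|l IHl].
    by rewrite expr0 scale1r => /eqP; rewrite (negbTE cx).
  by have [/IHl//|] := eqVneq (b i ^+ l *: (c *: x)) 0; exists l.
exists (b i ^+ l * c); rewrite -scalerA; split=> //; split.
  by exists (nseq l i ++ s); rewrite big_cat -cE big_nseq -Monoid.iteropE.
move=> j; rewrite inE => /predU1P[->|/rc jc].
  by rewrite scalerA -exprS.
by rewrite scalerA mulrC -scalerA jc scaler0.
Qed.

End Nilpotent.

Section GradedNilpotent.
Variables (k : fieldType) (B : comAlgType k) (h : ring_grading B).
Variables (G : lmodType B) (g : mod_grading h G).

(** On a homogeneous [x], the top component of a power of the sum comes from the power of its top
    term, which is therefore nilpotent; it is subtracted and the rest follows by induction. *)
Lemma homog_nil (r : seq int) (b : int -> B) j x : uniq r ->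
  (forall q, h q (b q)) -> hcomp g j x = x ->
  nil_on x (\sum_(q <- r) b q) -> forall q, q \in r -> nil_on x (b q).
Proof.
move=> + bh jx; have [n rn] : exists n, (size r <= n)%N by exists (size r).
elim: n r rn => [|n IH] r rn ur rx q qr.
  by move: rn qr; rewrite leqn0 => /nilP ->.
have [t tr tmax] : exists2 t, t \in r & forall j, j \in r -> j <= t.
  by apply: seq_int_max; apply/eqP => r0; rewrite r0 in qr.
have [l lx] := rx.
have top m : (forall i, (m%:Z * t + j < i) -> hcomp g i ((\sum_(q <- r) b q) ^+ m *: x) = 0) /\
    hcomp g (m%:Z * t + j) ((\sum_(q <- r) b q) ^+ m *: x) = b t ^+ m *: x.
  elim: m => [|m [IH1 IH2]].
    rewrite expr0 !scale1r mul0r add0r jx; split=> // i ji.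
    by rewrite -jx hcomp_comp (gt_eqF ji).
  have E i : hcomp g i ((\sum_(q <- r) b q) ^+ m.+1 *: x) =
      \sum_(q <- r) b q *: hcomp g (i - q) ((\sum_(q <- r) b q) ^+ m *: x).
    rewrite exprS -scalerA scaler_suml hcomp_sum; apply: eq_bigr => p _.
    by rewrite -(hcompM _ _ _ (bh p)) [p + _]addrC subrK.
  split=> [i im|].
    rewrite E big_seq big1// => p /tmax pt; rewrite IH1 ?scaler0//.
    by move: im; rewrite intS mulrDl mul1r; lia.
  rewrite E (bigD1_seq t)//= [X in hcomp g X](_ : _ = m%:Z * t + j); last first.
    by rewrite intS; ring.
  rewrite IH2 scalerA -exprS big_seq_cond big1 ?addr0// => p /andP[/tmax pt pt'].
  rewrite IH1 ?scaler0// intS mulrDl mul1r.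
  have : p < t by rewrite lt_neqAle pt'.
  lia.
have tx : nil_on x (b t) by exists l; rewrite -(top l).2 lx hcomp0.
have [->//|qt] := eqVneq q t.
apply: (IH (rem t r)).
- by rewrite size_rem// -ltnS prednK// lt0n size_eq0; apply/eqP => r0; rewrite r0 in qr.
- exact: rem_uniq.
- rewrite (_ : \sum_(q <- _) _ = \sum_(q <- r) b q - b t).
    by apply: nil_onD => //; exact: nil_onN.
  by rewrite (perm_big _ (perm_to_rem tr)) big_cons/= [b t + _]addrC addrK.
- by rewrite mem_rem_uniq// inE qt.
Qed.

End GradedNilpotent.

(** A nonzero constant [b] does not change the size of the remainder [r] of [p], while [b%:P * r] is
    a multiple of the monic [a], hence zero or at least as long as [a]. *)
Lemma monic_dvd (R : idomainType) (a p q : {poly R}) (b : R) : a \is monic -> b != 0 -> b%:P * p = a * q ->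
  exists t, p = a * t.
Proof.
move=> am b0 bp; exists (Pdiv.Ring.rdivp p a); rewrite mulrC.
have pE := Pdiv.RingMonic.rdivp_eq am p.
set r := Pdiv.Ring.rmodp p a in pE; set d := Pdiv.Ring.rdivp p a in pE *.
suff r0 : r = 0 by rewrite {1}pE r0 addr0.
have sr : (size r < size a)%N by rewrite Pdiv.Ring.ltn_rmodp monic_neq0.
have E : b%:P * r = a * (q - b%:P * d).
  by rewrite mulrBr -bp {1}pE; ring.
apply/eqP/negPn/negP => r0; move: sr; apply/negP; rewrite -leqNgt.
have e0 : q - b%:P * d != 0.
  apply/eqP => e0; move: E; rewrite e0 mulr0 => /eqP.
  by rewrite mulf_eq0 polyC_eq0 (negbTE b0) (negbTE r0).
have : size (b%:P * r) = size r by rewrite mul_polyC size_scale.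
rewrite E size_monicM// => <-.
by rewrite -subn1 -addnBA ?leq_addr// size_poly_gt0.
Qed.


(** Let [p] and [q] be the coordinates of [a x] and [b x] on [v]. Independence gives
    [b * p j = a * q j], so [a] divides each [p j], and torsion freeness cancels [a]. *)
Lemma lattice_div (k : fieldType) (B : comAlgType k) (G : lmodType B) (z : nat -> B)
    (m : nat) (a : {poly polyring k m}) (b : polyring k m) (J : finType) (v : J -> G) :
  a \is monic -> b != 0 -> rindep (ev z m.+1) v ->
  (forall x : G, tors z m.+1 x -> x = 0) -> forall x,
  rspan (ev z m.+1) v (ev z m.+1 a *: x) -> rspan (ev z m.+1) v (ev z m b *: x) ->
  rspan (ev z m.+1) v x.
Proof.
move=> am b0 vI tf x; rewrite -(evC z b).
pose S := polyring k m.+1; pose A : S := a; pose C : S := b%:P.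
have A0 : A != 0 by exact: monic_neq0.
have dvd (p q : S) : C * p = A * q -> exists t, p = A * t by exact: monic_dvd.
rewrite -[a]/A -[b%:P]/C; move: A C A0 dvd => A C A0 dvd [p pE] [q qE].
have /choice[t tP] : forall j, exists t, p j = A * t.
  move=> j; apply: (dvd _ (q j)); apply/subr0_eq.
  apply: (vI (fun j => C * p j - A * q j)).
  under eq_bigr do rewrite rmorphB !rmorphM scalerBl -!scalerA.
  by rewrite sumrB -!scaler_sumr -pE -qE !scalerA [X in X *: _ - _]mulrC subrr.
exists t; apply/eqP; rewrite -subr_eq0; apply/eqP/tf; exists A => //.
rewrite scalerBr pE scaler_sumr -sumrB big1// => j _.
by rewrite tP rmorphM -scalerA subrr.
Qed.

Section GrModGrading.
Variables (k : fieldType) (A : algType k) (F : filtration A).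
Variables (grC : commutative (@GRing.mul (gr F))).
Variables (h : ring_grading (com_gr grC)) (hE : hm h = gr_homog (grC := grC)).
Variables (M : lmodType A) (FM : mod_filtration F M).
Local Notation E := (cgr_mod grC FM).

Fact gcomp_gcomp m n (x : E) : gcomp m (gcomp n x) = if m == n then gcomp n x else 0.
Proof. exact: (gcomp_sym grC m (rees_mod_filt (gr_mod_repr x) n)). Qed.

Lemma gcomp0 n : gcomp n (0 : E) = 0.
Proof. by apply: (addrI (gcomp n 0)); rewrite -gcompD !addr0. Qed.

Lemma gcomp_sum n (J : Type) (r : seq J) (P : pred J) (f : J -> E) :
  gcomp n (\sum_(j <- r | P j) f j) = \sum_(j <- r | P j) gcomp n (f j).
Proof. exact: (big_morph _ (@gcompD _ _ _ _ _ _ n) (gcomp0 n)). Qed.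

Fact gcompM i n b (x : E) : h i b -> gcomp (i + n) (b *: x) = b *: gcomp n x.
Proof.
rewrite hE => -[a Fa ->]; have [r [ur xr xE]] := gcomp_dec x.
rewrite {1}xE scaler_sumr gcomp_sum.
have rf m : FM m (gr_mod_repr x m) by exact: rees_mod_filt.
transitivity (\sum_(m <- r) if m == n then (asym F i a : com_gr grC) *: gcomp n x else 0).
  apply: eq_bigr => m _; rewrite [gcomp m x](_ : _ = sym grC FM m (gr_mod_repr x m))//.
  rewrite symZ// gcomp_sym; last exact: mfiltZ.
  rewrite (inj_eq (addrI i)) eq_sym; case: eqP => [->|//]; by rewrite symZ.
have [nr|nr] := boolP (n \in r).
  rewrite (bigD1_seq n)//= eqxx big1 ?addr0// => m /negbTE.
  by move=> ->.
rewrite xr// scaler0 big1// => m _; by case: eqP.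
Qed.

Definition gr_mod_grading : mod_grading h E :=
  ModGrading (@gcompD _ _ _ _ _ _) gcomp_gcomp (@gcomp_dec _ _ _ _ _ _) gcompM.

Lemma gcompE n (x : E) : exists2 u, FM n u & gcomp n x = sym grC FM n u.
Proof. by exists (gr_mod_repr x n) => //; exact: rees_mod_filt. Qed.

Lemma gcomp_inj (x y : E) : (forall n, gcomp n x = gcomp n y) -> x = y.
Proof.
move=> xy; apply/eqP; rewrite -subr_eq0; apply/eqP.
apply: (hcomp_eq0 (g := gr_mod_grading)) => n /=.
rewrite gcompD xy; have /= -> := hcompN gr_mod_grading n y; exact: subrr.
Qed.

Lemma gcomp_hM i n a (x : E) : F i a ->
  gcomp n ((asym F i a : com_gr grC) *: x) = (asym F i a : com_gr grC) *: gcomp (n - i) x.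
Proof.
move=> Fa; have ha : h i (asym F i a : com_gr grC) by rewrite hE; exists a.
by rewrite -(gcompM _ _ ha) [i + _]addrC subrK.
Qed.

(* The elements of [gr FM] whose components of degree [n] are symbols of elements
   of [FN (n + s)], for a second filtration [FN]. *)
Definition sym_in (FN : int -> set M) (s : int) : set E :=
  [set x | forall n, exists u, [/\ FM n u, FN (n + s) u & gcomp n x = sym grC FM n u]].

Lemma sym_in_gsub FN s : (forall n, FN n 0) -> gsub gr_mod_grading (sym_in FN s).
Proof.
move=> N0 m x xs n /=; rewrite gcomp_gcomp; case: eqP => [->|_]; first exact: xs.
by exists 0; split; [exact: mfilt0|exact: N0|rewrite sym0].
Qed.

Lemma sym_in_bsub (FN : int -> set M) s :
  (forall n, FN n 0) -> (forall n u v, FN n u -> FN n v -> FN n (u + v)) ->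
  (forall i n a u, F i a -> FN n u -> FN (i + n) (a *: u)) ->
  bsub (sym_in FN s).
Proof.
move=> N0 ND NM.
have H0 : sym_in FN s 0.
  by move=> n; exists 0; split; [exact: mfilt0|exact: N0|rewrite gcomp0 sym0].
have HD x y : sym_in FN s x -> sym_in FN s y -> sym_in FN s (x + y).
  move=> xs ys n; have [u [Fu Nu uE]] := xs n; have [v [Fv Nv vE]] := ys n.
  exists (u + v); split; [exact: mfiltD|exact: ND|by rewrite gcompD uE vE symD].
split=> // b x xs.
have [r [c ch ->]] := gr_homog_dec b; rewrite scaler_suml.
elim/big_ind: _ => // i _ n; have [a Fa ->] := ch i.
rewrite gcomp_hM//; move: (xs (n - i)); have : n = i + (n - i) by rewrite addrC subrK.
move: (n - i) => m -> [u [Fu Nu ->]].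
exists (a *: u); split; [exact: mfiltZ| |exact: symZ].
by rewrite -addrA; exact: NM.
Qed.

Lemma sym_inP FN s n u : (forall n, FN n 0) -> FM n u -> FN (n + s) u ->
  sym_in FN s (sym grC FM n u).
Proof.
move=> N0 Fu Nu m; rewrite gcomp_sym//; case: eqP => [->|_]; first by exists u.
by exists 0; split; [exact: mfilt0|exact: N0|rewrite sym0].
Qed.

End GrModGrading.

(** * The saturated filtration *)

Section Saturation.
Variables (k : fieldType) (A : algType k) (F : filtration A).
Variables (grC : commutative (@GRing.mul (gr F))).
Variables (M : lmodType A) (FM : mod_filtration F M).

Lemma asym_eq n a b : F n a -> F n b -> asym F n a = asym F n b -> F (n - 1) (a - b).
Proof.
move=> Fa Fb; rewrite (asymE Fa) (asymE Fb) => /gr_piP/asboolP/(_ n) /=.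
by rewrite !fctE /lmono eqxx.
Qed.

Lemma filt_comm i m a b : F i a -> F m b -> F (i + m - 1) (a * b - b * a).
Proof.
move=> Fa Fb; apply: asym_eq; first exact: filtM.
  by rewrite addrC; exact: filtM.
by rewrite -asymM// grC asymM// addrC.
Qed.

Lemma mfilt_ex j u : exists p : nat, FM (j + p%:Z) u.
Proof.
have [n _ nu] : (\bigcup_(n in [set: int]) FM n) u by rewrite mfilt_bigcup.
by exists `|n - j|%N; apply: (mfilt_le _ nu); lia.
Qed.

Lemma filt_ex a : exists m, F m a.
Proof.
have [n _ nu] : (\bigcup_(n in [set: int]) F n) a by rewrite filt_bigcup.
by exists n.
Qed.

(* The filtration induced on [M] by the localization at powers of [a], where
   [a] has degree [i]. *)
Definition loc_filt i (a : A) (j : int) : set M :=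
  [set u | exists l : nat, FM (i *+ l + j) (a ^+ l *: u)].

Section Local.
Variables (i : int) (a : A).
Hypothesis Fa : F i a.

Lemma loc_filtW l l' j u : (l <= l')%N -> FM (i *+ l + j) (a ^+ l *: u) ->
  FM (i *+ l' + j) (a ^+ l' *: u).
Proof.
move=> /subnK <- lu; rewrite exprD -scalerA mulrnDr -addrA.
by apply: mfiltZ => //; exact: filtX.
Qed.

Lemma sub_loc_filt j u : FM j u -> loc_filt i a j u.
Proof. by move=> Fu; exists 0%N; rewrite mulr0n add0r expr0 scale1r. Qed.

Lemma loc_filt_le j j' : j <= j' -> loc_filt i a j `<=` loc_filt i a j'.
Proof. by move=> jj u [l lu]; exists l; apply: (mfilt_le _ lu); rewrite lerD2l. Qed.

Lemma loc_filtD j u v : loc_filt i a j u -> loc_filt i a j v -> loc_filt i a j (u + v).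
Proof.
move=> [l lu] [l' lv]; exists (maxn l l'); rewrite scalerDr; apply: mfiltD.
  exact: loc_filtW (leq_maxl _ _) lu.
exact: loc_filtW (leq_maxr _ _) lv.
Qed.

(* Commutators with [a] drop the degree by one, whence an induction on the
   distance of [u] to [FM j]. *)
Lemma loc_filtZ m b j u : F m b -> loc_filt i a j u -> loc_filt i a (m + j) (b *: u).
Proof.
move=> Fb; have [p] := mfilt_ex j u; elim: p => [|p IH] in m b j Fb *.
  by rewrite addr0 => Fu _; apply: sub_loc_filt; exact: mfiltZ.
move=> Fu [l lu].
(* The commutator loses one degree and [j + 1] gains it back, so the total degree is unchanged,
   while [u] is only [p] steps away from [FM (j + 1)]. *)
have [] := IH (i *+ l + m - 1) (a ^+ l * b - b * a ^+ l) (j + 1).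
- by apply: filt_comm => //; exact: filtX.
- by rewrite -addrA -intS.
- by exists l; apply: (mfilt_le _ lu); rewrite lerD2l lerDl.
move=> l' l'u; exists (l' + l)%N.
have -> : a ^+ (l' + l) *: (b *: u) = a ^+ l' *: (b *: (a ^+ l *: u)) +
    a ^+ l' *: ((a ^+ l * b - b * a ^+ l) *: u).
  by rewrite -scalerDr !scalerA -scalerDl addrC subrK exprD !scalerA mulrA.
rewrite mulrnDr; apply: mfiltD.
  rewrite -addrA; apply: mfiltZ; first exact: filtX.
  by rewrite addrCA; exact: mfiltZ.
by apply: (mfilt_le _ l'u); lia.
Qed.

Lemma loc_filt_div j u : loc_filt i a (i + j) (a *: u) -> loc_filt i a j u.
Proof.
by move=> [l lu]; exists l.+1; rewrite exprSr -scalerA mulrSr -addrA.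
Qed.

End Local.

Variable rho : rees F.

(** [rho] lifts [f], and [rho q] its component of degree [q]. Where [rho q = 0] the condition is
    void, with [l = 1]. *)
Definition sat_filt (j : int) : set M := [set u | forall q, loc_filt q (rho q) j u].

Let Fr q : F q (rho q). Proof. exact: rees_filt. Qed.

Lemma sub_sat_filt j : FM j `<=` sat_filt j.
Proof. by move=> u Fu q; exact: sub_loc_filt. Qed.

Lemma sat_filt_le j j' : j <= j' -> sat_filt j `<=` sat_filt j'.
Proof. by move=> jj u su q; exact: loc_filt_le (su q). Qed.

Lemma sat_filt0 j : sat_filt j 0.
Proof. by apply: sub_sat_filt; exact: mfilt0. Qed.

Lemma sat_filtD j u v : sat_filt j u -> sat_filt j v -> sat_filt j (u + v).
Proof. by move=> su sv q; exact: loc_filtD. Qed.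

Lemma sat_filtZ m j b u : F m b -> sat_filt j u -> sat_filt (m + j) (b *: u).
Proof. by move=> Fb su q; exact: loc_filtZ. Qed.

Lemma sat_filt_div j u : (forall q, sat_filt (q + j) (rho q *: u)) -> sat_filt j u.
Proof. by move=> H q; apply: loc_filt_div => //; exact: (H q q). Qed.

Lemma sat_filt_sc j (c : k) u : sat_filt j u -> sat_filt j (c%:A *: u).
Proof. by move=> su; rewrite -[j]add0r; apply: sat_filtZ => //; apply: filtZ; exact: filt1. Qed.

Fact sat_filt_submod j : submod_closed (mem (sat_filt j : set (restrict_scalars M))).
Proof.
split; first by rewrite inE; exact: sat_filt0.
by move=> c u v; rewrite !inE => su sv; apply: sat_filtD => //; exact: sat_filt_sc.
Qed.

Fact sat_filt_bigcup : \bigcup_(n in [set: int]) sat_filt n = [set: M].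
Proof.
apply/seteqP; split=> // u _; have [p pu] := mfilt_ex 0 u.
by exists (0 + p%:Z) => //; exact: sub_sat_filt.
Qed.

Hypothesis sat_sep : forall u, (forall j, sat_filt j u) -> u = 0.

Fact sat_filt_bigcap : \bigcap_(n in [set: int]) sat_filt n = [set 0].
Proof.
apply/seteqP; split=> [u su|_ -> n _]; last exact: sat_filt0.
by apply: sat_sep => j; exact: su.
Qed.

Definition saturation : mod_filtration F M :=
  ModFiltration sat_filt_submod sat_filt_le sat_filtZ sat_filt_bigcap sat_filt_bigcup.

End Saturation.

Section SymbolProducts.
Variables (k : fieldType) (A : algType k) (F : filtration A).
Variables (grC : commutative (@GRing.mul (gr F))).
Variables (h : ring_grading (com_gr grC)) (hE : hm h = gr_homog (grC := grC)).
Variables (M : lmodType A) (FM : mod_filtration F M).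
Local Notation E := (cgr_mod grC FM).
Implicit Types (x : E) (u : M) (b : rees F).

Definition cgr_pi b : com_gr grC := gr_pi b.

Lemma gcomp_piM b : exists r : seq int, [/\ uniq r, forall q, q \notin r -> b q = 0 &
  forall x n, gcomp n (cgr_pi b *: x) =
    \sum_(q <- r) (asym F q (b q) : com_gr grC) *: gcomp (n - q) x].
Proof.
have [r ur br] := fin_supp_seq (rees_supp b); exists r; split=> // x n.
rewrite /cgr_pi (gr_piE ur br) scaler_suml gcomp_sum; apply: eq_bigr => q _.
by rewrite (gcomp_hM hE)//; exact: rees_filt.
Qed.

Lemma gcomp_pi_sym b q j u : FM j u ->
  gcomp (q + j) (cgr_pi b *: (sym grC FM j u)) = sym grC FM (q + j) (b q *: u).
Proof.
move=> Fu; have [r [ur br ->]] := gcomp_piM b.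
have [qr|qr] := boolP (q \in r); last first.
  rewrite br// scale0r sym0 big_seq big1// => p pr.
  rewrite gcomp_sym//; case: eqP => pq; last by rewrite scaler0.
  by move: qr; have -> : q = p; [lia|rewrite pr].
rewrite (bigD1_seq q)//= big1 ?addr0 => [|p pq].
  rewrite gcomp_sym// [q + j]addrC addrK eqxx symZ//; last exact: rees_filt.
  by rewrite addrC.
rewrite gcomp_sym//; case: eqP => // pq'; last by rewrite scaler0.
by move: pq; have -> : p = q; [lia|rewrite eqxx].
Qed.

End SymbolProducts.

(** * Comparison of the two associated graded modules *)

Section Saturated.
Variables (k : fieldType) (A : algType k) (F : filtration A).
Variables (grC : commutative (@GRing.mul (gr F))).
Variables (h : ring_grading (com_gr grC)) (hE : hm h = gr_homog (grC := grC)).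
Variables (M : lmodType A) (FM : mod_filtration F M) (rho : rees F).
Variables (m : nat) (z : nat -> com_gr grC) (a : {poly polyring k m}).
Local Notation f := (cgr_pi grC rho).
Local Notation E := (cgr_mod grC FM).
Local Notation sf := (sat_filt FM rho).
Local Notation symE := (sym grC FM).
Local Notation trs := (tors z m.+1).
Hypothesis fE : f = ev z m.+1 a.
Hypothesis am : a \is monic.
Hypothesis Efg : fgen (ev z m.+1) [set: E].
Hypothesis fT : forall x : E, trs x -> f *: x = 0.

(** The symbol is homogeneous, so it is killed by every component of [f] along with [f]. *)
Lemma sym_tors_shift j u q : FM j u -> trs (symE j u) -> FM (q + j - 1) (rho q *: u).
Proof.
move=> Fu /fT fu; apply/(sym_eq0 grC).
  by apply: mfiltZ => //; exact: rees_filt.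
by rewrite -(gcomp_pi_sym hE)// fu gcomp0.
Qed.

Lemma sat_of_tors j u : FM j u -> trs (symE j u) -> sf (j - 1) u.
Proof.
move=> Fu tu; apply: (sat_filt_div) => q; apply: sub_sat_filt.
by rewrite addrA; exact: sym_tors_shift.
Qed.

(** Each component of [f] acts nilpotently on the symbol, hence so does [f]. With [sat_of_tors],
    this identifies the torsion [T] with [deep 1]. *)
Lemma tors_of_sat j u : FM j u -> sf (j - 1) u -> trs (symE j u).
Proof.
move=> Fu su.
have [l fl] : nil_on (symE j u) f.
  have [r ur br] := fin_supp_seq (rees_supp rho).
  rewrite /cgr_pi (gr_piE ur br); apply: nil_on_sum => q.
  have [l lu] := su q; exists l.
  have Fr : F q (rho q) by exact: rees_filt.
  have -> : (asym F q (rho q) : com_gr grC) ^+ l = asym F (q *+ l) (rho q ^+ l).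
    elim: l {lu} => [|l IH]; first by rewrite expr0 mulr0n asym1.
    by rewrite exprS IH [LHS]asymM ?mulrS ?exprS//; exact: filtX.
  rewrite symZ//; last exact: filtX.
  apply/sym_eq0; first by apply: mfiltZ => //; exact: filtX.
  by rewrite -addrA.
exists (a ^+ l); first by rewrite expf_neq0// monic_neq0.
by rewrite rmorphXn -fE.
Qed.

Section Limit.
Hypothesis sep : forall u, (forall j, sf j u) -> u = 0.
Local Notation FI := (saturation grC sep).
Local Notation H := (cgr_mod grC FI).
Local Notation symH := (sym grC FI).
Implicit Types (x : E) (y : H) (u v : M).

(* [deep s] and [shallow s] are the submodules [T_s] of [gr FM] and [G_s] of [gr FI]. *)
Definition deep (s : nat) : set E := sym_in (FM := FM) sf (- s%:Z).
Definition shallow (s : nat) : set H := sym_in (FM := FI) FM s%:Z.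

Lemma deep_bsub s : bsub (deep s).
Proof.
apply: (sym_in_bsub hE); [exact: sat_filt0|exact: sat_filtD|].
by move=> *; exact: sat_filtZ.
Qed.

Lemma shallow_bsub s : bsub (shallow s).
Proof.
apply: (sym_in_bsub hE); [exact: mfilt0|exact: mfiltD|].
by move=> *; exact: mfiltZ.
Qed.

Lemma shallow_gsub s : gsub (gr_mod_grading hE FI) (shallow s).
Proof. by apply: sym_in_gsub; exact: mfilt0. Qed.

Lemma deep_le s t : (s <= t)%N -> deep t `<=` deep s.
Proof.
move=> st x xt n; have [u [Fu su uE]] := xt n; exists u; split=> //.
by apply: sat_filt_le su; lia.
Qed.

Lemma shallow_le s t : (s <= t)%N -> shallow s `<=` shallow t.
Proof.
move=> st x xt n; have [u [Fu su uE]] := xt n; exists u; split=> //.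
by apply: mfilt_le su; lia.
Qed.

Lemma shallow_ex y : exists s, shallow s y.
Proof.
have [r [ur xr xE]] := gcomp_dec y.
have /choice[u uP] n : exists u, FI n u /\ gcomp n y = symH n u.
  by have [u] := gcompE n y; exists u.
have /choice[p pP] n := mfilt_ex FM n (u n).
exists (\sum_(n <- r) p n)%N => n.
have [nr|nr] := boolP (n \in r); last first.
  by exists 0; rewrite xr// sym0; split=> //; exact: mfilt0.
exists (u n); have [? ?] := uP n; split=> //.
by apply: mfilt_le (pP n); rewrite lerD2l (bigD1_seq n)//=; lia.
Qed.

Lemma deep_tors s : deep s.+1 `<=` trs.
Proof.
move=> x /(deep_le (ltn0Sn s)) xs.
have [r [ur xr ->]] := gcomp_dec x.
elim/big_ind: _ => [||n _]; [exact: tors0|by move=> *; exact: torsD|].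
by have [u [Fu su ->]] := xs n; exact: tors_of_sat.
Qed.

Lemma deep_ftors s x : deep s.+1 x -> f *: x = 0.
Proof. by move=> /deep_tors/fT. Qed.

(* [x] in [deep s] and [y] in [shallow s] have common lifts; modulo [deep s.+1] and
   [shallow s.-1] this is the isomorphism between the subquotients of the two
   filtrations. *)
Definition same_lift (s : nat) x y := forall n, exists u,
  [/\ FM (n + s%:Z) u, FI n u, gcomp (n + s%:Z) x = symE (n + s%:Z) u & gcomp n y = symH n u].

Lemma liftD s x x' y y' : same_lift s x y -> same_lift s x' y' -> same_lift s (x + x') (y + y').
Proof.
move=> r r' n; have [u [Fu Iu xu yu]] := r n; have [v [Fv Iv xv yv]] := r' n.
exists (u + v); split; [exact: mfiltD|exact: mfiltD| |].
  by rewrite gcompD xu xv symD.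
by rewrite gcompD yu yv symD.
Qed.

Lemma lift0 s : same_lift s 0 0.
Proof.
move=> n; exists 0.
by rewrite !gcomp0 !sym0; split=> //; exact: mfilt0.
Qed.

Lemma liftZ s b x y : same_lift s x y -> same_lift s (b *: x) (b *: y).
Proof.
move=> xy; have [r [c ch ->]] := gr_homog_dec b; rewrite !scaler_suml.
elim/big_rec2: _ => [|q x' y' _ xy']; first exact: lift0.
apply: liftD => // n; have [d Fd ->] := ch q; rewrite !(gcomp_hM hE)//.
move: (xy (n - q)); have : n = q + (n - q) by rewrite addrC subrK.
move: (n - q) => n' -> [u [Fu Iu xu yu]].
exists (d *: u); rewrite -addrA [q + (n' + s) - q]addrC addKr xu yu.
split; [exact: mfiltZ|exact: mfiltZ|exact: symZ|exact: symZ].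
Qed.

Lemma liftB s x x' y y' : same_lift s x y -> same_lift s x' y' -> same_lift s (x - x') (y - y').
Proof.
by move=> r r'; apply: liftD => //; rewrite -scaleN1r -[- y']scaleN1r; exact: liftZ.
Qed.

Lemma lift_sum s (I : finType) (c : I -> com_gr grC) (x : I -> E) (y : I -> H) :
  (forall i, same_lift s (x i) (y i)) -> same_lift s (\sum_i c i *: x i) (\sum_i c i *: y i).
Proof.
move=> xy; elim/big_rec2: _ => [|i x' y' _ xy']; first exact: lift0.
by apply: liftD => //; exact: liftZ.
Qed.

Lemma gcomp_sum_sym (FN : mod_filtration F M) (r : seq int) (u : int -> M) (d n : int) :
  uniq r -> (forall i, FN (i + d) (u i)) ->
  gcomp (n + d) (\sum_(i <- r) sym grC FN (i + d) (u i)) =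
  if n \in r then sym grC FN (n + d) (u n) else 0.
Proof.
move=> ur Fu; rewrite gcomp_sum.
have [nr|nr] := boolP (n \in r).
  rewrite (bigD1_seq n)//= gcomp_sym// eqxx big1 ?addr0// => i /negbTE ni.
  by rewrite gcomp_sym// (inj_eq (addIr d)) eq_sym ni.
rewrite big_seq big1// => i ir; rewrite gcomp_sym// (inj_eq (addIr d)).
by case: eqP => // ni; rewrite ni ir in nr.
Qed.

Lemma lift_of_shallow s y : shallow s y -> exists2 x, deep s x & same_lift s x y.
Proof.
move=> ys; have [r [ur yr _]] := gcomp_dec y.
have /choice[u uP] n : exists u, [/\ FI n u, FM (n + s%:Z) u & gcomp n y = symH n u].
  exact: ys.
have Fu i : FM (i + s%:Z) (u i) by case: (uP i).
exists (\sum_(i <- r) symE (i + s%:Z) (u i)).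
  apply: (rsub_sum (f := idfun)) => [|i _]; first exact: deep_bsub.
  apply: sym_inP => //; first exact: sat_filt0.
  by rewrite addrK; case: (uP i).
move=> n; have [Iu _ uE] := uP n; have [nr|nr] := boolP (n \in r).
  by exists (u n); split=> //; rewrite gcomp_sum_sym// nr.
by exists 0; rewrite gcomp_sum_sym// (negbTE nr) yr// !sym0; split=> //; exact: mfilt0.
Qed.

Lemma lift_of_deep s x : deep s x -> exists2 y, shallow s y & same_lift s x y.
Proof.
move=> xs; have [r [ur xr _]] := gcomp_dec x.
have /choice[u uP] n : exists u, [/\ FM (n + s%:Z) u, FI n u &
    gcomp (n + s%:Z) x = symE (n + s%:Z) u].
  by have [u [Fu Iu uE]] := xs (n + s%:Z); exists u; rewrite addrK in Iu.
have Iu i : FI (i + 0) (u i) by rewrite addr0; case: (uP i).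
pose r' := [seq i - s%:Z | i <- r].
have ur' : uniq r' by rewrite map_inj_uniq//; exact: addIr.
exists (\sum_(i <- r') symH (i + 0) (u i)).
  apply: (rsub_sum (f := idfun)) => [|i _]; first exact: shallow_bsub.
  apply: sym_inP => //; first exact: mfilt0.
  by rewrite addr0; case: (uP i).
move=> n; have [Fu Iun uE] := uP n; rewrite -[X in gcomp X (\sum_(_ <- _) _)]addr0.
rewrite gcomp_sum_sym//; have [nr|nr] := boolP (n \in r').
  by exists (u n); rewrite addr0.
exists 0; rewrite !sym0 xr; first by split=> //; exact: mfilt0.
apply: contra nr => nr; apply/mapP; exists (n + s%:Z) => //.
by rewrite addrK.
Qed.

(** The common lift [u] is corrected by a deeper lift [v] of the same component of [x]: [u - v]
    loses a degree in [FM] and keeps its symbol in [gr FI], as [v] is in [FI (n - 1)]. *)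
Lemma shallow_of_deep s x y : same_lift s.+1 x y -> deep s.+2 x -> shallow s y.
Proof.
move=> xy xs n; have [u [Fu Iu xu yu]] := xy n.
have [v [Fv sv xv]] := xs (n + s.+1%:Z).
have uv : FM (n + s%:Z) (u - v).
  have -> : n + s%:Z = n + s.+1%:Z - 1 by lia.
  by apply/(sym_eqP grC) => //; rewrite -xu.
have {}sv : FI (n - 1) v by apply: sat_filt_le sv; lia.
exists (u - v); split=> //.
  by apply: mfiltB => //; apply: mfilt_le sv; rewrite gerBl.
rewrite yu; apply/sym_eqP => //.
  by apply: mfiltB => //; apply: mfilt_le sv; rewrite gerBl.
by rewrite opprB addrCA subrr addr0.
Qed.

(** The same correction with the roles of the two filtrations exchanged. *)
Lemma deep_of_shallow s x y : same_lift s.+1 x y -> deep s.+1 x -> shallow s y -> deep s.+2 x.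
Proof.
move=> xy xs ys n'; pose n := n' - s.+1%:Z.
have -> : n' = n + s.+1%:Z by rewrite subrK.
have [u [Fu Iu xu yu]] := xy n; have [v [Iv Fv yv]] := ys n.
have uv : FI (n - 1) (u - v) by apply/(sym_eqP grC) => //; rewrite -yu.
have {}Fv : FM (n + s.+1%:Z - 1) v by apply: mfilt_le Fv; lia.
have Fv' : FM (n + s.+1%:Z) v by apply: mfilt_le Fv; lia.
exists (u - v); split; first exact: mfiltB.
  by apply: sat_filt_le uv; lia.
rewrite xu; apply/sym_eqP => //; first exact: mfiltB.
by rewrite opprB addrCA subrr addr0.
Qed.

(** At level [0] the relation is the graph of the map from [gr FM] to [gr FI] induced by the
    inclusions of [FM j] in [FI j]; its kernel is [deep 1] and its image [shallow 0]. *)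
Lemma lift_0l x y : same_lift 0 x y -> y = 0 -> deep 1 x.
Proof.
move=> xy y0 n; have [u [Fu Iu xu yu]] := xy n.
rewrite addr0 in Fu xu; exists u; split=> //.
by apply: (sym_eq0 grC Iu).1; rewrite -yu y0 gcomp0.
Qed.

Lemma lift_0r y : same_lift 0 0 y -> y = 0.
Proof.
move=> xy; apply: (gcomp_inj hE) => n; rewrite gcomp0.
have [u [Fu Iu xu ->]] := xy n; rewrite addr0 in Fu xu.
apply/sym_eq0 => //; apply: sub_sat_filt.
by apply/(sym_eq0 grC Fu); rewrite -xu gcomp0.
Qed.

Lemma shallow_scale s b : (forall x, deep s.+1 x -> deep s.+2 (b *: x)) ->
  forall y, shallow s.+1 y -> shallow s (b *: y).
Proof.
move=> bT y /lift_of_shallow[x xs xy].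
by apply: shallow_of_deep (bT _ xs); exact: liftZ.
Qed.

Lemma shallow_f s y : shallow s.+1 y -> shallow s (f *: y).
Proof.
apply: shallow_scale => x /deep_ftors ->.
by have [] := deep_bsub s.+2.
Qed.

Lemma deep_fgen s : fgen (ev z m.+1) (deep s).
Proof. by apply: fgen_sub Efg _ _ => //; apply: bsub_rsub; exact: deep_bsub. Qed.

(** [shallow s.+1] is generated by [shallow s] and partners of generators of [deep s.+1], which is
    finite inside [gr FM]. *)
Lemma shallow_fgen s : fgen (ev z m.+1) (shallow s).
Proof.
elim: s => [|s [J [w wE]]].
  have [I [e eE]] := deep_fgen 0.
  have /choice[y yP] i : exists y, shallow 0 y /\ same_lift 0 (e i) y.
    by have [|y] := @lift_of_deep 0 (e i); [rewrite eE; exact: rspan_gen|exists y].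
  exists I, y; apply/seteqP; split; last first.
    apply: rspan_min => [|i]; last by case: (yP i).
    by apply: bsub_rsub; exact: shallow_bsub.
  move=> v /lift_of_shallow[x]; rewrite eE => -[c ->] xv.
  exists c; apply/eqP; rewrite -subr_eq0; apply/eqP; apply: lift_0r.
  rewrite -[X in same_lift 0 X](subrr (\sum_i ev z m.+1 (c i) *: e i)).
  by apply: liftB => //; apply: lift_sum => i; case: (yP i).
have [I [e eE]] := deep_fgen s.+1.
have /choice[y yP] i : exists y, shallow s.+1 y /\ same_lift s.+1 (e i) y.
  by have [|y] := @lift_of_deep s.+1 (e i); [rewrite eE; exact: rspan_gen|exists y].
exists (I + J)%type, (fun o => match o with inl i => y i | inr j => w j end).
apply/seteqP; split; last first.
  apply: rspan_min => [|[i|j]]; first by apply: bsub_rsub; exact: shallow_bsub.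
    by case: (yP i).
  by apply: (shallow_le (leqnSn s)); rewrite wE; exact: rspan_gen.
move=> v /lift_of_shallow[x]; rewrite eE => -[c ->] xv.
rewrite -[v](subrK (\sum_i ev z m.+1 (c i) *: y i)) addrC; apply: rspan_sum.
  by exists c.
rewrite -wE; apply: (@shallow_of_deep s 0); last by have [] := deep_bsub s.+2.
rewrite -[X in same_lift _ X](subrr (\sum_i ev z m.+1 (c i) *: e i)).
by apply: liftB => //; apply: lift_sum => i; case: (yP i).
Qed.

(** [shallow 0] is [gr FM] modulo its torsion. A multiple of the partner [x] is in the kernel, hence
    torsion, so [x] and its components are torsion as well. *)
Lemma shallow0_tfree y : shallow 0 y -> trs y -> y = 0.
Proof.
move=> /lift_of_shallow[x _ xy] [p p0 py].
have /deep_tors[q q0 qpx] : deep 1 (ev z m.+1 p *: x) by apply: lift_0l py; exact: liftZ.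
have tx : trs x.
  by exists (q * p); [rewrite mulf_neq0|rewrite rmorphM -scalerA].
apply: (gcomp_inj hE) => n; rewrite gcomp0.
have [u [Fu Iu xu ->]] := xy n; rewrite addr0 in Fu xu.
apply/sym_eq0 => //; apply: sat_of_tors => //; rewrite -xu.
by apply: (tors_comp (g := gr_mod_grading hE FM) (U := setT) _ _ Efg).
Qed.

Lemma shallow_fX s y : shallow s y -> shallow 0 (f ^+ s *: y).
Proof.
elim: s y => [|s IH] y ys; first by rewrite expr0 scale1r.
by rewrite exprSr -scalerA; apply: IH; exact: shallow_f.
Qed.

(** A power of [f] sends a torsion [y] into the torsion free [shallow 0], so each component of [f]
    acts nilpotently on [y]. If [y] were not zero, some nonzero multiple, again a symbol, would be
    killed by all these components; but saturation puts its lift one step lower. *)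
Lemma sym_tfree j u : FI j u -> trs (symH j u) -> symH j u = 0.
Proof.
move=> Iu tu; set y := symH j u in tu *.
have [s ys] := shallow_ex y.
have fy : nil_on y f by exists s; apply: shallow0_tfree; [exact: shallow_fX|exact: torsZ].
have [r ur br] := fin_supp_seq (rees_supp rho).
pose b q : com_gr grC := asym F q (rho q).
have bh q : h q (b q) by rewrite hE; exists (rho q) => //; exact: rees_filt.
rewrite /cgr_pi (gr_piE ur br) in fy.
have bn := homog_nil (g := gr_mod_grading hE FI) (j := j) ur bh _ fy.
apply/eqP/negPn/negP => y0.
have [|c [cy [[t cE] rc]]] := nil_on_kill (r := r) (b := b) y0.
  by move=> q qr; apply: bn => //=; rewrite gcomp_sym// eqxx.
have [j' [u' [Iu' cu]]] : exists j' u', FI j' u' /\ c *: y = symH j' u'.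
  rewrite cE {cy cE rc}; elim: t => [|q t [j' [u' [Iu' IH]]]].
    by rewrite big_nil scale1r; exists j, u.
  have Fr : F q (rho q) by exact: rees_filt.
  rewrite big_cons -scalerA IH symZ//; exists (q + j'), (rho q *: u'); split=> //.
  exact: mfiltZ.
move/eqP: cy; apply; rewrite cu; apply/sym_eq0 => //.
apply: sat_filt_div => q; have [qr|qr] := boolP (q \in r); last first.
  by rewrite br// scale0r; exact: sat_filt0.
have Fr : F q (rho q) by exact: rees_filt.
have := rc q qr; rewrite cu symZ// => /(sym_eq0 grC (mfiltZ Fr Iu')).
by rewrite addrA.
Qed.

(** [tors_comp] needs a finite module, which [gr FI] is not yet known to be; it is applied inside a
    finite [shallow s]. *)
Lemma tfree y : trs y -> y = 0.
Proof.
move=> ty; have [s ys] := shallow_ex y; apply: (gcomp_inj hE) => n.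
rewrite gcomp0; have [u Iu yu] := gcompE n y; rewrite yu; apply: sym_tfree => //.
rewrite -yu; apply: (tors_comp (g := gr_mod_grading hE FI) (U := shallow s)) => //.
- exact: shallow_bsub.
- exact: shallow_gsub.
- exact: shallow_fgen.
Qed.

Lemma deep1_fgen : fgen (ev z m) (deep 1).
Proof.
apply: (nagata_fgen (y := z) (a := a)) => //; first exact: deep_bsub.
- exact: deep_fgen.
- by move=> i im; have [p pE] := ev_var (com_gr grC) im; exists p.
- by move=> x /deep_ftors; rewrite -fE.
Qed.

(** [deep 1] is finite over the first [m] variables, where ranks become stationary. As [b] is
    constant in the variable in which [a] is monic, the successive quotients have codimension
    two. *)
Lemma deep_codim2 : exists s0, forall s, (s0 <= s)%N -> exists2 b, b != 0 &
  forall x, deep s.+1 x -> deep s.+2 (ev z m b *: x).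
Proof.
have [I [e eE]] := deep1_fgen.
have [|s t st|x|s0 s0P] := @rank_stab _ _ (ev z m) _ (fun s => deep s.+1) I e.
- by move=> s; apply: bsub_rsub; exact: deep_bsub.
- exact: deep_le.
- by rewrite eE.
exists s0 => s s0s.
have [J [w wE]] : fgen (ev z m) (deep s.+1).
  apply: fgen_sub deep1_fgen _ _; last exact: deep_le.
  by apply: bsub_rsub; exact: deep_bsub.
have /choice[b bP] i : exists b, b != 0 /\ deep s.+2 (ev z m b *: w i).
  have [||b b0 bw] := s0P s.+1 _ (w i); first exact: leq_trans (leqnSn _).
    by apply: (@deep_le s0.+1 s.+1) => //; rewrite wE; exact: rspan_gen.
  by exists b.
exists (\prod_i b i); first by apply/prodf_neq0 => i _; case: (bP i).
move=> x; rewrite wE => -[c ->]; rewrite scaler_sumr.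
have TS := deep_bsub s.+2; have [_ _ TZ] := TS.
apply: (rsub_sum (f := idfun)) => [|i _]; first by [].
rewrite (bigD1 i)// scalerA mulrC -scalerA.
by rewrite rmorphM mulrC -scalerA; apply: (TZ); apply: (TZ); case: (bP i).
Qed.

Lemma shallow_lattice s : exists (J : finType) (v : J -> H), rindep (ev z m.+1) v /\
  exists2 c, c != 0 & forall y, shallow s y -> rspan (ev z m.+1) v (ev z m.+1 c *: y).
Proof.
have [I [e eE]] := shallow_fgen s.
have [|J [v [vI vG vP]]] := @max_indep _ _ (ev z m.+1) _ (shallow s) #|I|.
  by move=> J v vI vG; apply: (steinitz vI (w := e)) => j; rewrite -eE.
exists J, v; split=> //.
have /choice[b bP] i : exists b, b != 0 /\ rspan (ev z m.+1) v (ev z m.+1 b *: e i).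
  have [|b b0 bw] := vP (e i); first by rewrite eE; exact: rspan_gen.
  by exists b.
exists (\prod_i b i); first by apply/prodf_neq0 => i _; case: (bP i).
move=> x; rewrite eE => -[c ->]; rewrite scaler_sumr.
have TS := rspan_sub (ev z m.+1) v; have [_ _ TZ] := TS.
apply: (rsub_sum (f := ev z m.+1)) => [|i _]; first by [].
rewrite (bigD1 i)// scalerA mulrC -scalerA.
by rewrite rmorphM mulrC -scalerA; apply: (TZ); apply: (TZ); case: (bP i).
Qed.

(* A lattice containing [c *: y] for [y] in [shallow s] also does so for [y] in
   [shallow s.+1], as [f] and [b] map [shallow s.+1] into [shallow s] and are coprime. *)
Lemma shallow_stable : exists s, forall y, shallow s y.
Proof.
have [s0 s0P] := deep_codim2.
have [J [v [vI [c c0 cG]]]] := shallow_lattice s0.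
have cGs s : shallow s `<=` [set y | rspan (ev z m.+1) v (ev z m.+1 c *: y)].
  have [s0s|/ltnW ss0] := leqP s0 s; last first.
    by move=> y /(shallow_le ss0); exact: cG.
  rewrite -(subnK s0s); elim: (s - s0)%N => [|n IH] y; first exact: cG.
  rewrite addSn => ys.
  have [b b0 bT] := s0P (n + s0)%N (leq_addl _ _).
  apply: (lattice_div am b0 vI tfree).
    by rewrite -fE scalerA mulrC -scalerA; exact: IH _ (shallow_f ys).
  by rewrite scalerA mulrC -scalerA; exact: IH _ (shallow_scale bT ys).
(* Multiplication by [c] embeds [gr FI] into the lattice, so its image is finite; preimages of
   generators of the image lie in a common [shallow]. *)
have [I [e eE]] : fgen (ev z m.+1) (range (fun y : H => ev z m.+1 c *: y)).
  apply: (@fgen_sub _ _ _ _ _ (rspan (ev z m.+1) v)); first by exists J, v.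
    split; first by exists 0; rewrite ?scaler0.
      by move=> _ _ [x _ <-] [y _ <-]; exists (x + y); rewrite ?scalerDr.
    by move=> d _ [x _ <-]; exists (ev z m.+1 d *: x); rewrite // !scalerA mulrC.
  by move=> _ [y _ <-]; have [s ys] := shallow_ex y; exact: (cGs s).
have /choice[w wE] i : exists w, ev z m.+1 c *: w = e i.
  by have [w _ wE] : range (fun y : H => ev z m.+1 c *: y) (e i);
    [rewrite eE; exact: rspan_gen|exists w].
have /choice[s sP] i := shallow_ex (w i).
exists (\max_i s i)%N => y.
have : range (fun y : H => ev z m.+1 c *: y) (ev z m.+1 c *: y) by exists y.
rewrite eE => -[d dE].
have -> : y = \sum_i ev z m.+1 (d i) *: w i.
  apply/eqP; rewrite -subr_eq0; apply/eqP/tfree; exists c => //.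
  rewrite scalerBr dE scaler_sumr -sumrB big1// => i _.
  by rewrite -wE !scalerA mulrC subrr.
have GS := shallow_bsub (\max_i s i)%N; have [_ _ GZ] := GS.
apply: (rsub_sum (f := idfun)) => [|i _]; first by [].
apply: GZ; apply: shallow_le (sP i); exact: leq_bigmax.
Qed.

Lemma saturation_fgen : fgen (ev z m.+1) [set: H].
Proof.
have [s sP] := shallow_stable; have [I [e eE]] := shallow_fgen s; exists I, e.
by rewrite -eE; apply/seteqP; split.
Qed.

Hypothesis fin : forall j, exists (I : finType) (e : I -> M), FM j `<=` rspan (in_alg A) e.

(** Once the [shallow s] are stationary, so are the [deep s]; by finite dimension and separation
    their stable value is zero. *)
Lemma saturation_bounded : exists p : nat, forall j, sf j `<=` FM (j + p%:Z).
Proof.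
have [s0 s0P] := shallow_stable.
have TpS s : (s0 <= s)%N -> deep s.+1 `<=` deep s.+2.
  move=> s0s x xs; have [y _ xy] := lift_of_deep xs.
  by apply: deep_of_shallow xy xs _; exact: shallow_le s0s _ (s0P y).
have TpSt t : deep s0.+1 `<=` deep (t + s0).+1.
  elim: t => [//|t IH] x /IH; rewrite addSn; apply: TpS; exact: leq_addl.
have key j u : FM j u -> sf (j - s0.+1%:Z) u -> FM (j - 1) u.
  move=> Fu su.
  have [I [e Ie]] := fin j.
  have [|s t st||t0 t0P] := @rank_stab k A (in_alg A) M
    (fun t => FM j `&` sf (j - t%:Z)) I e.
  - move=> t; split; first by split; [exact: mfilt0|exact: sat_filt0].
      by move=> x y [? ?] [? ?]; split; [exact: mfiltD|exact: sat_filtD].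
    move=> c x [? ?]; split; last exact: sat_filt_sc.
    by rewrite -[j]add0r; apply: mfiltZ => //; apply: filtZ; exact: filt1.
  - move=> x [? sx]; split=> //; apply: sat_filt_le sx; lia.
  - by move=> x [/Ie].
  (* Over the field [k], stationary rank means stationary subspaces: such a [v] lies in every
     [sf i]. *)
  have Z v : FM j v -> sf (j - t0%:Z) v -> v = 0.
    move=> Fv sv; apply: sep => i.
    have [||b b0 [_ bv]] := t0P (maxn t0 `|j - i|%N) _ v; [exact: leq_maxl|by split|].
    have -> : v = (b^-1)%:A *: (b%:A *: v).
      by rewrite scalerA -(rmorphM (in_alg A)) mulVf// rmorph1 scale1r.
    by apply: sat_filt_sc => //; apply: sat_filt_le bv; lia.
  (* The symbol is also in [deep (t0 + s0).+1], where its lift is deep enough to vanish by [Z]. *)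
  have xs : deep s0.+1 (symE j u) by apply: sym_inP => //; exact: sat_filt0.
  have [v [Fv sv uv]] := TpSt t0 _ xs j.
  move: uv; rewrite gcomp_sym// eqxx (Z v) ?sym0//; first by move/(sym_eq0 grC Fu).
  by apply: sat_filt_le sv; lia.
(* As long as [u] is more than [s0] degrees above its level in [sf], [key] lowers its degree in [FM]
   by one. *)
exists s0 => j u su; have [p pu] := mfilt_ex FM (j + s0%:Z) u.
elim: p pu => [|p IH] pu; first by rewrite addr0 in pu.
apply: IH; have := key _ _ pu; have -> : j + s0 + p.+1 - 1 = j + s0 + p by lia.
by apply; apply: sat_filt_le su; lia.
Qed.

End Limit.
End Saturated.

(** * Gelfand-Kirillov dimension *)

Section FilteredGrowth.
Variables (k : fieldType) (A : algType k) (F : filtration A).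
Variables (grC : commutative (@GRing.mul (gr F))).
Variables (h : ring_grading (com_gr grC)) (hE : hm h = gr_homog (grC := grC)).
Variables (M : lmodType A) (FM : mod_filtration F M).
Local Notation B := (com_gr grC).
Local Notation E := (cgr_mod grC FM).
Local Notation symE := (sym grC FM).
Local Notation kA := (in_alg A).
Local Notation kB := (in_alg B).

Lemma cgr_mod_fgen : good_filtration FM -> fgen (ev (hgen h) (hnum h)) [set: E].
Proof.
move=> [s sE]; pose e (i : 'I_(size s)) : E := gr_mod_pi s`_i.
exists 'I_(size s), e; apply/seteqP; split=> // x _.
pose S : set (rees_mod FM) := [set y | rspan (ev (hgen h) (hnum h)) e (gr_mod_pi y : E)].
have ES := rspan_sub (ev (hgen h) (hnum h)) e; have [E0 ED EZ] := ES.
suff : S (gr_mod_repr x) by rewrite /S /= gr_mod_reprK.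
have : [set: rees_mod FM] (gr_mod_repr x) by [].
rewrite sE; apply; split=> [|y ys]; last first.
  have ys' : (index y s < size s)%N by rewrite index_mem.
  rewrite /S /= -[y](nth_index 0 ys); exact: (rspan_gen _ e (Ordinal ys')).
have pi0 : gr_mod_pi (0 : rees_mod FM) = 0 :> E.
  by apply: (addrI (gr_mod_pi 0 : E)); rewrite -[LHS]gr_mod_piD !addr0.
split=> [|a u v]; rewrite ?inE /S /= ?pi0// gr_mod_piD => Su Sv; apply: ED => //.
rewrite -gr_mod_scaleE.
by have [p _ <-] := hgen_ev h (gr_pi a : B); apply: EZ.
Qed.

Lemma kB_asym (c : k) : kB c = asym F 0 c%:A :> B.
Proof.
transitivity (c *: (asym F 0 1 : B)); first by rewrite asym1.
by rewrite [LHS]asymZ//; exact: filt1.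
Qed.

Lemma mfilt_sc n c u : FM n u -> FM n (kA c *: u).
Proof.
by move=> Fu; rewrite -[n]add0r; apply: mfiltZ => //; apply: filtZ; exact: filt1.
Qed.

Lemma sym_sc n c u : FM n u -> symE n (kA c *: u) = kB c *: symE n u.
Proof.
move=> Fu; rewrite kB_asym symZ ?add0r//.
by apply: filtZ; exact: filt1.
Qed.

Lemma sym_lin n (I : finType) (c : I -> k) (u : I -> M) : (forall i, FM n (u i)) ->
  FM n (\sum_i kA (c i) *: u i) /\
  symE n (\sum_i kA (c i) *: u i) = \sum_i kB (c i) *: symE n (u i).
Proof.
move=> Fu; elim/big_rec2: _ => [|i x y _ [Fy yE]]; first by rewrite sym0; split=> //; exact: mfilt0.
have Fc := mfilt_sc (c i) (Fu i); split; first exact: mfiltD.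
by rewrite symD// yE sym_sc.
Qed.

(** Below the least degree of [gr M], each [FM n] equals [FM (n - 1)], so it is in the intersection
    of all, which is zero. *)
Lemma mfilt_below z m : fgen (ev z m) [set: E] ->
  exists d : int, forall n u, n < d -> FM n u -> u = 0.
Proof.
move=> Efg; have [||d dP] := graded_below (g := gr_mod_grading hE FM) _ _ Efg; try by [].
exists d => n u nd Fu.
have Fi (i : nat) : FM (n - i%:Z) u.
  elim: i => [|i IH]; first by rewrite subr0.
  rewrite -addn1 PoszD opprD addrA; apply/(sym_eq0 grC IH).
  apply: (dP (n - i%:Z)) => //=; first by rewrite gcomp_sym// eqxx.
  by apply: le_lt_trans nd; rewrite gerBl.
have : (\bigcap_(i in [set: int]) FM i) u.
  by move=> i _; apply: (mfilt_le _ (Fi `|n - i|%N)); lia.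
by rewrite mfilt_bigcap.
Qed.

Section Basis.
Variables (z : nat -> B) (m : nat) (T : set E) (N : set M).
Hypothesis Efg : fgen (ev z m) T.
Hypotheses (TS : bsub T) (Tg : gsub (gr_mod_grading hE FM) T).
Hypothesis NT : forall n u, N u -> FM n u -> T (symE n u).
Hypotheses (N0 : N 0) (ND : forall u v, N u -> N v -> N (u + v)).
Hypothesis NZ : forall (c : k) u, N u -> N (kA c *: u).
Variable d : int.
Hypothesis Md : forall n u, n < d -> FM n u -> u = 0.

(* A basis adapted to the filtration: both the elements and their symbols are
   independent. *)
Lemma filt_basis (n : nat) : exists (I : finType) (u : I -> M) (e : I -> int),
  [/\ forall i, [/\ e i < d + n%:Z, N (u i) & FM (e i) (u i)],
      rindep kB (fun i => symE (e i) (u i)),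
      rindep kA u &
      forall j w, j < d + n%:Z -> N w -> FM j w ->
        rspan kA u w /\ rspan kB (fun i => symE (e i) (u i)) (symE j w)].
Proof.
elim: n => [|n [I [u [e [ue uI uI' uP]]]]].
  exists void, (fun=> 0), (fun=> 0); split=> [[]|c _ []|c _ []|j w].
  rewrite addr0 => jd _ /(Md jd) ->.
  by split; exists (fun=> 0); rewrite ?(sym0 grC FM j) big1// => -[].
pose j := d + n%:Z.
have [K Kb] := graded_bound TS Tg Efg.
have [J [w [_ wP]]] := Kb `|j|%N.
(* The new basis vectors in degree [j] are lifts of a maximal independent family of symbols of
   elements of [N]. *)
have [|I' [v [vI vU vP]]] := @max_indep k B kB E
    [set symE j x | x in [set x | N x /\ FM j x]] #|J|.
  move=> I' v vI vU; apply: (steinitz vI (w := w)) => i.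
  have [x [Nx Fx] <-] := vU i; apply: (wP j); [exact: NT|lia|].
  by rewrite /= gcomp_sym// eqxx.
have /choice[u' u'P] i : exists x, [/\ N x, FM j x & symE j x = v i].
  by have [x [Nx Fx] xE] := vU i; exists x.
have Nu' i : N (u' i) by case: (u'P i).
have Fu' i : FM j (u' i) by case: (u'P i).
have vE : v = (fun i => symE j (u' i)) by apply/funext => i; case: (u'P i).
rewrite vE in vI vP.
pose uu (o : I + I') := match o with inl i => u i | inr i => u' i end.
pose ee (o : I + I') := match o with inl i => e i | inr i => j end.
have Fu i : FM (j - 1) (u i).
  by have [ed _ Fu] := ue i; apply: mfilt_le Fu; rewrite -[e i](addrK 1) lerD2r; lia.
have symS : (fun o => symE (ee o) (uu o)) =
    (fun o => match o with inl i => symE (e i) (u i) | inr i => symE j (u' i) end).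
  by apply/funext => -[].
have nj : d + n.+1%:Z = j + 1 by rewrite /j; lia.
have incl x : rspan kA u x -> rspan kA uu x.
  move=> [c ->]; exists (fun o => if o is inl i then c i else 0).
  by rewrite big_sumType/= [X in _ + X]big1 ?addr0// => i _; rewrite !scale0r.
have inclE x : rspan kB (fun i => symE (e i) (u i)) x -> rspan kB (fun o => symE (ee o) (uu o)) x.
  move=> [c ->]; exists (fun o => if o is inl i then c i else 0).
  by rewrite big_sumType/= [X in _ + X]big1 ?addr0// => i _; rewrite !scale0r.
exists (I + I')%type, uu, ee; split.
- move=> [i|i] /=; last by split=> //; lia.
  by have [ei Nu Fe] := ue i; split=> //; lia.
- move=> c; rewrite big_sumType/= => c0.
  have c'0 : forall i, c (inr i) = 0.
    apply: (vI (fun i => c (inr i))); have /(congr1 (gcomp j)) := c0.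
    rewrite gcompD gcomp0 !gcomp_sum big1 => [|i _].
      rewrite add0r => H; rewrite -[RHS]H; apply: eq_bigr => i _.
      by rewrite -sym_sc// gcomp_sym ?eqxx//; exact: mfilt_sc.
    have [ei _ Fe] := ue i; rewrite -sym_sc// gcomp_sym//; last exact: mfilt_sc.
    by rewrite (gt_eqF ei).
  move: c0; rewrite [X in _ + X]big1 ?addr0; last first.
    by move=> i _; rewrite c'0 !scale0r.
  by move=> /uI c0 [i|i].
- move=> c; rewrite big_sumType/= => c0.
  have c'0 : forall i, c (inr i) = 0.
    apply: (vI (fun i => c (inr i))).
    have [F1 <-] := sym_lin (fun i => c (inr i)) Fu'.
    have [F2 _] := sym_lin (fun i => c (inl i)) Fu.
    apply/sym_eq0 => //; move/eqP: c0; rewrite addr_eq0 => /eqP E.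
    rewrite -[X in FM _ X]opprK -E; exact: mfiltN.
  move: c0; rewrite [X in _ + X]big1 ?addr0; last first.
    by move=> i _; rewrite c'0 !scale0r.
  by move=> /uI' c0 [i|i].
- move=> i x; rewrite nj ltzD1 le_eqVlt => /predU1P[->|ij] Nx Fx; last first.
    by have [? ?] := uP _ _ ij Nx Fx; split; [exact: incl|exact: inclE].
  have [|b b0 [c cE]] := vP (symE j x); first by exists x.
  have bE : symE j (kA b *: x) = symE j (\sum_i kA (c i) *: u' i).
    by rewrite sym_sc// cE; have [_ ->] := sym_lin c Fu'.
  have [Fc _] := sym_lin c Fu'.
  have Nc : N (\sum_i kA (c i) *: u' i).
    by elim/big_ind: _ => // l _; exact: NZ.
  have Fd : FM (j - 1) (kA b *: x - \sum_i kA (c i) *: u' i).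
    by apply/(sym_eqP grC) => //; exact: mfilt_sc.
  have Nd : N (kA b *: x - \sum_i kA (c i) *: u' i).
    apply: ND; first exact: NZ.
    by rewrite -scaleN1r -(rmorphN1 kA); exact: NZ.
  have bK (G : lmodType A) (y : G) : y = kA b^-1 *: (kA b *: y).
    by rewrite scalerA -(rmorphM kA) mulVf// rmorph1 scale1r.
  have bK' (G : lmodType B) (y : G) : y = kB b^-1 *: (kB b *: y).
    by rewrite scalerA -(rmorphM kB) mulVf// rmorph1 scale1r.
  split.
    rewrite [x]bK -[kA b *: x](subrK (\sum_i kA (c i) *: u' i)).
    have US := rspan_sub kA uu; have [_ UD UZ] := US.
    apply: UZ; apply: UD.
      by apply: incl; have [] := uP (j - 1) _ _ Nd Fd; rewrite // gtrDl.
    exists (fun o => if o is inr i then c i else 0).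
    by rewrite big_sumType/= [X in X + _]big1 ?add0r// => l _; rewrite !scale0r.
  rewrite [symE j x]bK' cE.
  have [_ _ UZ] := rspan_sub kB (fun o => symE (ee o) (uu o)).
  apply: UZ; exists (fun o => if o is inr i then c i else 0).
  by rewrite big_sumType/= [X in X + _]big1 ?add0r// => l _; rewrite !scale0r.
Qed.

(** An adapted basis of the part of [N] in degree at most [L] has as many elements as independent
    symbols, and these lie in [T]: so [N] grows no faster than [T]. *)
Lemma filt_growth : exists K : nat, forall (L : nat) (J : finType) (v : J -> M),
  rindep kA v -> (forall i, N (v i) /\ FM L%:Z (v i)) -> (#|J| <= K * L.+1 ^ m)%N.
Proof.
have [K Kb] := graded_bound TS Tg Efg.
exists K => L J v vI vN.
have [Ld|dL] := ltrP L%:Z d.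
  apply: (@leq_trans #|{: void}|); last by rewrite card_void.
  apply: (steinitz vI (w := fun _ : void => 0)) => i; rewrite (Md Ld (vN i).2).
  by exists (fun=> 0); rewrite big1// => -[].
have [I [u [e [ue uI uI' uP]]]] := filt_basis (absz (L%:Z - d + 1)).
have dE : d + (absz (L%:Z - d + 1))%:Z = L%:Z + 1 by lia.
rewrite dE in ue uP; have [J' [w [J'K wP]]] := Kb L.
apply: leq_trans J'K; apply: (@leq_trans #|I|).
  apply: (steinitz vI (w := u)) => i; have [Nv Fv] := vN i.
  by have [] := uP L%:Z (v i) _ Nv Fv; first by rewrite ltzD1.
apply: (steinitz uI (w := w)) => i; have [ei Nu Fe] := ue i.
apply: (wP (e i)); [exact: NT|by rewrite -ltzD1|].
by rewrite /= gcomp_sym// eqxx.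
Qed.

End Basis.
Section Total.
Variables (z : nat -> B) (m : nat).
Hypothesis Efg : fgen (ev z m) [set: E].

Lemma mfilt_fin j : exists (I : finType) (e : I -> M), FM j `<=` rspan kA e.
Proof.
have [d Md] := mfilt_below Efg.
have [//|//|//|//|//|//|I [u [e [_ _ _ uP]]]] :=
  @filt_basis z m setT setT Efg _ _ _ _ _ _ d Md (absz (j - d + 1)).
by exists I, u => x Fx; have [] := uP j x _ _ Fx; first by lia.
Qed.

Definition lowE (L : int) (x : E) := forall i, L < i -> gcomp i x = 0.

Lemma lowE_shift (b : B) : exists c : nat, forall L x, lowE L x -> lowE (L + c%:Z) (b *: x).
Proof.
have [r [x xh ->]] := gr_homog_dec b; exists (\sum_(q <- r) `|q|)%N => L y yL i iL.
rewrite scaler_suml gcomp_sum big_seq big1// => q qr.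
have [a Fa ->] := xh q; rewrite (gcomp_hM hE)// yL ?scaler0//.
have : (`|q| <= \sum_(q <- r) `|q|)%N by rewrite (big_rem q)//= leq_addr.
lia.
Qed.

Lemma lowE_mon (y : nat -> B) n : exists c : nat, forall N (a : idx n N) L x,
  lowE L x -> lowE (L + (c * N)%N%:Z) (mon y a *: x).
Proof.
elim: n => [|n [c cP]].
  by exists 0%N => N a L x; rewrite mul0n addr0 scale1r.
have [c' c'P] := lowE_shift (y n); exists (c + c')%N => N [a [i iN]] L x Lx.
have c'i (l : nat) : lowE (L + (c' * l)%N%:Z) (y n ^+ l *: x).
  elim: l => [|l IH]; first by rewrite muln0 addr0 scale1r.
  by rewrite exprS -scalerA mulnS addnC PoszD addrA; exact: c'P.
have := cP N a _ _ (c'i i); rewrite /= scalerA => H j jL; apply: H.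
by apply: le_lt_trans jL; nia.
Qed.

(** Neither [g] nor the [y] are homogeneous, but the components of the orbit have degrees bounded
    linearly in [N], hence are spanned by the symbols of an adapted basis. *)
Lemma free_growth (y : nat -> B) n (g : E) : free_orbit y n g ->
  exists c : nat, forall N : nat, exists (I : finType) (u : I -> M),
    [/\ rindep kA u, forall i, FM (c * N.+1)%N%:Z (u i) & (N.+1 ^ n <= #|I|)%N].
Proof.
move=> yg; have [d Md] := mfilt_below Efg.
have [C CP] := lowE_mon y n.
have [e0 ge0] : exists e0 : nat, lowE e0%:Z g.
  have [r [_ gr _]] := gcomp_dec g; exists (\sum_(q <- r) `|q|)%N => i ir.
  apply: gr; apply/negP => qr.
  have : (`|i| <= \sum_(q <- r) `|q|)%N by rewrite (big_rem i)//= leq_addr.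
  lia.
(* The basis has degrees below [d + absz (L - d + 1)], which is at most [L + 2 * |d| + 1]. *)
exists (e0 + C + 2 * `|d| + 2)%N => N; pose L : int := e0%:Z + (C * N)%N%:Z.
have [//|//|//|//|//|//|I [u [e [ue uI uI' uP]]]] :=
  @filt_basis z m setT setT Efg _ _ _ _ _ _ d Md (absz (L - d + 1)).
exists I, u; split=> // [i|].
  by have [ei _ Fe] := ue i; apply: mfilt_le Fe; move: ei; rewrite /L; nia.
rewrite -card_idx; apply: (steinitz (free_indep yg) (w := fun i => symE (e i) (u i))) => a.
have := CP N a _ _ ge0; rewrite -/L => xL.
have [r [_ _ ->]] := gcomp_dec (mon y a *: g).
have US := rspan_sub kB (fun i => symE (e i) (u i)); have [U0 _ _] := US.
apply: (rsub_sum (f := kB)) => [//|i _]; have [iL|Li] := lerP i L; last by rewrite xL.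
have [w Fw ->] := gcompE i (mon y a *: g).
by have [] := uP i w _ _ Fw; first by lia.
Qed.

End Total.

Lemma words_filt (s : seq A) : exists q : nat, forall n a, words s n a -> F (q * n)%N%:Z a.
Proof.
have /choice[p pP] := filt_ex F.
exists (\sum_(a <- s) `|p a|)%N => n _ [u [un us] <-].
suff : F ((\sum_(a <- s) `|p a|) * size u)%N%:Z (\prod_(a <- u) a).
  by apply: filt_le; rewrite lez_nat leq_mul2l un orbT.
elim: u us {un} => [|a u IH] us; first by rewrite muln0 big_nil; exact: filt1.
rewrite big_cons mulnS PoszD; apply: filtM; last first.
  by apply: IH => b bu; apply: us; rewrite inE bu orbT.
apply: (filt_le _ (pP a)).
have : (`|p a| <= \sum_(a <- s) `|p a|)%N.
  by rewrite (big_rem a) ?us ?mem_head//= leq_addr.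
lia.
Qed.

Lemma lspan_sub (R : pzRingType) (V : lmodType R) (X S : set V) :
  submod_closed (mem S) -> X `<=` S -> lspan X `<=` S.
Proof. by move=> SS XS x; apply. Qed.

Lemma lspan_submod (R : pzRingType) (V : lmodType R) (X : set V) :
  submod_closed (mem (lspan X)).
Proof.
split=> [|c u v]; rewrite !inE; first by move=> S [SS _]; exact: submod_mem0 SS.
by move=> uX vX S SX; have [SS _] := SX; apply: submod_memP SS _ _ _ (uX S SX) (vX S SX).
Qed.

Lemma word_span_filt (s : seq A) (t : seq M) : exists c : nat, forall n,
  word_span s t n `<=` FM (c * n.+1)%N%:Z.
Proof.
have [q qP] := words_filt s; have /choice[p pP] := mfilt_ex FM 0.
exists (q + \sum_(x <- t) p x)%N => n.
apply: lspan_sub; first exact: (mfilt_submod FM).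
move=> _ [a wa [x xt <-]]; apply: mfilt_le (mfiltZ (qP _ _ wa) (pP x)).
have : (p x <= \sum_(x <- t) p x)%N by rewrite (big_rem x)//= leq_addr.
nia.
Qed.

Lemma word_span_submod (N : set M) (s : seq A) (t : seq M) n :
  submod_closed (mem N) -> [set` t] `<=` N -> word_span s t n `<=` N.
Proof.
move=> NS tN; apply: lspan_sub.
  split; first by rewrite inE; exact: submod_mem0 NS.
  by move=> c u v; rewrite !inE; exact: submod_memP NS _ _ _.
by move=> _ [a wa [x xt <-]]; apply: submod_memZ => //; exact: tN.
Qed.

Fixpoint monA (al : nat -> A) (n N : nat) : idx n N -> A :=
  match n return idx n N -> A with
  | 0 => fun=> 1
  | m.+1 => fun a => monA al a.1 * al m ^+ a.2
  end.

Lemma sym_sum n (I : Type) (r : seq I) (P : pred I) (u : I -> M) :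
  (forall i, P i -> FM n (u i)) ->
  FM n (\sum_(i <- r | P i) u i) /\
  symE n (\sum_(i <- r | P i) u i) = \sum_(i <- r | P i) symE n (u i).
Proof.
move=> Fu; elim/big_rec2: _ => [|i x y Pi [Fy yE]].
  by rewrite sym0; split=> //; exact: mfilt0.
by have Fi := Fu i Pi; split; [exact: mfiltD|rewrite symD// yE].
Qed.

(** Lifts of homogeneous generators of [gr A] and [gr M] give the same symbols, and the difference
    drops in degree. Since [gr A] is generated in positive degrees, the degree bounds the length of
    the words. *)
Lemma word_span_gen (z : nat -> B) (m : nat) : fgen (ev z m) [set: E] ->
  exists (s : seq A) (t : seq M) (D : nat), forall n : nat,
    FM n%:Z `<=` word_span s t (n + D).
Proof.
move=> Efg; have [d Md] := mfilt_below Efg.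
have [//|//|I [e [dd [_ ed eP]]]] := homog_gens (g := gr_mod_grading hE FM) _ _ Efg.
have /choice[al alP] i : exists x, (i < hnum h)%N -> F (hdeg h i)%:Z x /\
    hgen h i = asym F (hdeg h i)%:Z x.
  have [ih|ih] := ltnP i (hnum h); last by exists 0.
  by have := hgen_hm ih; rewrite hE => -[x Fx xE]; exists x.
have /choice[tau tauP] i : exists x, FM (dd i) x /\ e i = symE (dd i) x.
  by have [x Fx] := gcompE (dd i) (e i); have /= -> := ed i; exists x.
pose s := [seq al i | i <- iota 0 (hnum h)]; pose t := [seq tau i | i <- enum I].
have monP n N (a : idx n N) : (n <= hnum h)%N ->
    [/\ F (mdeg h a)%:Z (monA al a), asym F (mdeg h a)%:Z (monA al a) = mon (hgen h) a &
        words s (mdeg h a) (monA al a)].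
  elim: n a => [|n IH] a nh.
    split; [exact: filt1|exact: asym1|].
    by exists [::]; rewrite ?big_nil.
  case: a => a [i iN]; have [Fa aE [u [ua us] uE]] := IH a (ltnW nh).
  have [Fn nE] := alP n nh.
  have Fi : F (hdeg h n * i)%N%:Z (al n ^+ i).
    by have := filtX i Fn; rewrite -mulr_natr natz -PoszM.
  have iE : asym F (hdeg h n * i)%N%:Z (al n ^+ i) = (hgen h n ^+ i : B).
    elim: (i) Fi {iN} => [|l IHl] Fi; first by rewrite muln0 expr0 [LHS]asym1.
    have Fl : F (hdeg h n * l)%N%:Z (al n ^+ l).
      by have := filtX l Fn; rewrite -mulr_natr natz -PoszM.
    by rewrite [RHS]exprS -(IHl Fl) nE mulnS PoszD [RHS]asymM// exprS.
  split=> /=; rewrite ?PoszD; first exact: filtM.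
    by rewrite -asymM// aE iE.
  exists (u ++ nseq i (al n)).
    split.
      rewrite size_cat size_nseq leq_add//; apply: leq_pmull; exact: hdeg_gt0.
    move=> x; rewrite mem_cat => /orP[/us//|/nseqP[-> _]].
    by apply/mapP; exists n => //; rewrite mem_iota.
  by rewrite big_cat uE big_nseq -Monoid.iteropE.
exists s, t, (\sum_i `|dd i|)%N.
set D := (\sum_i `|dd i|)%N.
have WS K := lspan_submod (V := restrict_scalars M)
  [set (a *: x : M) | a in words s K & x in [set` t]].
suff H n j u (K : nat) : j < d + n%:Z -> FM j u -> j + D%:Z <= K%:Z -> word_span s t K u.
  move=> n u Fu; apply: (H (absz (n%:Z - d + 1)) n%:Z) => //; lia.
elim: n j u => [|n IH] j u jn Fu jK.
  by rewrite addr0 in jn; rewrite (Md _ _ jn Fu); exact: submod_mem0 (WS K).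
have [//|/=|L [c cE]] := eP (symE j u) j; first by rewrite gcomp_sym// eqxx.
pose w := \sum_i \sum_(a : idx (hnum h) L | (mdeg h a)%:Z + dd i == j)
  (c i a)%:A *: (monA al a *: tau i).
have Fterm i a : (mdeg h a)%:Z + dd i == j ->
    FM j ((c i a)%:A *: (monA al a *: tau i)) /\
    symE j ((c i a)%:A *: (monA al a *: tau i)) = (c i a *: mon (hgen h) a) *: e i.
  move=> /eqP <-; have [Fa aE _] := monP _ _ a (leqnn _); have [Ft tE] := tauP i.
  have Fat := mfiltZ Fa Ft.
  split; first exact: mfilt_sc.
  by rewrite sym_sc// -symZ// aE tE scalerA -mulr_algl.
have [Fw wE] : FM j w /\ symE j w = symE j u.
  have H1 i := @sym_sum j _ (index_enum (idx (hnum h) L)) _ _ (fun a ja => (Fterm i a ja).1).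
  have [F1 F2] := @sym_sum j _ (index_enum I) xpredT _ (fun i _ => (H1 i).1).
  split; first exact: F1.
  rewrite [LHS]F2 cE; apply: eq_bigr => i _; rewrite (H1 i).2.
  by apply: eq_bigr => a ja; rewrite (Fterm i a ja).2.
rewrite -[u](subrK w).
apply: (submod_memD (WS K)).
  apply: (IH (j - 1)); [lia| |lia].
  by apply/(sym_eqP grC).
rewrite /w.
apply: (submod_mem_sum (WS K)) => i _; apply: (submod_mem_sum (WS K)) => a /eqP ja.
apply: (submod_memZ (WS K)) => S [_ SX]; apply: SX.
exists (monA al a).
  have [_ _ [v [va vs] vE]] := monP _ _ a (leqnn _); exists v => //; split=> //.
  apply: leq_trans va _.
  have : (`|dd i| <= D)%N by rewrite /D (bigD1 i)//= leq_addr.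
  lia.
by exists (tau i) => //=; apply/mapP; exists i => //; rewrite mem_enum.
Qed.

End FilteredGrowth.

(** * Logarithmic estimates for the upper limit *)

Section LimSup.
Variable K : realType.
Implicit Types (u : (\bar K)^nat) (l : \bar K).
Local Open Scope ereal_scope.

Lemma limn_esup_inf u : limn_esup u = ereal_inf (range (esups u)).
Proof. by rewrite limn_esup_lim; apply/cvg_lim => //; exact: cvg_esups_inf. Qed.

Lemma limn_esup_le u l n0 : (forall n, (n0 <= n)%N -> u n <= l) -> limn_esup u <= l.
Proof.
move=> ul; rewrite limn_esup_inf; apply: (@le_trans _ _ (esups u n0)).
  by apply: ereal_inf_lbound; exists n0.
by apply: ge_ereal_sup => _ [n /= n0n <-]; exact: ul.
Qed.

Lemma limn_esup_ge u l n0 : (forall n, (n0 <= n)%N -> l <= u n) -> l <= limn_esup u.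
Proof.
move=> lu; rewrite limn_esup_inf; apply: le_ereal_inf_tmp => _ [n _ <-].
apply: (@le_trans _ _ (u (maxn n n0))); first by apply: lu; exact: leq_maxr.
by apply: ereal_sup_ubound; exists (maxn n n0) => //=; exact: leq_maxl.
Qed.

End LimSup.

Section DimLog.
Variable K : realType.
Local Open Scope ereal_scope.

(** The exponent [4] makes [ln C.+1] at most a quarter of [ln n]. *)
Lemma log_dim_le (D C m n : nat) : (1 < n)%N -> (C.+1 ^ 4 <= n)%N ->
  (D <= C.+1 * n ^ m)%N ->
  lne (D%:R%:E : \bar K) * ((ln n%:R)^-1)%:E <= (m%:R + 4^-1)%:E.
Proof.
move=> n1 Cn DC.
have n1' : (1 < n%:R :> K)%R by rewrite ltr1n.
have n0 : (0 < n%:R :> K)%R by exact: lt_trans n1'.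
have ln0 : (0 < ln (n%:R : K))%R by exact: ln_gt0.
have [->|D0] := posnP D; first by rewrite le0_lneNy// gt0_mulNye ?leNye// lte_fin invr_gt0.
rewrite lne_EFin ?ltr0n// -EFinM lee_fin ler_pdivrMr//.
have C0 : (0 < C.+1%:R :> K)%R by rewrite ltr0n.
have H1 : (ln (D%:R : K) <= ln (C.+1%:R : K) + ln (n%:R : K) *+ m)%R.
  rewrite -lnXn// -lnM ?posrE ?exprn_gt0// ler_ln ?posrE ?ltr0n ?mulr_gt0 ?exprn_gt0//.
  by rewrite -natrX -natrM ler_nat.
have H2 : (ln (C.+1%:R : K) *+ 4 <= ln (n%:R : K))%R.
  by rewrite -lnXn// ler_ln ?posrE ?exprn_gt0// -natrX ler_nat.
apply: (le_trans H1); rewrite -(mulr_natl _ m) mulrDl.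
rewrite -(mulr_natl _ 4) in H2; lra.
Qed.

(** Replacing [N.+1] by [n] costs [m.+1] times [ln C.+1], which the exponent [2 * m.+1] keeps within
    half of [ln n]. *)
Lemma log_dim_ge (D N C m n : nat) : (1 < n)%N -> (C.+1 ^ (2 * m.+1) <= n)%N ->
  (n <= C.+1 * N.+1)%N -> (N.+1 ^ m.+1 <= D)%N ->
  (m%:R + 2^-1)%:E <= lne (D%:R%:E : \bar K) * ((ln n%:R)^-1)%:E.
Proof.
move=> n1 Cn nN ND.
have n1' : (1 < n%:R :> K)%R by rewrite ltr1n.
have n0 : (0 < n%:R :> K)%R by exact: lt_trans n1'.
have ln0 : (0 < ln (n%:R : K))%R by exact: ln_gt0.
have D0 : (0 < D)%N by apply: leq_trans ND; rewrite expn_gt0.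
rewrite lne_EFin ?ltr0n// -EFinM lee_fin ler_pdivlMr//.
have C0 : (0 < C.+1%:R :> K)%R by rewrite ltr0n.
have N0 : (0 < N.+1%:R :> K)%R by rewrite ltr0n.
have H1 : (ln (N.+1%:R : K) *+ m.+1 <= ln (D%:R : K))%R.
  by rewrite -lnXn// ler_ln ?posrE ?ltr0n ?exprn_gt0// -natrX ler_nat.
have H2 : (ln (C.+1%:R : K) *+ (2 * m.+1) <= ln (n%:R : K))%R.
  by rewrite -lnXn// ler_ln ?posrE ?exprn_gt0// -natrX ler_nat.
have H3 : (ln (n%:R : K) <= ln (C.+1%:R : K) + ln (N.+1%:R : K))%R.
  by rewrite -lnM ?posrE// ler_ln ?posrE ?mulr_gt0// -natrM ler_nat.
have E : (ln (C.+1%:R : K) *+ (2 * m.+1) = 2 * (m.+1%:R * ln C.+1%:R))%R.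
  by rewrite -[LHS]mulr_natl natrM mulrA.
rewrite E in H2; apply: le_trans H1; rewrite -[leRHS]mulr_natl.
have H4 := ler_wpM2l (ler0n K m.+1) H3.
move: H2 H4; set x := ln _; set y := ln _; set w := ln _.
by rewrite -(natr1 m) => H2 H4; lra.
Qed.

End DimLog.

Section LDim.
Variables (K : realType) (k : fieldType) (A : algType k) (M : lmodType A).
Local Notation kA := (in_alg A).
Local Notation kM := (restrict_scalars M).

Lemma ldim_le (U : set kM) (r : nat) :
  (forall (n : nat) (v : 'I_n -> M), rindep kA v -> (forall i, U (v i)) -> (n <= r)%N) ->
  (ldim K U <= r%:R%:E)%E.
Proof.
move=> Ur; apply: ge_ereal_sup => _ [s [sI sU] <-].
rewrite lee_fin ler_nat; apply: (Ur _ (fun i => (s : seq M)`_i)) => // i.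
by apply: sU; exact: mem_nth.
Qed.

Lemma ldim_ge (U : set kM) (I : finType) (v : I -> M) :
  rindep kA v -> (forall i, U (v i)) -> (#|I|%:R%:E <= ldim K U)%E.
Proof.
move=> vI vU; apply: ereal_sup_ubound => /=.
exists [seq v i | i <- enum I]; last by rewrite size_map -cardE.
split=> [|_ /mapP[i _ ->]//].
set s : seq M := [seq v i | i <- enum I].
have ss : size s = #|I| by rewrite size_map -cardE.
move=> c c0 i.
pose g (x : I) : 'I_(size s) := cast_ord (esym ss) (enum_rank x).
have gb : bijective g.
  exists (fun j => enum_val (cast_ord ss j)) => x; first by rewrite /g cast_ordKV enum_rankK.
  by rewrite /g enum_valK cast_ordK.
have [g' gK g'K] := gb.
rewrite -(g'K i); apply: (vI (fun x => c (g x))).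
have : \sum_(i < size s) kA (c i) *: s`_i = 0 by exact: c0.
rewrite (reindex g)/=; last exact: onW_bij.
move=> H; rewrite -[RHS]H; apply: eq_bigr => x _; congr (_ *: _).
by rewrite /s (nth_map x) ?nth_enum_rank// -cardE.
Qed.

End LDim.

Section GKCompare.
Variable K : realType.
Variables (k : fieldType) (A : algType k) (F : filtration A).
Variables (grC : commutative (@GRing.mul (gr F))).
Variables (h : ring_grading (com_gr grC)) (hE : hm h = gr_homog (grC := grC)).
Variables (M : lmodType A) (FM : mod_filtration F M).
Local Notation E := (cgr_mod grC FM).
Local Notation kA := (in_alg A).

Lemma ldim_ge0 (U : set (restrict_scalars M)) : (0 <= ldim K U)%E.
Proof.
have := @ldim_ge K k A M U void (fun=> 0); rewrite card_void; apply; last by case.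
by move=> c _ [].
Qed.

Lemma lne_ldim_le (U : set (restrict_scalars M)) (r n : nat) : (1 < n)%N ->
  (ldim K U <= r%:R%:E)%E ->
  (lne (ldim K U) * ((ln n%:R)^-1)%:E <= lne (r%:R%:E) * ((ln n%:R)^-1)%:E)%E.
Proof.
move=> n1 Ur; rewrite lee_wpmul2r//.
  by rewrite lee_fin invr_ge0 ln_ge0// ler1n ltnW.
by rewrite lee_lne// !in_itv/= ?ldim_ge0 ?leey// lee_fin ler0n.
Qed.

Lemma lne_ldim_ge (U : set (restrict_scalars M)) (r n : nat) : (1 < n)%N ->
  (r%:R%:E <= ldim K U)%E ->
  (lne (r%:R%:E) * ((ln n%:R)^-1)%:E <= lne (ldim K U) * ((ln n%:R)^-1)%:E)%E.
Proof.
move=> n1 Ur; rewrite lee_wpmul2r//.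
  by rewrite lee_fin invr_ge0 ln_ge0// ler1n ltnW.
by rewrite lee_lne// !in_itv/= ?ldim_ge0 ?leey// lee_fin ler0n.
Qed.

(* The constants [1 / 4] and [1 / 2] only serve to separate the two bounds without
   computing a limit. *)
Lemma GKdim_le (N : set M) (m C : nat) : submod_closed (mem N) ->
  (forall (L : nat) (J : finType) (v : J -> M), rindep kA v ->
     (forall i, N (v i) /\ FM L%:Z (v i)) -> (#|J| <= C * L.+1 ^ m)%N) ->
  (GKdim K N <= (m%:R + 4^-1)%:E)%E.
Proof.
move=> NS NC; apply: ge_ereal_sup => _ [s [t [tN ->]]].
have [c cP] := word_span_filt FM s t.
(* For positive [n], [(c * n.+1).+1] is at most [2 * c.+1 * n]. *)
pose C' := (C * (2 * c.+1) ^ m)%N.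
apply: (@limn_esup_le _ _ _ (maxn 2 (C'.+1 ^ 4))) => n; rewrite geq_max => /andP[n2 nC].
pose r := (C * (c * n.+1).+1 ^ m)%N.
apply: (@le_trans _ _ (lne (r%:R%:E) * ((ln n%:R)^-1)%:E)%E).
  apply: lne_ldim_le => //; apply: ldim_le => n' v vI vW.
  have := NC (c * n.+1)%N _ v vI; rewrite card_ord; apply=> i.
  by split; [apply: word_span_submod (vW i)|exact: (cP n)].
apply: (log_dim_le K (C := C')) => //.
apply: (@leq_trans (C' * n ^ m)%N); last by rewrite leq_mul2r leqnSn orbT.
rewrite /C' -mulnA -expnMn leq_mul2l; apply/orP; right.
have [->|m0] := posnP m; first by rewrite !expn0.
rewrite leq_exp2r//; nia.
Qed.

Lemma GKdim_ge (z : nat -> com_gr grC) (m' : nat) (y : nat -> com_gr grC) (m : nat) (g : E) :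
  fgen (ev z m') [set: E] -> free_orbit y m.+1 g ->
  ((m%:R + 2^-1)%:E <= GKdim K [set: M])%E.
Proof.
move=> Efg yg; have [s [t [D DP]]] := word_span_gen hE Efg.
have [c cP] := free_growth hE Efg yg.
apply: (@le_trans _ _ (limn_esup (fun n =>
    lne (ldim K (word_span s t n)) * ((ln n%:R)^-1)%:E)%E)); last first.
  by apply: ereal_sup_ubound; exists s, t.
pose C := (2 * c.+1)%N.
apply: (@limn_esup_ge _ _ _ (maxn 2 (maxn (2 * D + 2 * c.+1) (C.+1 ^ (2 * m.+1))))) => n.
rewrite !geq_max => /and3P[n2 nD nC].
(* With this [N], [FM (c * N.+1)] lies in [word_span s t n]; the threshold [2 * D + 2 * c.+1] yields
   [n < 2 * c.+1 * N.+1]. *)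
pose N := ((n - D) %/ c.+1).-1.
have N0 : (0 < (n - D) %/ c.+1)%N by rewrite divn_gt0//; lia.
have NE : N.+1 = ((n - D) %/ c.+1)%N by rewrite /N prednK.
have Nn : (c * N.+1 + D <= n)%N.
  have : (N.+1 * c.+1 <= n - D)%N by rewrite NE leq_trunc_div.
  lia.
have nN : (n <= C.+1 * N.+1)%N.
  have : (n - D < N.+2 * c.+1)%N by rewrite NE ltn_ceil.
  rewrite /C; nia.
have [I [u [uI uF IN]]] := cP N.
apply: (@le_trans _ _ (lne (#|I|%:R%:E) * ((ln n%:R)^-1)%:E)%E).
  exact: (log_dim_ge K n2 nC nN IN).
apply: lne_ldim_ge => //; apply: ldim_ge uI _ => i.
have nE : n = (n - D + D)%N by lia.
rewrite nE; apply: DP; apply: mfilt_le (uF i); rewrite lez_nat; lia.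
Qed.

End GKCompare.

(** * Krull dimension *)

Section Primes.
Variable B : comNzRingType.

Record idl (I : set B) : Prop := Idl {
  idl0 : I 0;
  idlD : forall a b, I a -> I b -> I (a + b);
  idlM : forall a b, I b -> I (a * b) }.

Record prim (P : set B) : Prop := Prim {
  prim_idl :> idl P;
  prim1 : ~ P 1;
  primM : forall a b, P (a * b) -> P a \/ P b }.

Lemma idlMr I a b : idl I -> I a -> I (a * b).
Proof. by move=> HI Ia; rewrite mulrC; exact: idlM. Qed.

Lemma idlN I a : idl I -> I a -> I (- a).
Proof. by move=> HI Ia; rewrite -mulN1r; exact: idlM. Qed.

Lemma idl_sum I (J : Type) (r : seq J) (p : pred J) (f : J -> B) :
  idl I -> (forall i, p i -> I (f i)) -> I (\sum_(i <- r | p i) f i).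
Proof.
by move=> HI H; elim/big_ind: _ => //; [exact: idl0|exact: idlD].
Qed.

Lemma primX P a n : prim P -> P (a ^+ n) -> P a.
Proof.
move=> PP; elim: n => [/(prim1 PP)//|n IH]; rewrite exprS => /(primM PP)[//|].
exact: IH.
Qed.

(** [p + w * b] is [w * b] modulo [I], so [w ^+ n] times a polynomial in [b] becomes homogeneous in
    [w] and [p + w * b]. *)
Lemma idl_homogenize I p w b c n i : idl I -> I p -> (i <= n)%N ->
  I (c * w ^+ (n - i) * (p + w * b) ^+ i - w ^+ n * (c * b ^+ i)).
Proof.
move=> HI Ip ni.
have -> : w ^+ n * (c * b ^+ i) = c * w ^+ (n - i) * (w * b) ^+ i.
  by rewrite exprMn -{1}(subnK ni) exprD mulrCA -!mulrA; congr (_ * (_ * _)); rewrite mulrCA mulrA.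
rewrite -mulrBr; apply: idlM => //; rewrite subrXX addrK; exact: idlMr.
Qed.

Lemma exists_prim (I S : set B) : idl I -> S 1 ->
  (forall a b, S a -> S b -> S (a * b)) -> (forall a, I a -> ~ S a) ->
  exists P, [/\ prim P, I `<=` P & forall a, P a -> ~ S a].
Proof.
move=> HI S1 SM IS.
(* The condition bears on the union of [I] and [J], because the empty chain has union [set0], which
   is no ideal. *)
pose good (J : set B) := idl (I `|` J) /\ forall a, (I `|` J) a -> ~ S a.
have [C CG tot|J [[HJ JS] Jmax]] := @Zorn_bigcup B good.
  have [[X0 CX0]|CN] := pselect (exists X, C X); last first.
    have -> : \bigcup_(X in C) X = set0.
      by apply/seteqP; split=> // x [X CX]; case: CN; exists X.
    by rewrite /good setU0.
  have sub X : C X -> I `|` X `<=` I `|` \bigcup_(X in C) X.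
    by move=> CX x [Ix|Xx]; [left|right; exists X].
  have lift a : (I `|` \bigcup_(X in C) X) a -> exists2 X, C X & (I `|` X) a.
    by move=> [Ia|[X CX Xa]]; [exists X0 => //; left|exists X => //; right].
  split; last by move=> a /lift[X CX Xa]; have [_] := CG X CX; exact.
  split.
  - by left; exact: idl0.
  - move=> a b /lift[X CX Xa] /lift[Y CY Yb].
    have [XY|YX] := tot X Y CX CY.
      apply: (sub Y CY); apply: idlD => //; first by have [] := CG Y CY.
      by move: Xa => [|/XY]; [left|right].
    apply: (sub X CX); apply: idlD => //; first by have [] := CG X CX.
    by move: Yb => [|/YX]; [left|right].
  - move=> a b /lift[X CX Xb]; apply: (sub X CX); apply: idlM => //.
    by have [] := CG X CX.
pose P := I `|` J.
have PP : idl P by exact: HJ.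
have ext a : ~ P a -> exists p r, P p /\ S (p + r * a).
  move=> Pa; apply: contrapT => H.
  pose J' : set B := [set x | exists p r, P p /\ x = p + r * a].
  have PJ' : P `<=` J' by move=> p Pp; exists p, 0; rewrite mul0r addr0.
  have IJ' : I `|` J' = J'.
    by apply/seteqP; split=> [x [Ix|//]|x]; [apply: PJ'; left|right].
  apply: (Jmax J'); last first.
    rewrite /good IJ'; split; last first.
      by move=> _ [p [r [Pp ->]]] Sp; apply: H; exists p, r.
    split; first by apply: PJ'; exact: idl0.
      move=> _ _ [p [r [Pp ->]]] [p' [r' [Pp' ->]]]; exists (p + p'), (r + r').
      by split; [exact: idlD|rewrite mulrDl addrACA].
    move=> c _ [p [r [Pp ->]]]; exists (c * p), (c * r).
    by split; [exact: idlM|rewrite mulrDr mulrA].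
  split=> [x Jx|J'J]; first by apply: PJ'; right.
  apply: Pa; right; apply: J'J; exists 0, 1; rewrite add0r mul1r.
  by split=> //; exact: idl0.
exists P; split=> //; last by move=> x; left.
split=> //; first by move=> /JS.
move=> a b Pab; apply: contrapT => /not_orP[/ext[p [r [Pp Sp]]] /ext[q [s [Pq Sq]]]].
apply: (JS _ _ (SM _ _ Sp Sq)); rewrite mulrDl !mulrDr.
apply: idlD => //; apply: idlD => //.
- exact: idlM.
- exact: idlMr.
- exact: idlM.
- by rewrite mulrACA; exact: idlM.
Qed.

End Primes.

Section Krull.
Variables (k : fieldType) (B : comAlgType k).
Implicit Types (P Q : set B) (z y : nat -> B).

Definition indep_mod P y n := forall p, P (ev y n p) -> p = 0.

Definition set_at z n (b : B) : nat -> B := fun i => if i == n then b else z i.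

Lemma ev_set_at z n b (p : polyring k n) : ev (set_at z n b) n p = ev z n p.
Proof. by apply: ev_ext => i ni; rewrite /set_at (ltn_eqF ni). Qed.

Lemma ev_set_atS z n b (q : {poly polyring k n}) N : (size q <= N)%N ->
  ev (set_at z n b) n.+1 q = \sum_(i < N) ev z n q`_i * b ^+ i.
Proof.
move=> qN; rewrite (evSE _ qN) {2}/set_at eqxx; apply: eq_bigr => i _.
by rewrite ev_set_at.
Qed.

(** An element [x] of [Q 1] outside [Q 0] is the new variable: modulo [Q 1] the constant coefficient
    of a relation vanishes by induction, and then [x] cancels modulo [Q 0]. *)
Lemma chain_indep (n : nat) (Q : nat -> set B) :
  (forall i, (i <= n)%N -> prim (Q i)) ->
  (forall i, (i < n)%N -> Q i `<` Q i.+1) -> exists y, indep_mod (Q 0%N) y n.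
Proof.
elim: n Q => [|n IH] Q QP QS.
  exists (fun=> 0) => p; rewrite ev0E => Qp; apply/eqP/negPn/negP => p0.
  apply: (prim1 (QP 0%N (leqnn _))).
  rewrite -(scale1r (1 : B)) -(mulVf (p0 : (p : k) != 0)) -scalerA -mulr_algl.
  by apply: (idlM (QP 0%N (leqnn _))).
have [||y yI] := IH (fun i => Q i.+1).
- by move=> i ni; exact: QP.
- by move=> i ni; exact: (QS i.+1).
have [Q01 /existsNP[x /not_implyP[Q1x Q0x]]] := QS 0%N (ltn0Sn n).
have P0 := QP 0%N (ltn0Sn n); have P1 := QP 1%N (leq_trans (ltn0Sn n) (leqnn _)).
exists (set_at y n x); elim/poly_ind => [//|p c IHp].
rewrite rmorphD rmorphM evX evC ev_set_at {2}/set_at eqxx => H.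
have c0 : c = 0.
  apply: yI; have := Q01 _ H; set u := _ * x => Hu.
  rewrite -[ev y n c](addKr u); apply: (idlD P1) => //.
  by apply: (idlN P1); exact: (idlM P1).
rewrite c0 rmorph0 addr0 in H.
by have [/IHp ->|//] := primM P0 H; rewrite mul0r add0r c0 polyC0.
Qed.

Section Module.
Variables (H : lmodType B) (z : nat -> B) (d : nat).
Hypothesis Hfg : fgen (ev z d) [set: H].

Definition ann : set B := [set b | forall x : H, b *: x = 0].

Lemma ann_idl : idl ann.
Proof.
split=> [x|a b aa ab x|a b ab x]; first by rewrite scale0r.
  by rewrite scalerDl aa ab addr0.
by rewrite -scalerA ab scaler0.
Qed.

(** The determinant trick: the characteristic polynomial of a matrix for the action of [b] on
    generators. *)
Lemma integral_mod_ann b : exists2 q : {poly polyring k d},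
  q \is monic & ann (ev (set_at z d b) d.+1 q).
Proof.
have [I [e0 e0E]] := Hfg; rewrite rspan_ord in e0E.
set n := #|I| in e0E; set e := (fun i : 'I_n => _) in e0E.
have /choice[c cE] i : exists c : 'I_n -> polyring k d, b *: e i = \sum_j ev z d (c j) *: e j.
  by have : [set: H] (b *: e i) by []; rewrite e0E => -[c ->]; exists c.
pose C : 'M[polyring k d]_n := \matrix_(i, j) c i j.
exists (char_poly C); first exact: char_poly_monic.
set f := ev _ _; pose D := map_mx f (char_poly_mx C).
have De i : \sum_j D i j *: e j = 0.
  rewrite (eq_bigr (fun j => (b *+ (i == j)) *: e j - ev z d (c i j) *: e j)).
    rewrite sumrB -cE (bigD1 i)//= eqxx big1 ?addr0 ?subrr// => j /negbTE ji.
    by rewrite eq_sym ji scale0r.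
  move=> j _; rewrite /D !mxE -scalerBl; congr (_ *: _).
  rewrite (rmorphB f) (rmorphMn f) /f evX evC ev_set_at; congr (_ *+ _ - _).
  by rewrite /set_at eqxx.
have det i : \det D *: e i = 0.
  have /matrixP/(_ i) E := mul_adj_mx D.
  transitivity (\sum_j ((\adj D *m D) i j) *: e j).
    rewrite mul_adj_mx (bigD1 i)//= mxE eqxx mulr1n big1 ?addr0// => j /negbTE ji.
    by rewrite mxE eq_sym ji scale0r.
  under eq_bigr do rewrite mxE scaler_suml.
  rewrite exchange_big big1// => l _.
  by under eq_bigr do rewrite -scalerA; rewrite -scaler_sumr De scaler0.
have -> : f (char_poly C) = \det D by rewrite /char_poly -det_map_mx.
move=> x; have : [set: H] x by []; rewrite e0E => -[a ->].
by rewrite scaler_sumr big1// => i _; rewrite scalerA mulrC -scalerA det scaler0.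
Qed.

(** The tuple [u] of generators, in a power of [H], has annihilator [ann]; so independence modulo
    [P] makes its orbit free. *)
Lemma indep_mod_le P y n : ann `<=` P -> indep_mod P y n -> (n <= d)%N.
Proof.
move=> aP yP; have [I [e eE]] := Hfg.
pose G : lmodType B := {ffun I -> H}.
pose u : G := [ffun i => e i].
have GS : bsub [set: G] by [].
have Gfg : fgen (ev z d) [set: G].
  exists (I * I)%type, (fun ij => [ffun l => if l == ij.1 then e ij.2 else 0] : G).
  apply/seteqP; split=> // w _.
  have /choice[c cE] i : exists c : I -> polyring k d, (w : {ffun I -> H}) i = \sum_j ev z d (c j) *: e j.
    by have : [set: H] ((w : {ffun I -> H}) i) by []; rewrite eE => -[c ->]; exists c.
  exists (fun ij => c ij.1 ij.2); apply/ffunP => l; rewrite cE sum_ffunE.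
  rewrite -(pair_bigA _ (fun i j => (ev z d (c i j) *: ([ffun l => if l == i then e j else 0] : G) : {ffun I -> H}) l))/=.
  rewrite [RHS](bigD1 l)//= [X in _ = _ + X]big1 ?addr0 => [|i /negbTE il].
    by apply: eq_bigr => j _; rewrite !ffunE eqxx.
  by apply: big1 => j _; rewrite !ffunE eq_sym il scaler0.
apply: (free_orbit_dim GS Gfg (u := u)) => // p pu; apply: yP; apply: aP => x.
have : [set: H] x by []; rewrite eE => -[a ->].
rewrite scaler_sumr big1// => i _; rewrite scalerA mulrC -scalerA.
have /ffunP/(_ i) : (ev y n p *: u : {ffun I -> H}) = 0 by exact: pu.
by rewrite !ffunE => ->; rewrite scaler0.
Qed.

Lemma prim_chain_le (Q : nat -> set B) n : ann `<=` Q 0%N ->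
  (forall i, (i <= n)%N -> prim (Q i)) ->
  (forall i, (i < n)%N -> Q i `<` Q i.+1) -> (n <= d)%N.
Proof.
move=> aQ QP QS; have [y yI] := chain_indep QP QS.
exact: indep_mod_le aQ yI.
Qed.

(* If [x = ev z d p] is in [P] and [p != 0], torsion freeness makes [ann] disjoint
   from the products [c * x ^+ n] with [c] not in [P], so that some prime smaller
   than [P] contains [ann] but not [x]. *)
Lemma min_prim_indep P : (forall x : H, tors z d x -> x = 0) -> prim P -> ann `<=` P ->
  (forall Q, prim Q -> ann `<=` Q -> Q `<=` P -> P `<=` Q) -> indep_mod P z d.
Proof.
move=> tf PP aP Pmin p Pp; apply/eqP/negPn/negP => p0.
pose x := ev z d p.
pose S : set B := [set s | exists c n, ~ P c /\ s = c * x ^+ n].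
have [|_ _ [c [n [Pc ->]]] [c' [n' [Pc' ->]]]|a aa [c [n [Pc aE]]]|Q [QP aQ QS]] :=
  @exists_prim B ann S ann_idl.
- by exists 1, 0%N; rewrite mulr1; split=> //; exact: prim1.
- exists (c * c'), (n + n')%N; rewrite exprD mulrACA; split=> //.
  by move=> /(primM PP)[].
- apply: Pc; apply: aP => w; apply: tf; exists (p ^+ n); first by rewrite expf_neq0.
  by rewrite rmorphXn scalerA mulrC -aE.
apply: (QS x); last by exists 1, 1%N; rewrite mul1r; split=> //; exact: prim1.
apply: Pmin => // c Qc; apply: contrapT => Pc.
by apply: (QS c Qc); exists c, 0%N; rewrite mulr1.
Qed.

End Module.

(** A direct form of lying over: a prime [P1] over [P] containing the last variable and no nonzero
    polynomial in the others satisfies the hypotheses with one variable less. *)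
Lemma prim_chain z d P : prim P -> indep_mod P z d ->
  (forall b, exists2 q : {poly polyring k d}, q \is monic & P (ev (set_at z d b) d.+1 q)) ->
  exists Q : nat -> set B, [/\ Q 0%N = P, forall i, (i <= d)%N -> prim (Q i) &
    forall i, (i < d)%N -> Q i `<` Q i.+1].
Proof.
elim: d P => [|d IH] P PP zI bI; first by exists (fun=> P); split.
pose w := z d.
pose J : set B := [set x | exists p b, P p /\ x = p + w * b].
have HJ : idl J.
  split=> [|_ _ [p [b [Pp ->]]] [p' [b' [Pp' ->]]]|a _ [p [b [Pp ->]]]].
  - by exists 0, 0; rewrite mulr0 addr0; split=> //; exact: (idl0 PP).
  - exists (p + p'), (b + b'); rewrite mulrDr addrACA; split=> //.
    exact: (idlD PP).
  - exists (a * p), (a * b); rewrite mulrDr mulrCA; split=> //.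
    exact: (idlM PP).
have PJ : P `<=` J by move=> p Pp; exists p, 0; rewrite mulr0 addr0.
have Jw : J w by exists 0, 1; rewrite mulr1 add0r; split=> //; exact: (idl0 PP).
pose S : set B := [set s | exists2 p : polyring k d, p != 0 & s = ev z d p].
have [||_ [p [b [Pp ->]]] [q q0 qE]|P1 [P1P JP1 P1S]] := @exists_prim B J S HJ.
- by exists 1; rewrite ?oner_neq0 ?rmorph1.
- move=> _ _ [p p0 ->] [q q0 ->]; exists (p * q); first by rewrite mulf_neq0.
  by rewrite rmorphM.
(* If [q = p + w * b], homogenizing the monic equation of [b] gives a polynomial [g] in the [z i]
   with value in [P], hence zero; but its constant coefficient in [w] is [q ^+ n]. *)
- have [f fm Pf] := bI b; pose n := (size f).-1.
  have fn : (size f <= n.+1)%N by rewrite /n; case: (size f).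
  pose g : {poly polyring k d} := \sum_(i < n.+1) (f`_i : {poly polyring k d}) * 'X ^+ (n - i) * (q%:P) ^+ i.
  have g0 : g = 0.
    apply: zI; have : P (w ^+ n * ev (set_at z d.+1 b) d.+2 f) by exact: (idlM PP).
    rewrite (ev_set_atS _ _ fn) mulr_sumr.
    set s1 := \sum_(i < _) _ => Ps1.
    rewrite -[ev z d.+1 g](subrK s1); apply: (idlD PP) => //.
    rewrite /g rmorph_sum /s1 -sumrB.
    apply: idl_sum => [|i _]; first exact: PP.
    rewrite !rmorphM !rmorphXn evX evC -qE.
    by apply: idl_homogenize => //; [exact: PP|rewrite -ltnS].
  have : g`_0 = q ^+ n.
    rewrite /g coef_sum big_ord_recr/= subnn expr0 mulr1.
    have fn1 : f`_n = 1 by rewrite -(monicP fm) lead_coefE.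
    rewrite fn1 mul1r -rmorphXn coefC eqxx big1 ?add0r// => i _.
    by rewrite mulrAC coefMXn subn_gt0 ltn_ord.
  by rewrite g0 coef0 => /esym/eqP; rewrite expf_eq0 (negbTE q0) andbF.
have P1w : P1 w by exact: JP1.
have PP1 : P `<=` P1 by move=> x /PJ/JP1.
have red (c : {poly polyring k d}) : P1 (ev z d.+1 c - ev z d c`_0).
  rewrite (evSE _ (leqnSn _)) big_ord_recl expr0 mulr1 addrAC subrr add0r.
  apply: idl_sum => [|i _]; first exact: P1P.
  rewrite exprS mulrCA.
  exact: (idlMr _ P1P).
have zI1 : indep_mod P1 z d.
  by move=> p Pp; apply/eqP/negPn/negP => p0; apply: (P1S _ Pp); exists p.
have [b|Q [Q0 QP QS]] := IH P1 P1P zI1.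
  (* Setting the last variable to zero in the coefficients keeps [f] monic and changes its value by
     an element of [P1]. *)
  have [f fm Pf] := bI b.
  exists (map_poly (fun c : {poly polyring k d} => c`_0) f).
    have h0 (c : {poly polyring k d}) : c`_0 = horner_eval 0 c by rewrite /horner_eval horner_coef0.
    rewrite (eq_map_poly h0); exact: monic_map.
  rewrite (@ev_set_atS _ _ _ _ (size f)) ?size_poly//.
  rewrite -[X in P1 X](subrK (ev (set_at z d.+1 b) d.+2 f)); apply: (idlD P1P); last exact: PP1.
  rewrite (@ev_set_atS _ _ _ _ (size f))// -sumrB.
  apply: idl_sum => [|i _]; first exact: P1P.
  rewrite -mulrBl; apply: (idlMr _ P1P); rewrite coef_map_id0 ?coef0//.
  by rewrite -opprB; apply: (idlN P1P); exact: red.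
exists (fun i => if i is j.+1 then Q j else P); split=> //.
  by move=> [|i] //; exact: QP.
move=> [_|i /QS//]; rewrite Q0; split=> // P1P'.
have /zI/eqP : P (ev z d.+1 'X) by rewrite evX; exact: P1P'.
by rewrite polyX_eq0.
Qed.

End Krull.

(** * Irreducible closed sets and chains of primes *)

Section Spec.
Variable R : comPzRingType.
Implicit Types (p q : spec R) (Z : set (spec R)) (E : set R).

Definition vz E : set (spec R) := [set q : spec R | E `<=` q].
Definition zid Z : set R := [set a | forall q, Z q -> (q : set R) a].

Lemma spec_idealM q a b : (q : set R) b -> (q : set R) (a * b).
Proof. exact: (submod_memZ (ideal_closed q) a). Qed.

Lemma spec_ideal0 q : (q : set R) 0.
Proof. exact: (submod_mem0 (ideal_closed q)). Qed.

Lemma spec_idealD q a b : (q : set R) a -> (q : set R) b -> (q : set R) (a + b).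
Proof. exact: (submod_memD (ideal_closed q)). Qed.

Lemma spec_primeM q a b : (q : set R) (a * b) -> (q : set R) a \/ (q : set R) b.
Proof. by have [_] := spec_prime q; apply. Qed.

Lemma mk_spec (P : set R) : P 0 -> (forall a b, P a -> P b -> P (a + b)) ->
  (forall a b, P b -> P (a * b)) -> ~ P 1 -> (forall a b, P (a * b) -> P a \/ P b) ->
  exists q : spec R, (q : set R) = P.
Proof.
move=> P0 PD PM P1 PP.
have PI : submod_closed (mem (P : set R^o)).
  split=> [|a u v]; rewrite !inE => // Pu Pv.
  by apply: PD => //; exact: PM.
by exists (@Spec R (Ideal PI) (conj P1 PP)).
Qed.

Lemma spec_closedP (C : set (spec R)) : closed C <-> exists E, C = vz E.
Proof.
rewrite -openC; split=> [[E CE]|[E ->]]; exists E.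
  rewrite -[C]setCK CE; apply/seteqP; split=> q /=; last by move=> Eq; apply.
  exact: contrapT.
by apply/seteqP; split.
Qed.

Lemma vz_zid (C : set (spec R)) : closed C -> C = vz (zid C).
Proof.
move=> /spec_closedP[E ->]; apply/seteqP; split=> q /=.
  by move=> Eq a; apply.
by move=> H a Ea; apply: H => p; apply.
Qed.

Lemma irreducible_prime Z : irreducible Z -> exists q : spec R, (q : set R) = zid Z.
Proof.
move=> [[q0 Zq0] ZI]; apply: mk_spec.
- by move=> q _; exact: spec_ideal0.
- by move=> a b Za Zb q Zq; apply: spec_idealD; [exact: Za|exact: Zb].
- by move=> a b Zb q Zq; apply: spec_idealM; exact: Zb.
- by move=> /(_ _ Zq0); have [+ _] := spec_prime q0.
move=> a b Zab; have [||q Zq|H|H] := ZI (vz [set a]) (vz [set b]).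
- by apply/spec_closedP; eexists.
- by apply/spec_closedP; eexists.
- by have [qa|qb] := spec_primeM (Zab q Zq); [left|right] => _ ->.
- by left=> q /H; apply.
- by right=> q /H; apply.
Qed.

Lemma vz_irreducible q : irreducible (vz q).
Proof.
split; first by exists q.
move=> C D /spec_closedP[E ->] /spec_closedP[E' ->] /(_ q)[//|Eq|Eq]; [left|right] => p qp a Ea.
  exact/qp/Eq.
exact/qp/Eq.
Qed.

Lemma vz_closed E : closed (vz E).
Proof. by apply/spec_closedP; exists E. Qed.

Lemma irreducible_componentP Z : irreducible_component Z ->
  exists2 q : spec R, Z = vz q & forall p, p `<=` q -> q `<=` p.
Proof.
move=> [Zirr Zmax]; have [q qE] := irreducible_prime Zirr.
have Zq : Z `<=` vz q by move=> p Zp; rewrite /vz /= qE => a; apply.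
have ZE : Z = vz q by rewrite -(Zmax _ (vz_irreducible q) Zq).
exists q => // p pq; have Zp : Z `<=` vz p.
  by rewrite ZE => p' qp'; exact: subset_trans qp'.
have pZ : vz p p by [].
by rewrite (Zmax _ (vz_irreducible p) Zp) ZE in pZ.
Qed.

Lemma krull_dim_le (K : realType) q (d : nat) :
  (forall n (Q : nat -> spec R), q `<=` Q 0%N ->
     (forall i, (i < n)%N -> (Q i : set R) `<` Q i.+1) -> (n <= d)%N) ->
  (krull_dim K (vz q) <= d%:R%:E)%E.
Proof.
move=> Hd; apply: ge_ereal_sup => _ [n [Y [YI YS]] <-]; rewrite lee_fin ler_nat.
have Ycl i : (i <= n)%N -> closed (Y i).
  by move=> /YI[_ [C Ccl ->]]; apply: closedI => //; exact: vz_closed.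
have /choice[P PE] i : exists p : spec R, (i <= n)%N -> (p : set R) = zid (Y i).
  have [/YI[/irreducible_prime[p pE] _]|ni] := leqP i n; first by exists p.
  by exists q.
apply: (Hd n (fun i => P (n - i)%N)).
  rewrite subn0 PE//; have [_ [C _ YE]] := YI n (leqnn n).
  by move=> a qa p; rewrite YE => -[/(_ a qa)].
move=> i ni; rewrite !PE ?leq_subr//.
have jE : (n - i)%N = (n - i.+1).+1 by lia.
have [Y1 Y2] := YS (n - i.+1)%N ltac:(lia).
rewrite jE; split=> [a Za p /Y1|H]; first exact: Za.
apply: Y2; rewrite (vz_zid (Ycl (n - i.+1)%N (leq_subr _ _))) => p Yp a Za.
exact: (H a Za).
Qed.

Lemma krull_dim_ge (K : realType) q (d : nat) (Q : nat -> spec R) :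
  q `<=` Q 0%N -> (forall i, (i < d)%N -> (Q i : set R) `<` Q i.+1) ->
  (d%:R%:E <= krull_dim K (vz q))%E.
Proof.
move=> qQ QS; apply: ereal_sup_ubound; exists d => //.
have qQi i : (i <= d)%N -> q `<=` Q i.
  elim: i => [//|i IH] id; apply: subset_trans (IH (ltnW id)) _.
  by have [] := QS i id.
exists (fun i => vz (Q (d - i)%N)); split=> i id.
  split; first exact: vz_irreducible.
  exists (vz (Q (d - i)%N)); first exact: vz_closed.
  apply/seteqP; split=> p; last by case.
  by move=> Qp; split=> //; apply: subset_trans Qp; apply: qQi; exact: leq_subr.
have dE : (d - i)%N = (d - i.+1).+1 by lia.
have [Q1 Q2] := QS (d - i.+1)%N ltac:(lia).
rewrite dE; split=> [p Qp|H]; first exact: subset_trans Qp.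
by apply: Q2; apply: H.
Qed.

End Spec.

Section Quotient.
Variables (B : comNzRingType) (I : ideal B).
Local Notation R := (ring_quot I).
Local Notation pi := (@rq_pi B I).

Definition pull (q : spec R) : set B := [set b | (q : set R) (pi b)].

Lemma rq_pi1 : pi 1 = 1. Proof. by []. Qed.

Lemma rq_piM a b : pi (a * b) = pi a * pi b.
Proof. by rewrite -rq_mulE. Qed.

Lemma rq_pi_eq0 b : (I : set B) b -> pi b = 0.
Proof.
move=> Ib; have pi0 : pi 0 = 0 by apply: (addrI (pi 0)); rewrite -rq_piD !addr0.
by rewrite -pi0; apply/rq_piP; rewrite subr0 unfold_in inE.
Qed.

Lemma pull_prim q : prim (pull q).
Proof.
split; first split.
- rewrite /pull /= rq_pi_eq0; first exact: spec_ideal0.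
  exact: (submod_mem0 (ideal_closed I)).
- by move=> a b qa qb; rewrite /pull /= rq_piD; exact: spec_idealD.
- by move=> a b qb; rewrite /pull /= rq_piM; exact: spec_idealM.
- by rewrite /pull /= rq_pi1; have [+ _] := spec_prime q.
- by move=> a b; rewrite /pull /= rq_piM; exact: spec_primeM.
Qed.

Lemma pull_sub q : I `<=` pull q.
Proof. by move=> b Ib; rewrite /pull /= rq_pi_eq0//; exact: spec_ideal0. Qed.

Lemma pull_le (p q : spec R) : p `<=` q <-> pull p `<=` pull q.
Proof.
split=> [pq b|pq]; first exact: pq.
by elim/rq_ind=> b; exact: (pq b).
Qed.

Lemma pull_lt (p q : spec R) : (p : set R) `<` q <-> pull p `<` pull q.
Proof.
by split=> -[pq qp]; split; try exact/pull_le; move=> H; apply: qp; exact/pull_le.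
Qed.

Lemma pull_surj (P : set B) : prim P -> I `<=` P -> exists q, pull q = P.
Proof.
move=> PP IP.
have PE x : P x <-> P (rq_repr (pi x)).
  have /IP Pd : (I : set B) (rq_repr (pi x) - x).
    by have := rq_reprP I x; rewrite unfold_in inE.
  split=> Px; first by rewrite -[rq_repr _](subrK x); exact: (idlD PP).
  by rewrite -[x](subrK (rq_repr (pi x))) -opprB; apply: (idlD PP) => //; exact: (idlN PP).
have PE1 x : P x -> P (rq_repr (pi x)) by move/PE.
have PE2 x : P (rq_repr (pi x)) -> P x by move=> H; apply/PE.
have [||||a b|q qE] := @mk_spec R [set x | P (rq_repr x)].
- have -> : 0 = pi 0.
    by rewrite rq_pi_eq0//; exact: (submod_mem0 (ideal_closed I)).
  by apply: PE1; exact: (idl0 PP).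
- elim/rq_ind=> a; elim/rq_ind=> b /PE2 Pa /PE2 Pb.
  by rewrite -rq_piD; apply: PE1; exact: (idlD PP).
- elim/rq_ind=> a; elim/rq_ind=> b /PE2 Pb.
  by rewrite -rq_piM; apply: PE1; exact: (idlM PP).
- by rewrite -rq_pi1 => /PE2/(prim1 PP).
- elim/rq_ind: a => a; elim/rq_ind: b => b; rewrite -rq_piM => /PE2/(primM PP).
  by move=> [Pa|Pb]; [left|right]; apply: PE1.
exists q; apply/seteqP; split=> b; rewrite /pull /= qE; [exact: PE2|exact: PE1].
Qed.

End Quotient.

(** * Purity *)

(** [I] and [ann H] need only lie in the same primes, so [H] may come from another filtration than
    [I]. Each component is given by a minimal prime over [ann H] and has dimension [d]. *)
Lemma pure_of_module (K : realType) (k : fieldType) (B : comAlgType k) (I : ideal B)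
    (H : lmodType B) (z : nat -> B) (d : nat) :
  fgen (ev z d) [set: H] -> (forall x : H, tors z d x -> x = 0) ->
  (forall P : set B, prim P -> I `<=` P <-> ann H `<=` P) ->
  pure_dimensional (spec (ring_quot I)) K.
Proof.
move=> Hfg tf IH.
suff dimE (Z : set (spec (ring_quot I))) : irreducible_component Z ->
    krull_dim K Z = d%:R%:E.
  by move=> Z Z' /dimE -> /dimE ->.
move=> Zc; have [q -> qmin] := irreducible_componentP Zc.
have aq (p : spec (ring_quot I)) : ann H `<=` pull p.
  by apply/IH; [exact: pull_prim|exact: pull_sub].
have zI : indep_mod (pull q) z d.
  apply: (min_prim_indep tf) => //; first exact: pull_prim.
  move=> Q QP aQ Qq; have /(pull_surj QP)[p pQ] : I `<=` Q by apply/(IH Q QP).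
  by rewrite -pQ; apply: (pull_le q p).1; apply: qmin; apply/pull_le; rewrite pQ.
have [Q [Q0 QP QS]] : exists Q : nat -> set B, [/\ Q 0%N = pull q,
    forall i, (i <= d)%N -> prim (Q i) & forall i, (i < d)%N -> Q i `<` Q i.+1].
  apply: prim_chain zI _; first exact: pull_prim.
  by move=> b; have [f fm fa] := integral_mod_ann Hfg b; exists f => //; exact: aq.
apply/eqP; rewrite eq_le; apply/andP; split.
  apply: krull_dim_le => n P qP PS.
  apply: (prim_chain_le Hfg (Q := fun i => pull (P i))) => [|i _|i /PS].
  - exact: aq.
  - exact: pull_prim.
  - by move/pull_lt.
have Qq i : (i <= d)%N -> pull q `<=` Q i.
  elim: i => [_|i IHi id]; first by rewrite Q0.
  by apply: subset_trans (IHi (ltnW id)) _; have [] := QS i id.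
have /choice[P PE] i : exists p : spec (ring_quot I), (i <= d)%N -> pull p = Q i.
  have [id|di] := leqP i d; last by exists q.
  have /(pull_surj (QP i id))[p pQ] : I `<=` Q i; last by exists p.
  by move=> x Ix; apply: (Qq i id); exact: pull_sub.
apply: (krull_dim_ge K (Q := P)).
  by apply/pull_le; rewrite PE//; exact: Qq.
by move=> i id; apply/pull_lt; rewrite !PE//; [exact: QS|exact: ltnW].
Qed.

Section TorsionChange.
Variables (k : fieldType) (B : comAlgType k) (G : lmodType B).
Implicit Types (y z : nat -> B).

Lemma fgen_range y z n m (U : set G) : bsub U ->
  (forall i, (i < n)%N -> range (ev z m) (y i)) ->
  fgen (ev y n) U -> fgen (ev z m) U.
Proof.
move=> US yz [I [e UE]]; exists I, e; apply/seteqP; split; last first.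
  apply: rspan_min => [|i]; first exact: bsub_rsub.
  by rewrite UE; exact: rspan_gen.
move=> x; rewrite UE => -[c ->].
apply: rsub_sum => [|i _]; first exact: rspan_sub.
have [|p _ <-] := range_ev_sub yz (t := ev y n (c i)); first by eexists.
by have [_ _ Z] := rspan_sub (ev z m) e; apply: Z; exact: rspan_gen.
Qed.

(** The multiples of [x] form a module finite over [m] variables, where no orbit under [m.+1]
    variables is free, whichever they are. *)
Lemma tors_change y z m (x : G) : fgen (ev z m.+1) [set: G] ->
  tors z m.+1 x -> tors y m.+1 x.
Proof.
move=> Gfg tx; apply/torsPn => yx.
pose W : set G := range (fun b => b *: x).
have WS : bsub W.
  split; first by exists 0 => //; rewrite scale0r.
    by move=> _ _ [a _ <-] [b _ <-]; exists (a + b) => //; rewrite scalerDl.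
  by move=> c _ [a _ <-]; exists (c * a) => //; rewrite scalerA.
have Wfg : fgen (ev z m.+1) W by apply: fgen_sub Gfg _ _ => //; exact: bsub_rsub.
have [|z' z'W] := tors_fgen WS Wfg; first by move=> _ [b _ <-]; exact: torsZ.
have Wx : W x by exists 1 => //; rewrite scale1r.
by have := free_orbit_dim WS z'W Wx yx; rewrite ltnn.
Qed.

End TorsionChange.

Section Annihilators.
Variables (k : fieldType) (A : algType k) (F : filtration A).
Variables (grC : commutative (@GRing.mul (gr F))).
Variables (h : ring_grading (com_gr grC)) (hE : hm h = gr_homog (grC := grC)).
Variables (M : lmodType A) (FM FN : mod_filtration F M).
Local Notation B := (com_gr grC).

Lemma ann_homog (FP : mod_filtration F M) i a : F i a ->
  ann (cgr_mod grC FP) (asym F i a) <-> forall j u, FP j u -> FP (i + j - 1) (a *: u).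
Proof.
move=> Fa; split=> [H j u Fu|H x].
  by apply/(sym_eq0 grC (mfiltZ Fa Fu)); rewrite -symZ// H.
have [r [_ _ ->]] := gcomp_dec x; rewrite scaler_sumr big1// => j _.
have [u Fu ->] := gcompE j x; rewrite symZ//; apply/sym_eq0; first exact: mfiltZ.
exact: H.
Qed.

Lemma ann_comp (b : rees F) q : ann (cgr_mod grC FM) (cgr_pi grC b) ->
  ann (cgr_mod grC FM) (asym F q (b q)).
Proof.
move=> H; have Fq : F q (b q) by exact: rees_filt.
apply/(ann_homog FM Fq) => j u Fu; apply/(sym_eq0 grC); first by apply: mfiltZ => //; exact: rees_filt.
by rewrite -(gcomp_pi_sym hE)// H gcomp0.
Qed.

(** A homogeneous element annihilating [gr FM] gains one degree with each application; a high enough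
    power overcomes the shifts and annihilates [gr FN], and [P] is prime. *)
Lemma ann_shift (p p' : nat) (P : set B) :
  (forall j, FN j `<=` FM (j + p%:Z)) -> (forall j, FM j `<=` FN (j + p'%:Z)) ->
  prim P -> ann (cgr_mod grC FN) `<=` P -> ann (cgr_mod grC FM) `<=` P.
Proof.
move=> NM MN PP aP b Mb.
have bE : cgr_pi grC (gr_repr b) = b by exact: gr_reprK.
have [r ur br] := fin_supp_seq (rees_supp (gr_repr b)).
have -> : b = \sum_(q <- r) (asym F q (gr_repr b q) : B).
  by rewrite -[LHS]bE; exact: gr_piE.
apply: (@idl_sum B) => [|q _]; first exact: PP.
have Fq : F q (gr_repr b q) by exact: rees_filt.
set a := gr_repr b q in Fq *.
have Ma : ann (cgr_mod grC FM) (asym F q a) by apply: ann_comp; rewrite bE.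
have MaX l j u : FM j u -> FM (q *+ l + j - l%:Z) (a ^+ l *: u).
  move=> Fu; elim: l => [|l IH]; first by rewrite mulr0n add0r subr0 scale1r.
  rewrite exprS -scalerA; have := (ann_homog FM Fq).1 Ma _ _ IH.
  by apply: mfilt_le; rewrite mulrS; lia.
(* [p] to pass from [FN] to [FM], [p'] to come back, and one more to annihilate the symbol. *)
pose l := (p + p').+1.
apply: (primX (n := l) PP); apply: aP.
have aX n : (asym F q a : B) ^+ n = asym F (q *+ n) (a ^+ n).
  elim: n => [|n IH]; first by rewrite expr0 mulr0n asym1.
  by rewrite exprS IH [LHS]asymM ?mulrS ?exprS//; exact: filtX.
rewrite aX; apply/(ann_homog FN (filtX l Fq)) => j u /NM Fu; have /MN := MaX l _ _ Fu.
by apply: mfilt_le; rewrite /l; lia.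
Qed.

End Annihilators.

Lemma char_idealP (k : fieldType) (A : algType k) (F : filtration A)
    (grC : commutative (@GRing.mul (gr F))) (M : lmodType A)
    (FM : mod_filtration F M) (P : set (com_gr grC)) : prim P ->
  char_ideal grC FM `<=` P <-> ann (cgr_mod grC FM) `<=` P.
Proof.
move=> PP; split=> H b Hb; first by apply: H => Q [_]; apply; exact: Hb.
have PI : submod_closed (mem (P : set (com_gr grC)^o)).
  split=> [|c u v]; rewrite !inE; first exact: (idl0 PP).
  by move=> Pu Pv; apply: (idlD PP) => //; exact: (idlM PP).
apply: (Hb (Ideal PI)); split=> //.
by split; [exact: prim1|exact: primM].
Qed.

Theorem theorem0p4 (K : realType) (k : fieldType) (A : algType k)
    (F : filtration A) (grC : commutative (@GRing.mul (gr F)))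
    (gr_connected : connected_graded F) (gr_affine : affine_algebra (gr F))
    (M : lmodType A) (M_fg : finitely_generated M) (M_pure : GKdim_pure K M)
    (FM : mod_filtration F M) (FM_good : good_filtration FM) :
  pure_dimensional (char_variety grC FM) K.
Proof.
have [h hE] := gr_ring_grading grC gr_connected gr_affine.
have Efg0 := cgr_mod_fgen h FM_good.
have ES : bsub [set: cgr_mod grC FM] by [].
case: (normalization ES Efg0) => [E0|[d [y [g [_ Efg yg]]]]].
  (* When [gr M = 0] the variety is empty, so it has no component. *)
  have a1 : ann (cgr_mod grC FM) 1.
    by move=> x; have : [set: cgr_mod grC FM] x by []; rewrite E0 => ->; rewrite scaler0.
  move=> Z Z' [[[q _] _] _]; exfalso.
  have qP := pull_prim q; apply: (prim1 qP).
  by apply: (char_idealP FM qP).1 a1; exact: pull_sub.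
have [tf|ntf] := pselect (forall x : cgr_mod grC FM, tors y d x -> x = 0).
  by apply: pure_of_module Efg tf _ => P PP; exact: char_idealP.
case: d => [|m] in Efg yg ntf *.
  by exfalso; apply: ntf => x; exact: tors_zero.
have yfg : fgen (ev y m.+1) (tors y m.+1 : set (cgr_mod grC FM)).
  by apply: fgen_sub Efg _ _ => //; apply: bsub_rsub; exact: tors_bsub.
have [f0 f00 f0T] := tors_ann yfg (fun x tx => tx).
have [z [c [a [yz c0 am aE]]]] := nagata y f00.
have Ezfg : fgen (ev z m.+1) [set: cgr_mod grC FM] by exact: fgen_range yz Efg.
(* [f0] was chosen for torsion over [y], whereas [a] is needed for torsion over [z]. *)
have fT (x : cgr_mod grC FM) : tors z m.+1 x -> ev z m.+1 a *: x = 0.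
  by move=> /(tors_change y Ezfg)/f0T fx; rewrite aE -mulr_algl -scalerA fx scaler0.
pose rho := gr_repr (ev z m.+1 a : com_gr grC).
have fE : cgr_pi grC rho = ev z m.+1 a by exact: gr_reprK.
have fT' (x : cgr_mod grC FM) : tors z m.+1 x -> cgr_pi grC rho *: x = 0.
  by rewrite fE; exact: fT.
have TS : bsub (tors z m.+1 : set (cgr_mod grC FM)) by exact: tors_bsub.
have Tg : gsub (gr_mod_grading hE FM) (tors z m.+1).
  by move=> n x tx; apply: (tors_comp (U := setT)).
have Tfg : fgen (ev z m) (tors z m.+1 : set (cgr_mod grC FM)).
  apply: (nagata_fgen (y := z) TS _ _ am fT).
    by apply: fgen_sub Ezfg _ _ => //; exact: bsub_rsub.
  by move=> i im; have [p pE] := ev_var (com_gr grC) im; exists p.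
have [e Me] := mfilt_below hE Ezfg.
have sep u : (forall j, sat_filt FM rho j u) -> u = 0.
  move=> su; apply: contrapT => u0.
  pose N : set M := [set v | forall j, sat_filt FM rho j v].
  have NS : submod_closed (mem N).
    split=> [|b v w]; rewrite !inE; first by move=> j; exact: sat_filt0.
    move=> Nv Nw j; apply: sat_filtD => //; have [i Fb] := filt_ex F b.
    by rewrite -[j](subrK i) [j - i + i]addrC; exact: sat_filtZ.
  have N0 : N <> [set 0] by move=> N0; apply: u0; have : N u by []; rewrite N0.
  have [C CP] := filt_growth (hE := hE) (N := N) Tfg TS Tg
    (fun n v Nv Fv => tors_of_sat fE am Fv (Nv (n - 1)))
    (submod_mem0 NS) (submod_memD NS) (fun c v => submod_memZ NS c%:A (u := v)) Me.
  (* Purity would force [m + 1/2 <= GKdim M = GKdim N <= m + 1/4]. *)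
  have := GKdim_le K NS CP; rewrite (M_pure _ NS N0).
  move=> /(le_trans (GKdim_ge K hE Efg yg)); rewrite lee_fin lerD2l.
  by rewrite lef_pV2 ?posrE ?ltr0n// ler_nat.
have tf := tfree hE fE am Ezfg fT' (sep := sep).
have Hfg := saturation_fgen hE fE am Ezfg fT' sep.
have [p pP] := saturation_bounded hE fE am Ezfg fT' sep (mfilt_fin hE Ezfg).
apply: pure_of_module Hfg tf _ => P PP; rewrite (char_idealP FM PP); split.
  apply: (ann_shift hE (p := 0) (p' := p)) PP => j; rewrite ?addr0; last exact: pP.
  exact: sub_sat_filt.
apply: (ann_shift hE (p := p) (p' := 0)) PP => j; rewrite ?addr0; first exact: pP.
exact: sub_sat_filt.
Qed.
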